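(* For any probability distribution $G=\{g_k\}_{k\ge 1}$ on $\mathbb{N}=\{1,2,\dots\}$ there exist a stationary discrete-time real-valued process $\{X_k\}_{k\ge 0}$ and an increasing sequence of real numbers $\{u_n\}_{n\ge 1}$ such that the time-scaled point processes of exceedances $$N_n(A) := \#\{k\ge 0 : \ k/n\in A,\ X_k>u_n\},\qquad A\in\mathcal{B}(\mathbb{R}_+),$$ converge in distribution, as $n\to\infty$, to a compound Poisson process on $\mathbb{R}_+$ with compounding law $G$.
   Context: Here $\mathbb{R}_+=[0,\infty)$ and $\mathcal{B}(\mathbb{R}_+)$ is its Borel $\sigma$-algebra. A process $\{X_k\}_{k\ge 0}$ is stationary if for every $l\ge 1$ the processes $\{X_k\}_{k\ge 0}$ and $\{X_{l+k}\}_{k\ge 0}$ have the same distribution. No moment assumption is made on $G$: its mean $\sum_{k\ge1} k g_k$ may be finite or infinite. A compound Poisson process on $\mathbb{R}_+$ with compounding law $G$ is the point process $N(A)=\sum_{i\ge 1}\zeta_i\mathbf{1}\{T_i\in A\}$, where $T_1<T_2<\cdots$ are the points of a homogeneous Poisson process on $\mathbb{R}_+$ with some rate $\lambda\in(0,\infty)$, and $\zeta_1,\zeta_2,\dots$ are i.i.d. random variables with distribution $G$, independent of $\{T_i\}$. Convergence is the usual weak convergence (convergence in distribution) of point processes on $\mathbb{R}_+$, i.e. convergence in distribution of random locally finite counting measures with respect to the vague topology. *)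

(* Defs.v *)
From HB Require Import structures.
From mathcomp Require Import all_boot all_order all_algebra.
From mathcomp Require Import all_classical all_reals all_analysis.
From mathcomp Require Import measurable_realfun.

Set Implicit Arguments.
Unset Strict Implicit.
Unset Printing Implicit Defensive.

Import Order.TTheory GRing.Theory Num.Theory.
Import numFieldNormedType.Exports.

Local Open Scope classical_set_scope.
Local Open Scope ring_scope.

(* Locally finite counting measures on [0, +oo[, represented as measures on
   the Borel sets of R that do not charge the negative half-line. *)
Record counting_measure (R : realType) := CountingMeasure {
  cm_measure :> {measure set (measurableTypeR R) -> \bar R};
  cm_support : cm_measure [set x : R | x < 0] = 0%E;
  cm_locally_finite : forall b : R, (cm_measure `[0%R, b]%classic < +oo)%E;
  cm_integer : forall A : set (measurableTypeR R), measurable A ->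
    (cm_measure A < +oo)%E -> exists m : nat, cm_measure A = m%:R%:E }.

HB.instance Definition _ (R : realType) := gen_eqMixin (counting_measure R).
HB.instance Definition _ (R : realType) := gen_choiceMixin (counting_measure R).

(* Nonnegative continuous functions on [0, +oo[ with compact support; the
   values off [0, +oo[ are irrelevant. *)
Record test_function (R : realType) := TestFunction {
  test_fun :> R -> R;
  test_continuous : {within `[0, +oo[, continuous test_fun};
  test_ge0 : forall x, 0 <= x -> 0 <= test_fun x;
  test_compact_support : exists b : R, forall x, b < x -> test_fun x = 0 }.

HB.instance Definition _ (R : realType) := gen_eqMixin (test_function R).
HB.instance Definition _ (R : realType) := gen_choiceMixin (test_function R).

Definition vague_integral (R : realType) (mu : counting_measure R) :
    {ptws test_function R -> R} :=
  fun f => (\int[mu]_(x in `[0, +oo[) f x)%R.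

(* The vague topology: the coarsest topology making mu |-> \int f dmu
   continuous for every test function f. *)
HB.instance Definition _ (R : realType) :=
  Topological.copy (counting_measure R)
    (initial_topology (@vague_integral R)).

(* Measurability with respect to the sigma-algebra generated by the
   evaluations mu |-> mu A, which is the Borel sigma-algebra of the vague
   topology. *)
Definition point_process d (Omega : measurableType d) (R : realType)
    (N : Omega -> counting_measure R) :=
  forall A : set (measurableTypeR R), measurable A ->
    measurable_fun [set: Omega] (fun w => N w A : \bar R).

(* The point processes may live on different probability spaces. *)
Definition cvg_in_distribution d (Omega : measurableType d)
    d' (Omega' : measurableType d') (R : realType)
    (P : probability Omega R) (P' : probability Omega' R)
    (Nn : nat -> Omega -> counting_measure R)
    (N : Omega' -> counting_measure R) :=
  [/\ forall n, point_process (Nn n),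
      point_process N &
      forall phi : counting_measure R -> R, continuous phi ->
        (exists C : R, forall mu, `|phi mu| <= C) ->
        ('E_P[phi \o Nn n] @[n --> \oo] --> 'E_P'[phi \o N])%E].

Definition product_sigma_algebra d (E : measurableType d) :
    set_system (nat -> E) :=
  <<s \bigcup_i preimage_set_system [set: nat -> E] (fun x => x i) measurable >>.

Definition stationary d (Omega : measurableType d) (R : realType)
    (P : probability Omega R) (X : nat -> {RV P >-> R}) :=
  forall l : nat, (1 <= l)%N ->
  forall A : set (nat -> R), product_sigma_algebra A ->
    P [set w | A (fun k => X (l + k)%N w)] = P [set w | A (fun k => X k w)].

Definition independent_seq d (Omega : measurableType d) (R : realType)
    (P : probability Omega R) d' (E : measurableType d')
    (Y : nat -> {RV P >-> E}) :=
  forall (m : nat) (B : nat -> set E), (forall i, measurable (B i)) ->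
    P (\bigcap_(i < m) (Y i @^-1` B i)) =
    (\prod_(i < m) P (Y i @^-1` B i))%E.

Definition independent_processes d (Omega : measurableType d) (R : realType)
    (P : probability Omega R)
    d1 (E1 : measurableType d1) (Y : nat -> {RV P >-> E1})
    d2 (E2 : measurableType d2) (Z : nat -> {RV P >-> E2}) :=
  forall (A : set (nat -> E1)) (B : set (nat -> E2)),
    product_sigma_algebra A -> product_sigma_algebra B ->
    P ([set w | A (fun k => Y k w)] `&` [set w | B (fun k => Z k w)]) =
    (P [set w | A (fun k => Y k w)] * P [set w | B (fun k => Z k w)])%E.

(* T 0 < T 1 < ... are the points of a homogeneous Poisson process on
   [0, +oo[: the numbers of points in consecutive intervals
   [t 0, t 1[, [t 1, t 2[, ... are independent Poisson variables. *)
Definition poisson_points d (Omega : measurableType d) (R : realType)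
    (P : probability Omega R) (lambda : R) (T : nat -> {RV P >-> R}) :=
  [/\ {ae P, forall w, 0 <= T 0%N w},
      {ae P, forall w, increasing_seq (fun i => T i w)} &
      forall t : nat -> R, t 0%N = 0 -> increasing_seq t ->
      forall (m : nat) (c : nat -> nat),
        P (\bigcap_(i < m)
             [set w | counting [set k | T k w \in `[t i, t i.+1[]
                      = (c i)%:R%:E :> \bar R]) =
        (\prod_(i < m) poisson_pmf (lambda * (t i.+1 - t i)) (c i))%:E].

Definition compound_poisson d (Omega : measurableType d) (R : realType)
    (P : probability Omega R) (g : nat -> R)
    (N : Omega -> counting_measure R) :=
  exists (lambda : R) (T : nat -> {RV P >-> R}) (zeta : nat -> {RV P >-> nat}),
    [/\ 0 < lambda /\ poisson_points lambda T,
        independent_seq zeta,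
        forall i k, (1 <= k)%N -> P (zeta i @^-1` [set k]) = (g k)%:E,
        independent_processes zeta T &
        {ae P, forall w, forall A : set (measurableTypeR R), measurable A ->
          N w A = (\sum_(i <oo) (zeta i w)%:R%:E * (\1_A (T i w))%:E)%E}].

Section exceedances.
Variables (R : realType) (n : nat) (x : nat -> R) (v : R).

Definition exceedances (A : set (measurableTypeR R)) : \bar R :=
  counting [set k : nat | A (k%:R / n%:R) /\ v < x k].

Let level : set nat := [set k | v < x k].

Let exceedancesE A : exceedances A = mrestr (@counting nat R)
  (I : measurable level) ((fun k : nat => k%:R / n%:R : R) @^-1` A).
Proof. by []. Qed.

Let exceedances0 : exceedances set0 = 0%E.
Proof. by rewrite exceedancesE preimage_set0 measure0. Qed.

Let exceedances_ge0 A : (0 <= exceedances A)%E.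
Proof. by rewrite exceedancesE measure_ge0. Qed.

Let exceedances_sigma_additive : semi_sigma_additive exceedances.
Proof.
move=> F mF tF mUF; rewrite exceedancesE preimage_bigcup.
apply: measure_semi_sigma_additive => //.
apply/trivIsetP => /= i j _ _ ij; rewrite -preimage_setI.
by move/trivIsetP : tF => /(_ _ _ _ _ ij) ->//; rewrite preimage_set0.
Qed.

HB.instance Definition _ := isMeasure.Build _ _ _ exceedances
  exceedances0 exceedances_ge0 exceedances_sigma_additive.

Lemma exceedances_support : exceedances [set y : R | y < 0] = 0%E.
Proof.
rewrite /exceedances (_ : [set k | _] = set0) ?measure0//.
apply/seteqP; split=> k //= [+ _].
by rewrite ltNge divr_ge0.
Qed.

Lemma exceedances_locally_finite (b : R) :
  (0 < n)%N -> (exceedances `[0%R, b]%classic < +oo)%E.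
Proof.
move=> n0; rewrite /exceedances /counting asboolT ?ltry//.
have [m bm] : exists m : nat, b * n%:R < m%:R.
  by exists (Num.bound `|b * n%:R|); exact: le_lt_trans (ler_norm _) (archi_boundP _).
apply: (@sub_finite_set _ _ `I_m); last exact: finite_II.
move=> k /= [+ _]; rewrite in_itv/= => /andP[_].
rewrite ler_pdivrMr ?ltr0n// => kb.
by rewrite -(ltr_nat R); exact: le_lt_trans kb bm.
Qed.

Lemma exceedances_integer (A : set (measurableTypeR R)) : measurable A ->
  (exceedances A < +oo)%E -> exists m : nat, exceedances A = m%:R%:E.
Proof. by move=> _; rewrite /exceedances /counting; case: ifP => // _ _; eexists. Qed.

End exceedances.

Definition exceedance_process (R : realType) (n : nat) (n0 : (0 < n)%N)
    (x : nat -> R) (v : R) : counting_measure R :=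
  @CountingMeasure R (@exceedances R n x v)
    (exceedances_support n x v)
    (fun b => exceedances_locally_finite x v b n0)
    (@exceedances_integer R n x v).

(* Main.v *)
Require Import Defs.
From HB Require Import structures.
From mathcomp Require Import all_boot all_order all_algebra.
From mathcomp Require Import all_classical all_reals all_analysis.
From mathcomp Require Import measurable_realfun.
From mathcomp Require Import ring lra zify.

(** The process is assembled from clumps. Attach to every index [i] an independent
    pair (U_i, Z_i), where U_i is uniform on [0, 1] and Z_i has law G. At level p
    the index [i] is a seed if U_i < p, and a seed makes the Z_i indices that end
    at [i] exceed. Accordingly, X_k is minus the infimum of 1 and of the U_(k+h)
    over those h for which the clump is long enough, h < Z_(k+h), and
    U_(k+h) < 2^-h ([clump_process]). The last condition costs nothing for small p,
    when U_(k+h) < p implies it for any bounded h, but it makes distant seeds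
    summably rare, so that infinite means are allowed. Being a function of a shifted
    i.i.d. sequence, X is stationary ([clump_process_stationary]).

    With the level p of order 1/n ([level]), seeds in a window of length of order n
    are rare and far apart. Outside an event of vanishing probability
    ([bad_bound]), the number of exceedances in a cell of a grid is the sum of the
    marks Z_i 1(U_i < p) over the indices of the cell ([exceedances_off_bad]).
    These sums are independent and their laws are binomial mixtures of convolution
    powers of G; the Poisson limit theorem gives compound Poisson limits
    ([cvg_compound]).

    The limit process places i.i.d. marks of law G at the points of a Poisson
    process of rate 1. The points are partial sums of exponential gaps, and the
    Poisson law of the counts in consecutive intervals follows from the memoryless
    property ([step_law], [arrival_law]). Its cell counts are independent with the
    same compound Poisson laws ([cells_law]).

    Weak convergence for the vague topology then follows from the convergence of
    the joint laws of the counts on all grids ([cvg_in_distribution_cells]): a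
    bounded continuous function is the pointwise limit of its suprema over
    measures with prescribed counts, because measures with the same counts on finer
    and finer grids converge vaguely ([same_grid_cvg]).

    Every i.i.d. sequence is extracted from one uniform number: splitting its
    binary digits into those of even and of odd rank yields two independent uniform
    numbers, hence by iteration an i.i.d. sequence ([exists_uniform_sequence]). *)

Set Implicit Arguments.
Unset Strict Implicit.
Unset Printing Implicit Defensive.
Import Order.TTheory GRing.Theory Num.Theory.
Import numFieldNormedType.Exports.
Local Open Scope classical_set_scope.
Local Open Scope ring_scope.

(** * Laws on the line and the uniform distribution *)

Section ray_uniqueness.
Context d1 (O1 : measurableType d1) d2 (O2 : measurableType d2) (R : realType).
Variables (P1 : probability O1 R) (P2 : probability O2 R).

(** Half-lines are stable under intersection and generate the Borel sets. The
    event [E] and the weight [c] let the lemma compare a law restricted to an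
    event with a multiple of another law, which covers independence,
    self-similarity and memorylessness at once. *)
Lemma eq_law_ray (f1 : O1 -> measurableTypeR R) (f2 : O2 -> measurableTypeR R)
    (E : set O1) (c : R) :
  measurable_fun setT f1 -> measurable_fun setT f2 -> measurable E -> 0 <= c ->
  (forall x, P1 (f1 @^-1` `]-oo, x[ `&` E) = (c%:E * P2 (f2 @^-1` `]-oo, x[))%E) ->
  forall B, measurable B -> P1 (f1 @^-1` B `&` E) = (c%:E * P2 (f2 @^-1` B))%E.
Proof.
move=> mf1 mf2 mE c0 H B mB.
pose q1 : {measure set (measurableTypeR R) -> \bar R} :=
  [the {measure set _ -> \bar R} of pushforward (mrestr P1 mE) f1].
pose q2 : {measure set (measurableTypeR R) -> \bar R} :=
  [the {measure set _ -> \bar R} of pushforward P2 f2].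
pose m1 := q1 mf1.
pose m2 : {measure set (measurableTypeR R) -> \bar R} :=
  [the {measure set _ -> \bar R} of mscale (NngNum c0) (q2 mf2)].
have fin (x : R) : (m1 `]-oo, x[%classic < +oo)%E.
  rewrite /m1 /= /pushforward /mrestr; apply: le_lt_trans (ltry 1).
  apply: probability_le1; apply: measurableI => //.
  by rewrite -[X in measurable X]setTI; exact: (mf1).
have main := @measure_unique _ R (measurableTypeR R) (@RGenInftyO.G R)
  (fun k => `]-oo, k%:R[%classic) _ _ _ _ m1 m2 _ _ B mB.
apply: main => //.
- exact: RGenInftyO.measurableE.
- move=> _ _ [x ->] [y ->]; exists (Order.min x y).
  by apply/seteqP; split=> z /=; rewrite !in_itv/= lt_min => /andP.
- by move=> i; exists i%:R.
- apply/seteqP; split=> // x _; exists (Num.bound `|x|) => //=.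
  by rewrite in_itv/=; exact: le_lt_trans (ler_norm _) (archi_boundP _).
- by move=> _ [x ->]; exact: H.
Qed.

End ray_uniqueness.

(** The distribution function of the uniform law on [0, 1]. *)
Definition clamp (R : realType) (x : R) : R := Num.min (Num.max x 0) 1.

Section unit_interval.
Variable R : realType.
Let P : probability (measurableTypeR R) R := uniform_prob (@ltr01 R).

Lemma uniform01_itv (x y : R) : 0 <= x -> y <= 1 -> x <= y ->
  P `[x, y[%classic = (y - x)%:E.
Proof.
move=> x0 y1 xy; rewrite /P/= /uniform_prob.
rewrite (eq_integral (cst 1%E)); last first.
  move=> z; rewrite inE/= /uniform_pdf subr0 invr1 => /itvP zxy.
  by have -> : 0 <= z <= 1 
    by apply/andP; split; [apply: le_trans x0 _|apply: le_trans y1]; rewrite zxy.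
rewrite integral_cst//= mul1e lebesgue_measure_itv/= lte_fin.
by case: ltP => // yx; rewrite (le_anti (introT andP (conj xy yx))) subrr.
Qed.

Lemma uniform01_setC : P (~` `[0, 1[%classic) = 0%E.
Proof.
rewrite probability_setC//.
by rewrite [X in (1 - X)%E]uniform01_itv// subr0 subee.
Qed.

Lemma uniform01_core (A : set (measurableTypeR R)) : measurable A ->
  P A = P (A `&` `[0, 1[%classic).
Proof.
move=> mA; rewrite -[in LHS](setIT A) -(setUv `[0, 1[%classic) setIUr measureU//.
- rewrite [X in (_ + X)%E](_ : _ = 0%E) ?adde0//.
  apply/eqP; rewrite -measure_le0 -uniform01_setC le_measure ?inE//.
  + by apply: measurableI => //; exact: measurableC.
  + exact: measurableC.
- exact: measurableI.
- by apply: measurableI => //; exact: measurableC.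
- by rewrite setIACA setICr setI0.
Qed.

Lemma uniform01_ray (x : R) : P `]-oo, x[%classic = (clamp x)%:E.
Proof.
rewrite uniform01_core//; have [x0|x0] := leP x 0.
  rewrite (_ : _ `&` _ = set0) ?measure0 /clamp.
    by rewrite (max_idPr x0) (min_idPl ler01).
  apply/seteqP; split=> // z /=; rewrite !in_itv/= => -[zx /andP[z0 _]].
  by move: (le_lt_trans z0 zx); rewrite ltNge x0.
rewrite (_ : _ `&` _ = `[0, clamp x[%classic).
  rewrite uniform01_itv// ?subr0// /clamp (max_idPl (ltW x0)).
    by rewrite ge_min lexx orbT.
  by rewrite le_min (ltW x0)/=.
apply/seteqP; split=> z /=; rewrite !in_itv/= /clamp lt_min (max_idPl (ltW x0)).
  by case=> -> /andP[-> ->].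
by move=> /and3P[-> -> ->].
Qed.

(** Conditioned on a subinterval, a uniform variable is again uniform after
    rescaling; this is what makes binary digits independent. *)
Lemma uniform01_affine (c a : R) (B : set (measurableTypeR R)) :
  0 <= c -> 0 < a -> c + a <= 1 -> measurable B ->
  P ([set x | (x - c) / a \in B] `&` `[c, c + a[%classic) = (a%:E * P B)%E.
Proof.
move=> c0 a0 ca1 mB.
have mf : measurable_fun setT (fun x : measurableTypeR R => (x - c) / a : measurableTypeR R).
  by apply: measurable_funM => //; apply: measurable_funB.
have -> : [set x | (x - c) / a \in B] = (fun x => (x - c) / a) @^-1` B.
  by apply/seteqP; split=> x /=; rewrite inE.
apply: (@eq_law_ray _ _ _ _ R P P (fun x => (x - c) / a) id) => //.
- exact: ltW.
- move=> x; rewrite preimage_id uniform01_ray.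
  rewrite (_ : _ `&` _ = `[c, c + a * clamp x[%classic).
    rewrite uniform01_itv ?lerDl//.
    + by rewrite addrC addKr EFinM.
    + by apply: le_trans ca1; rewrite lerD2l ger_pMr// /clamp ge_min lexx orbT.
    + by apply: mulr_ge0; [exact: ltW|rewrite /clamp le_min ler01 le_max lexx orbT].
  have a0' := ltW a0.
  have -> : a * clamp x = Num.min (Num.max (a * x) 0) a.
    by rewrite /clamp minr_pMr// maxr_pMr// mulr0 mulr1.
  apply/seteqP; split=> z /=; rewrite !in_itv/= ltr_pdivrMr// -!ltrBlDl lt_min lt_max (mulrC x).
    by move=> [h /andP[h1 h2]]; rewrite h1 h h2.
  by move=> /andP[h1 /andP[/orP[h2|h2] h3]]; [split=> //; apply/andP|move: h2 h1; lra].
Qed.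

End unit_interval.

(** * An i.i.d. sequence of uniform variables *)

(** The sequence [fun i w => Y (iter i th w)] is i.i.d. as soon as [Y] is
    independent of [th] and [th] preserves [P]. The preservation of [P] is the
    case [A = setT]; by iteration, both facts yield the law of every finite
    block of the sequence without any infinite product space. *)
Definition iid_shift d (O : measurableType d) (R : realType) (P : probability O R)
    d' (E : measurableType d') (Y : O -> E) (th : O -> O) :=
  [/\ measurable_fun setT Y, measurable_fun setT th &
    forall A B, measurable A -> measurable B ->
      P (Y @^-1` A `&` th @^-1` B) = (P (Y @^-1` A) * P B)%E].

Lemma preimageT_measurable d d' (O : measurableType d) (E : measurableType d')
    (f : O -> E) (A : set E) :
  measurable_fun setT f -> measurable A -> measurable (f @^-1` A).
Proof. by move=> mf mA; rewrite -[X in measurable X]setTI; exact: (mf). Qed.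

Lemma measurable_iter d (O : measurableType d) (f : O -> O) n :
  measurable_fun setT f -> measurable_fun setT (iter n f).
Proof.
by move=> mf; elim: n => [|n IH]; [exact: measurable_id|exact: measurableT_comp mf IH].
Qed.

Section uniform_sequence.
Variable R : realType.
Let P : probability (measurableTypeR R) R := uniform_prob (@ltr01 R).

(* First binary digit, and the map that forgets it. *)
Let bit (x : measurableTypeR R) : bool := 2^-1 <= x.
Let D (x : measurableTypeR R) : measurableTypeR R :=
  if bit x then 2 * x - 1 else 2 * x.

Let mbit : measurable_fun setT bit.
Proof. by apply: measurable_fun_ler. Qed.

Let mD : measurable_fun setT D.
Proof.
apply: measurable_fun_ifT => //.
  by apply: measurable_funB => //; apply: measurable_funM.
Qed.

Let bit_affine (e : bool) B : measurable B ->
  P (bit @^-1` [set e] `&` D @^-1` B) = ((2^-1)%:E * P B)%E.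
Proof.
move=> mB; rewrite uniform01_core; last first.
  by apply: measurableI; apply: preimageT_measurable.
rewrite -(@uniform01_affine R (e%:R / 2) 2^-1 B)//; last first.
- by case: e => /=; lra.
congr (P _); apply/seteqP; rewrite /D /bit.
split=> x /=; rewrite !in_itv/= inE invrK; case: (leP 2^-1 x) => hx; case: e => /=.
- move=> [[_ Bx] /andP[x0 x1]]; split; [|by apply/andP; split; lra].
  by have -> : (x - 1 / 2) * 2 = 2 * x - 1 by lra.
- by case=> -[].
- by case=> -[].
- move=> [[_ Bx] /andP[x0 x1]]; split; [|by apply/andP; split; lra].
  by have -> : (x - 0 / 2) * 2 = 2 * x by lra.
- move=> [Bx /andP[x0 x1]]; split; [|by apply/andP; split; lra].
  by split=> //; have <- : (x - 1 / 2) * 2 = 2 * x - 1 by lra.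
- by move=> [_ /andP[x0 x1]]; exfalso; lra.
- by move=> [_ /andP[x0 x1]]; exfalso; lra.
- move=> [Bx /andP[x0 x1]]; split; [|by apply/andP; split; lra].
  by split=> //; have <- : (x - 0 / 2) * 2 = 2 * x by lra.
Qed.

(* The digits of even rank of [x] are the digits of [xi x], so that the digits of
   odd rank are those of [xi (D x)]. *)
Let term (x : measurableTypeR R) (i : nat) : R :=
  (bit (iter i (D \o D) x))%:R * 2^-1 ^+ i.+1.

Let term_ge0 x i : 0 <= term x i. Proof. by rewrite mulr_ge0. Qed.

Let term_le x i : term x i <= 2^-1 * 2^-1 ^+ i.
Proof. by rewrite /term exprS ler_piMl ?mulr_ge0 ?exprn_ge0//; case: bit. Qed.

Let geo : series (geometric (2^-1 : R) 2^-1) @ \oo --> (1 : R).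
Proof.
have h : `|2^-1 : R| < 1 by rewrite ger0_norm ?invr_ge0// invf_lt1// ltr1n.
have := @cvg_geometric_series R 2^-1 2^-1 h.
by rewrite (_ : 1 - 2^-1 = 2^-1 :> R) ?divff//; lra.
Qed.

Let cterm x : cvgn (series (term x)).
Proof.
apply: (@series_le_cvg _ _ (geometric (2^-1 : R) 2^-1)) => //.
- by move=> n; rewrite /geometric/= mulr_ge0// exprn_ge0.
- by apply/cvg_ex; exists 1; exact: geo.
Qed.

Let xi (x : measurableTypeR R) : measurableTypeR R := limn (series (term x)).

Let mxi : measurable_fun setT xi.
Proof.
apply: (@measurable_fun_cvg _ _ R setT (fun n x => series (term x) n)) => [n|x _].
  apply: measurable_sum => i; apply: measurable_funM => //.
  apply: measurableT_comp => //; apply: (measurableT_comp mbit).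
  by apply: measurable_iter; exact: measurableT_comp mD mD.
exact: cterm.
Qed.

Let xi_ge0 x : 0 <= xi x.
Proof. by apply: limr_ge; [exact: cterm|apply: nearW => n; exact: sumr_ge0]. Qed.

Let xi_le1 x : xi x <= 1.
Proof.
rewrite -(cvg_lim _ geo)//; apply: ler_lim.
- exact: cterm.
- by apply/cvg_ex; exists 1; exact: geo.
- by near=> n; apply: ler_sum => i _; exact: term_le.
Unshelve. all: by end_near. Qed.

Let xiE x : xi x = (bit x)%:R / 2 + xi (D (D x)) / 2.
Proof.
apply/cvg_lim => //; rewrite -(cvg_shiftS (series (term x)))/=.
have -> : (fun n => series (term x) n.+1) =
          (fun n => (bit x)%:R / 2 + series (term (D (D x))) n * 2^-1).
  apply/funext => n; rewrite /series/= big_nat_recl//= /term/= expr1; congr (_ + _).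
  rewrite mulr_suml; apply: eq_bigr => i _.
  by rewrite -iterSr/= [in LHS]exprSr mulrA.
by apply: cvgD; [exact: cvg_cst|apply: cvgM; [exact: cterm|exact: cvg_cst]].
Qed.

Let F (s t : R) : R := fine (P ([set x | xi x < s] `&` [set x | xi (D x) < t])).

Let mxlt (f : measurableTypeR R -> measurableTypeR R) s : measurable_fun setT f ->
  measurable [set x | f x < s].
Proof.
move=> mf; rewrite (_ : [set _ | _] = f @^-1` `]-oo, s[%classic).
  exact: preimageT_measurable.
by apply/seteqP; split=> x /=; rewrite in_itv.
Qed.

Let mF s t : measurable ([set x | xi x < s] `&` [set x | xi (D x) < t]).
Proof. by apply: measurableI; apply: mxlt => //; exact: measurableT_comp. Qed.

Let FE s t : (F s t)%:E = P ([set x | xi x < s] `&` [set x | xi (D x) < t]).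
Proof. by rewrite /F fineK// fin_num_measure. Qed.

(* Conditioning on the first digit exchanges the roles of the even and odd
   digits: [F] solves a self-similarity equation, which [clamp s * clamp t]
   solves as well by [clamp_half]. *)
Let F_half s t : F s t = 2^-1 * (F t (2 * s) + F t (2 * s - 1)).
Proof.
apply: EFin_inj; rewrite FE EFinM EFinD !FE muleDr//; last first.
  by rewrite fin_num_adde_defl// fin_num_measure.
rewrite -(setTI (_ `&` _)) -(_ : bit @^-1` [set false] `|` bit @^-1` [set true] = setT).
  rewrite setIUl measureU//; last 3 first.
  - by apply: measurableI => //; exact: preimageT_measurable.
  - by apply: measurableI => //; exact: preimageT_measurable.
  - by apply/seteqP; split=> x //= [[-> _] [] //].
  rewrite -(bit_affine false) -?(bit_affine true)//.
  congr (P _ + P _)%E; apply/seteqP; split=> x /=; rewrite (xiE x) => -[-> ] /= [h1 h2]; do 2?split=> //; lra.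
by apply/seteqP; split=> x //= _; case: bit; [right|left].
Qed.

Let clamp_half (s : R) : clamp s = 2^-1 * (clamp (2 * s) + clamp (2 * s - 1)).
Proof.
have c0 (y : R) : y <= 0 -> clamp y = 0.
  by move=> y0; rewrite /clamp max_r// min_l.
have c1 (y : R) : 1 <= y -> clamp y = 1.
  by move=> y1; rewrite /clamp max_l ?min_r//; lra.
have c01 (y : R) : 0 <= y -> y <= 1 -> clamp y = y.
  by move=> y0 y1; rewrite /clamp max_l ?min_l.
have [s0|s0] := leP s 0; first by rewrite !c0; lra.
have [s1|s1] := leP s 2^-1; first by rewrite (c0 (2 * s - 1)) ?(c01 s) ?(c01 (2 * s)); lra.
rewrite (c1 (2 * s)); last lra.
by have [s2|s2] := leP s 1; [rewrite !c01|rewrite !c1]; lra.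
Qed.

Let d s t := F s t - clamp s * clamp t.

Let d_neg s t : s <= 0 \/ t <= 0 -> d s t = 0.
Proof.
have c0 (y : R) : y <= 0 -> clamp y = 0.
  by move=> y0; rewrite /clamp max_r// min_l.
move=> st; rewrite /d.
have -> : clamp s * clamp t = 0 by case: st => /c0 ->; rewrite ?mulr0 ?mul0r.
rewrite /F (_ : _ `&` _ = set0) ?measure0 ?subr0//.
apply/seteqP; split=> x //= [h1 h2]; have := xi_ge0 x; have := xi_ge0 (D x).
by case: st; lra.
Qed.

Let d_big s t : 1 < s -> 1 < t -> d s t = 0.
Proof.
have c1 (y : R) : 1 < y -> clamp y = 1.
  by move=> y1; rewrite /clamp max_l ?min_r//; lra.
move=> s1 t1; rewrite /d !c1// mulr1.
rewrite /F (_ : _ `&` _ = setT) ?probability_setT ?subrr//.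
apply/seteqP; split=> x //= _; have := xi_le1 x; have := xi_le1 (D x); lra.
Qed.

Let d_quarter s t : d s t = 4^-1 * (d (2 * s) (2 * t) + d (2 * s) (2 * t - 1)
   + d (2 * s - 1) (2 * t) + d (2 * s - 1) (2 * t - 1)).
Proof.
rewrite /d (F_half s t) (F_half t (2 * s)) (F_half t (2 * s - 1)).
rewrite (clamp_half s) (clamp_half t); lra.
Qed.

(* Among the four terms of [d_quarter] one always vanishes, since one of its
   arguments is nonpositive or both exceed 1; hence a contraction by 3/4, which
   forces [d] to be zero. *)
Let d_le m s t : `|d s t| <= (3 / 4) ^+ m.
Proof.
elim: m s t => [|m IH] s t.
  have F0 : 0 <= F s t by rewrite /F fine_ge0.
  have F1 : F s t <= 1 by rewrite -lee_fin FE probability_le1.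
  have c0 (y : R) : 0 <= clamp y by rewrite /clamp le_min ler01 le_max lexx orbT.
  have c1 (y : R) : clamp y <= 1 by rewrite /clamp ge_min lexx orbT.
  have := mulr_ge0 (c0 s) (c0 t); have := mulr_ile1 (c0 s) (c0 t) (c1 s) (c1 t).
  by rewrite expr0 ler_norml /d => ? ?; apply/andP; split; lra.
have := IH (2 * s) (2 * t); have := IH (2 * s) (2 * t - 1).
have := IH (2 * s - 1) (2 * t); have := IH (2 * s - 1) (2 * t - 1).
rewrite !ler_norml => /andP[? ?] /andP[? ?] /andP[? ?] /andP[? ?].
rewrite exprS d_quarter.
have [s1|s1] := leP s 2^-1.
  by rewrite (@d_neg (2 * s - 1) (2 * t)); [apply/andP; split; lra|left; lra].
have [t1|t1] := leP t 2^-1.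
  by rewrite (@d_neg (2 * s) (2 * t - 1)); [apply/andP; split; lra|right; lra].
by rewrite (@d_big (2 * s) (2 * t)); [apply/andP; split; lra|lra|lra].
Qed.

Let d0 s t : d s t = 0.
Proof.
apply/eqP; rewrite -normr_le0.
have h : (fun m => (3 / 4 : R) ^+ m) @ \oo --> (0 : R).
  by apply: cvg_expr; rewrite ger0_norm; lra.
rewrite -(cvg_lim _ h)//; apply: limr_ge; first by apply/cvg_ex; exists 0.
by near=> m; exact: d_le.
Unshelve. all: by end_near. Qed.

(** A single uniform number contains the whole sequence: its even binary digits
    form [xi], its odd digits form [th], and the two are independent and again
    uniform. *)
Lemma exists_uniform_sequence : exists d (O : measurableType d)
   (P : probability O R) (xi : O -> measurableTypeR R) (th : O -> O),
   iid_shift P xi th /\ (forall x, P [set w | xi w < x] = (clamp x)%:E).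
Proof.
exists _, (measurableTypeR R), P, xi, (xi \o D).
have F1 s t : P ([set x | xi x < s] `&` [set x | xi (D x) < t]) = (clamp s * clamp t)%:E.
  by rewrite -FE; congr EFin; apply/eqP; rewrite -subr_eq0; apply/eqP; exact: d0.
have mth : measurable_fun setT (xi \o D) by exact: measurableT_comp.
have xi1 s : P [set x | xi x < s] = (clamp s)%:E.
  have := F1 s 2; rewrite /clamp (@max_l _ _ 2)// (@min_r _ _ 2); last lra.
  rewrite mulr1 => <-; congr (P _); apply/seteqP; split=> x /= => [|[]//].
  by move=> ->; split=> //; have := xi_le1 (D x); lra.
have th1 t : P [set x | xi (D x) < t] = (clamp t)%:E.
  have := F1 2 t; rewrite /clamp (@max_l _ _ 2)// (@min_r _ _ 2); last lra.
  rewrite mul1r => <-; congr (P _); apply/seteqP; split=> x /= => [|[]//].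
  by move=> ->; split=> //; have := xi_le1 x; lra.
have pre (f : measurableTypeR R -> measurableTypeR R) s :
  f @^-1` `]-oo, s[%classic = [set x | f x < s].
  by apply/seteqP; split=> x /=; rewrite in_itv.
split=> //; split=> // A B mA mB.
rewrite setIC.
have fA : P (xi @^-1` A) = (fine (P (xi @^-1` A)))%:E.
  by rewrite fineK// fin_num_measure//; exact: preimageT_measurable.
rewrite fA; apply: (@eq_law_ray _ _ _ _ R P P (xi \o D) id) => //.
- exact: preimageT_measurable.
- by rewrite fine_ge0.
move=> t; rewrite -fA preimage_id uniform01_ray setIC muleC.
apply: (@eq_law_ray _ _ _ _ R P P xi xi) => //.
- exact: preimageT_measurable.
- by rewrite /clamp le_min ler01 le_max lexx orbT.
- by move=> s; rewrite !pre F1 xi1 muleC EFinM.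
Qed.

End uniform_sequence.

(** * Sums of i.i.d. integers over consecutive blocks *)

Lemma measure_split_nat d (O : measurableType d) (R : realType)
    (P : {measure set O -> \bar R}) (f : O -> nat) (A : set O) n :
  measurable_fun setT f -> measurable A -> (forall w, A w -> (f w < n)%N) ->
  P A = (\sum_(k < n) P (f @^-1` [set (k : nat)] `&` A))%E.
Proof.
move=> mf mA Af.
have E : A = f @^-1` [set i | (i < n)%N] `&` A.
  by apply/seteqP; split=> w; [move=> Aw; split=> //; exact: Af|case].
rewrite [in LHS]E {E}.
elim: n {Af} => [|n IH].
  rewrite big_ord0 (_ : _ `&` _ = set0) ?measure0//.
  by apply/seteqP; split=> w [].
have mfk (B : set nat) : measurable (f @^-1` B `&` A).
  by apply: measurableI => //; exact: preimageT_measurable.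
rewrite big_ord_recr/=.
rewrite (_ : _ `&` _ = (f @^-1` [set i | (i < n)%N] `&` A) `|` (f @^-1` [set n] `&` A)).
  rewrite measureU//; last first.
    by apply/seteqP; split=> w //= [[h _] [e _]]; rewrite e ltnn in h.
  by congr (_ + _)%E; exact: IH.
apply/seteqP; split=> w /=.
  by move=> [fn Aw]; move: fn; rewrite ltnS leq_eqVlt => /orP[/eqP|]; [right|left].
by move=> [] [fn Aw]; rewrite ?fn// ltnS ltnW.
Qed.

Section convolution_powers.
Variable R : realType.
Implicit Types (p g : nat -> R) (q : R).

(** The mass function of the sum of [n] independent variables of mass [p]. *)
Fixpoint conv_power p (n c : nat) : R :=
  if n is n'.+1 then \sum_(k < c.+1) p k * conv_power p n' (c - k)%N
  else (c == 0)%:R.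

(** The law of a variable of mass [g] that is kept with probability [q] and
    replaced by 0 otherwise. *)
Definition thinned q g (k : nat) : R := q * g k + (1 - q) * (k == 0)%:R.

Lemma conv_power_eq0 g n c : g 0 = 0 -> (c < n)%N -> conv_power g n c = 0.
Proof.
move=> g0; elim: n c => // n IH c; rewrite ltnS => cn /=.
rewrite big1// => -[[|k] kc] _ /=; first by rewrite g0 mul0r.
by rewrite IH ?mulr0//; move: kc; rewrite ltnS => kc; lia.
Qed.

(** The number of kept summands is binomial, and given that [r] are kept their
    sum has mass [conv_power g r]. The bound [N] only has to exceed [n], because
    the binomial coefficients vanish beyond [n]. *)
Lemma conv_power_thinned_all q g n N c : (n < N)%N ->
  conv_power (thinned q g) n c =
  \sum_(r < N) 'C(n, r)%:R * q ^+ r * (1 - q) ^+ (n - r) * conv_power g r c.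
Proof.
elim: n N c => [|n IH] [//|N] c; rewrite ltnS => nN.
  rewrite big_ord_recl/= bin0 subn0 !expr0 !mul1r big1 ?addr0// => i _.
  by rewrite bin0n/= mul0r mul0r mul0r.
have IHk k : conv_power (thinned q g) n (c - k)%N = \sum_(r < N)
    'C(n, r)%:R * q ^+ r * (1 - q) ^+ (n - r) * conv_power g r (c - k)%N by exact: IH.
rewrite [LHS]/=.
transitivity ((1 - q) * conv_power (thinned q g) n c +
    q * \sum_(k < c.+1) g k * conv_power (thinned q g) n (c - k)%N).
  rewrite [LHS]big_ord_recl [in RHS]big_ord_recl (eq_bigr (fun i : 'I_c =>
    q * (g (lift ord0 i) * conv_power (thinned q g) n (c - lift ord0 i)%N))).
    by rewrite -mulr_sumr {1}/thinned eqxx subn0 /= mulr1; set S := \sum_(i < c) _; set C := conv_power _ _ _; ring.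
  by move=> i _; rewrite /thinned/= mulr0 addr0 mulrA.
have -> : \sum_(k < c.+1) g k * conv_power (thinned q g) n (c - k)%N =
    \sum_(r < N) 'C(n, r)%:R * q ^+ r * (1 - q) ^+ (n - r) * conv_power g r.+1 c.
  under eq_bigr => k _ do rewrite IHk mulr_sumr.
  rewrite exchange_big/=; apply: eq_bigr => r _; rewrite mulr_sumr.
  by apply: eq_bigr => k _; rewrite mulrCA.
rewrite (IH N.+1 c (leqW nN)).
rewrite mulr_sumr mulr_sumr !big_ord_recl -addrA.
congr (_ + _).
  by rewrite !bin0 !subn0 exprS !mulrA; ring.
rewrite -big_split/=; apply: eq_bigr => r _; rewrite /bump/= add1n binS natrD.
have [rn|rn] := ltnP r n.
  have -> : (n - r = (n - r.+1).+1)%N by lia.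
  by rewrite subSS (_ : (n - r = (n - r.+1).+1)%N) ?exprS//; [ring|lia].
rewrite (@bin_small n r.+1)// subSS exprS; ring.
Qed.

(** Since the kept summands are positive, at most [c] of them can add up to [c].
    The number of terms therefore does not grow with [n], so that limits in [n]
    can be taken term by term. *)
Lemma conv_power_thinned q g n c : g 0 = 0 -> q < 1 ->
  conv_power (thinned q g) n c =
  \sum_(r < c.+1) 'C(n, r)%:R * q ^+ r * (1 - q) ^+ n / (1 - q) ^+ r * conv_power g r c.
Proof.
move=> g0 q1; have q10 : 1 - q != 0 by rewrite subr_eq0 gt_eqF.
have E N : (n < N)%N -> (c < N)%N -> conv_power (thinned q g) n c =
  \sum_(r < N) 'C(n, r)%:R * q ^+ r * (1 - q) ^+ n / (1 - q) ^+ r * conv_power g r c.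
  move=> nN cN; rewrite (@conv_power_thinned_all q g n N c nN); apply: eq_bigr => r _.
  congr (_ * _); rewrite -!mulrA; have [rn|rn] := leqP r n; last first.
    by rewrite bin_small// !mul0r.
  by congr (_ * (_ * _)); rewrite -{2}(subnK rn) exprD -mulrA divff ?mulr1// expf_neq0.
rewrite (E (maxn n c).+1) ?ltnS ?leq_maxl ?leq_maxr//.
rewrite -[in LHS](subnKC (_ : (c.+1 <= (maxn n c).+1)%N)) ?ltnS ?leq_maxr//.
rewrite big_split_ord [X in _ + X = _]big1 ?addr0// => i _.
by rewrite conv_power_eq0 ?mulr0//= addSn ltnS leq_addr.
Qed.

End convolution_powers.

Lemma iid_shift_measure d (O : measurableType d) (R : realType) (P : probability O R)
    d' (E : measurableType d') (Y : O -> E) (th : O -> O) n B :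
  iid_shift P Y th -> measurable B -> P (iter n th @^-1` B) = P B.
Proof.
move=> [mY mth H] mB; elim: n => // n <-.
have mnB : measurable (iter n th @^-1` B).
  by apply: preimageT_measurable => //; exact: measurable_iter.
rewrite (_ : iter n.+1 th @^-1` B = Y @^-1` setT `&` th @^-1` (iter n th @^-1` B)).
  by rewrite H// preimage_setT probability_setT mul1e.
by apply/seteqP; split=> w /=; rewrite -iterS iterSr; [split|case].
Qed.

Section block_sums.
Context d (O : measurableType d) (R : realType) (P : probability O R).
Variables (Y : O -> nat) (th : O -> O) (p : nat -> R).
Hypothesis Yiid : iid_shift P Y th.
Hypothesis Ylaw : forall k, P (Y @^-1` [set k]) = (p k)%:E.

Let mY : measurable_fun setT Y. Proof. by case: Yiid. Qed.
Let mth : measurable_fun setT th. Proof. by case: Yiid. Qed.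

Let S n w := (\sum_(i < n) Y (iter i th w))%N.

Let mS n : measurable_fun setT (S n).
Proof.
elim: n => [|n IH]; rewrite /S; first by under eq_fun do rewrite big_ord0; exact: measurable_cst.
under eq_fun do rewrite big_ord_recr/=.
by apply: measurable_fun_addn => //; apply: measurableT_comp => //; exact: measurable_iter.
Qed.

(** The event on [iter n th] records that the future of the sequence is
    independent of its first [n] terms; without it the induction on blocks in
    [block_sums_law] would not close. *)
Lemma sum_law n c B : measurable B ->
  P (S n @^-1` [set c] `&` iter n th @^-1` B) = ((conv_power p n c)%:E * P B)%E.
Proof.
move=> mB; have PB : P B = (fine (P B))%:E by rewrite fineK// fin_num_measure.
elim: n c => [|n IH] c.
  have -> : S 0 @^-1` [set c] `&` iter 0 th @^-1` B = [set w | (c == 0)%N /\ B w].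
    apply/seteqP; rewrite /S; split=> w /=; rewrite big_ord0.
      by move=> [-> ?].
    by move=> [/eqP -> ?].
  rewrite /=; case: (c == 0)%N => /=; last first.
    by rewrite mul0e (_ : [set _ | _] = set0) ?measure0//; apply/seteqP; split=> w // [].
  by rewrite mul1e; congr (P _); apply/seteqP; split=> w // [].
have mSB (k : nat) : measurable (S n @^-1` [set k] `&` iter n th @^-1` B).
  by apply: measurableI; apply: preimageT_measurable => //; exact: measurable_iter.
rewrite (@measure_split_nat _ _ _ P Y _ c.+1)//; first last.
- by move=> w [/= <- _]; rewrite /S big_ord_recl/= ltnS; exact: leq_addr.
- by apply: measurableI; apply: preimageT_measurable => //; exact: measurable_iter.
rewrite PB -EFinM /= mulr_suml -sumEFin.
apply: eq_bigr => -[k kc] _ /=.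
rewrite -mulrA !EFinM -PB -IH// -Ylaw; case: Yiid => _ _ <-//.
have SS w : S n.+1 w = (Y w + S n (th w))%N.
  rewrite /S big_ord_recl/=; congr addn; apply: eq_bigr => i _.
  by rewrite /= -iterSr.
congr (P _); apply/seteqP; split=> w /=; rewrite SS -iterS iterSr.
  by move=> [-> [<- ?]]; do 2?split=> //; rewrite addKn.
by move=> [-> [-> ?]]; do 2?split=> //; rewrite subnKC.
Qed.

Lemma block_sums_law (a : nat -> nat) (c : nat -> nat) J : a 0%N = 0%N ->
  (forall j, (a j <= a j.+1)%N) ->
  P [set w | forall j, (j < J)%N -> (\sum_(a j <= i < a j.+1) Y (iter i th w))%N = c j] =
  (\prod_(j < J) conv_power p (a j.+1 - a j) (c j))%:E.
Proof.
move=> a0 a_nd.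
suff H B : measurable B ->
    P ([set w | forall j, (j < J)%N -> (\sum_(a j <= i < a j.+1) Y (iter i th w))%N = c j]
       `&` iter (a J) th @^-1` B) =
    ((\prod_(j < J) conv_power p (a j.+1 - a j) (c j))%:E * P B)%E.
  by have := H setT measurableT; rewrite preimage_setT setIT probability_setT mule1.
elim: J B => [|J IH] B mB.
  rewrite big_ord0 mul1e a0; congr (P _).
  by apply/seteqP; split=> w // [].
have mSB (n : nat) : measurable (S n @^-1` [set c J] `&` iter n th @^-1` B).
  by apply: measurableI; apply: preimageT_measurable => //; exact: measurable_iter.
rewrite big_ord_recr EFinM -muleA -(@sum_law (a J.+1 - a J) (c J))// -IH//.
have SE w : S (a J.+1 - a J) (iter (a J) th w) = (\sum_(a J <= i < a J.+1) Y (iter i th w))%N.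
  rewrite /S [RHS](_ : _ = \sum_(0 + a J <= i < a J.+1) Y (iter i th w))%N// big_addn big_mkord; apply: eq_bigr => i _.
  by rewrite iterD.
have iE w : iter (a J.+1 - a J) th (iter (a J) th w) = iter (a J.+1) th w.
  by rewrite -iterD subnK.
congr (P _); apply/seteqP; split=> w /=; rewrite SE iE.
  by move=> [h ?]; split; [move=> j jJ; apply: h; exact: ltnW|split=> //; exact: h].
move=> [h [hJ ?]]; split=> // j; rewrite ltnS leq_eqVlt => /orP[/eqP ->//|]; exact: h.
Qed.

End block_sums.

(** * The compound Poisson limit of thinned sums *)

Section poisson_limit.
Variable R : realType.
Implicit Types (q : nat -> R) (L : nat -> nat) (t : R).

(** The factor of the binomial mass that carries the powers of [q]: the rule
    (r + 1) * C(L, r + 1) = (L - r) * C(L, r) makes each step multiply the limit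
    by t / (r + 1). *)
Lemma cvg_bin q L t r : (forall n, 0 <= q n) -> q @ \oo --> (0 : R) ->
  (fun n => (L n)%:R * q n) @ \oo --> t ->
  (fun n => 'C(L n, r)%:R * q n ^+ r) @ \oo --> t ^+ r / r`!%:R.
Proof.
move=> q0 cq cL; elim: r => [|r IH].
  rewrite expr0 fact0 divr1; under eq_fun do rewrite bin0 expr0 mulr1.
  exact: cvg_cst.
have E n : 'C(L n, r.+1)%:R * q n ^+ r.+1 =
    ('C(L n, r)%:R * q n ^+ r) * ((L n - r)%N%:R * q n) * r.+1%:R^-1.
  have h : 'C(L n, r.+1)%:R = (L n - r)%N%:R * 'C(L n, r)%:R * r.+1%:R^-1 :> R.
    by rewrite -natrM -mul_bin_left natrM mulrAC divff ?mul1r//.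
  by rewrite h exprS; ring.
under eq_fun do rewrite E.
have -> : t ^+ r.+1 / (r.+1)`!%:R = t ^+ r / r`!%:R * t * r.+1%:R^-1.
  by rewrite factS natrM invfM exprS; ring.
apply: cvgM; last exact: cvg_cst.
apply: cvgM; first exact: IH.
apply: (@squeeze_cvgr _ _ _ _ (fun n => (L n)%:R * q n - r%:R * q n) (fun n => (L n)%:R * q n)) => //.
- near=> n; apply/andP; split; last by rewrite ler_wpM2r// ler_nat leq_subr.
  rewrite -mulrBl ler_wpM2r// lerBlDr -natrD ler_nat; lia.
- rewrite -[X in _ --> X](subr0 t) -[X in _ --> _ - X](mulr0 r%:R).
  by apply: cvgB => //; apply: cvgM => //; exact: cvg_cst.
Unshelve. all: by end_near. Qed.

(** Compound Poisson law with mean number [t] of summands; the sum stops at [c]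
    because [compound_pmf] is used for summands that are at least 1. *)
Definition compound_pmf t (g : nat -> R) (c : nat) : R :=
  \sum_(r < c.+1) poisson_pmf t r * conv_power g r c.

(** Poisson limit theorem inside the finite sum of [conv_power_thinned]. *)
Lemma cvg_compound q L t (g : nat -> R) c : 0 < t -> g 0%N = 0 ->
  (forall n, 0 <= q n < 1) -> q @ \oo --> (0 : R) ->
  (fun n => (L n)%:R * q n) @ \oo --> t ->
  (fun n => (1 - q n) ^+ L n) @ \oo --> expR (- t) ->
  (fun n => conv_power (thinned (q n) g) (L n) c) @ \oo --> compound_pmf t g c.
Proof.
move=> t0 g0 q01 cq cL ce.
have q0 n : 0 <= q n by case/andP: (q01 n).
have E n := @conv_power_thinned R (q n) g (L n) c g0 (proj2 (andP (q01 n))).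
under eq_fun do rewrite E.
apply: cvg_big => [|r _]; first exact: (@add_continuous R).
apply: cvgM; last exact: cvg_cst.
rewrite /poisson_pmf t0 -[X in _ --> X]divr1; apply: cvgM.
  by apply: cvgM => //; exact: cvg_bin.
have h1 : (fun n => 1 - q n) @ \oo --> (1 : R).
  by rewrite -[X in _ --> X]subr0; apply: cvgB => //; exact: cvg_cst.
have h2 : (fun n => (1 - q n) ^+ r) @ \oo --> (1 : R).
  rewrite -[X in _ --> X](expr1n R r).
  apply: (@continuous_cvg _ _ _ _ _ _ (fun x : R => x ^+ r)) h1; exact: exprn_continuous.
by apply: cvgV => //; exact: oner_neq0.
Qed.

(** Chosen so that [(1 - level n) ^+ L] is exactly [expR (- L / (n + 1))], which
    makes the void probabilities converge without any estimate. *)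
Definition level (n : nat) : R := 1 - expR (- (n.+1%:R)^-1).

Lemma level_gt0 n : 0 < level n.
Proof. by rewrite subr_gt0 expR_lt1 oppr_lt0 invr_gt0. Qed.

Lemma level_lt1 n : level n < 1.
Proof. by rewrite ltrBlDr ltrDl expR_gt0. Qed.

Lemma level_le n : level n <= n.+1%:R^-1.
Proof.
have := @expR_ge1Dx R (- (n.+1%:R)^-1); rewrite /level.
by move: (n.+1%:R^-1) (expR _) => a b; lra.
Qed.

Lemma level_mono : {mono (fun n => - level n) : n m / (n <= m)%N >-> n <= m}.
Proof.
move=> n m; rewrite /level !opprB lerBlDr subrK ler_expR lerN2 lef_pV2 ?posrE//.
by rewrite ler_nat ltnS.
Qed.

Lemma cvg_level : level @ \oo --> (0 : R).
Proof.
apply: (@squeeze_cvgr _ _ _ _ (cst 0) (fun n => n.+1%:R^-1)).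
- by near=> n; rewrite level_le (ltW (level_gt0 _)).
- exact: cvg_cst.
- exact: cvg_harmonic.
Unshelve. all: by end_near. Qed.

Lemma cvg_mul_level L t : (fun n => (L n)%:R / n.+1%:R) @ \oo --> t ->
  (fun n => (L n)%:R * level n) @ \oo --> t.
Proof.
move=> cL.
apply: (@squeeze_cvgr _ _ _ _ (fun n => ((L n)%:R / n.+1%:R) * expR (- (n.+1%:R)^-1))
   (fun n => (L n)%:R / n.+1%:R)) => //.
- near=> n; apply/andP; split; last by rewrite ler_wpM2l// level_le.
  rewrite -mulrA ler_wpM2l// /level.
  have h := @expR_ge1Dx R (n.+1%:R)^-1.
  have e0 := expR_gt0 (- (n.+1%:R)^-1 : R).
  have e1 : expR (n.+1%:R)^-1 * expR (- (n.+1%:R)^-1) = 1 :> R.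
    by rewrite -expRD subrr expR0.
  by have := ler_wpM2r (ltW e0) h; rewrite e1 mulrDl mul1r lerBrDr addrC.
- rewrite -[X in _ --> X]mulr1; apply: cvgM => //.
  rewrite -[X in _ --> X]expR0; apply: continuous_cvg; first exact: continuous_expR.
  by have := @cvgN _ _ _ _ _ _ _ (@cvg_harmonic R); rewrite oppr0; apply.
Unshelve. all: by end_near. Qed.

Lemma cvg_exp_level L t : (fun n => (L n)%:R / n.+1%:R) @ \oo --> t ->
  (fun n => (1 - level n) ^+ L n) @ \oo --> expR (- t).
Proof.
move=> cL; rewrite (_ : (fun n => (1 - level n) ^+ L n) = (fun n => expR (- ((L n)%:R / n.+1%:R)))).
  by apply: continuous_cvg; [exact: continuous_expR|exact: cvgN].
by apply/funext => n; rewrite /level subKr -expRM_natl mulrN.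
Qed.

End poisson_limit.

(** * Vague convergence from agreement on grids *)

Lemma cvg_initial (S : choiceType) (T : topologicalType) (f : S -> T)
    (F : set_system S) (s : S) : Filter F ->
  f @ F --> f s -> F --> (s : initial_topology f).
Proof.
move=> FF cv A [_ [[B oB <-] Bfs] BA].
by apply: filterS BA _; apply: cv; exact: open_nbhs_nbhs.
Qed.

Section vague_convergence.
Variable R : realType.

Lemma vague_cvg (nu : nat -> counting_measure R) (mu : counting_measure R) :
  (forall f : test_function R,
     (fun m => vague_integral (nu m) f) @ \oo --> vague_integral mu f) ->
  nu @ \oo --> mu.
Proof.
move=> H; apply: (@cvg_initial _ _ (@vague_integral R)).
apply/cvg_sup => f; apply: cvg_initial; exact: H.
Qed.

Definition cell (M j : nat) : set (measurableTypeR R) :=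
  `[j%:R / M%:R, j.+1%:R / M%:R[%classic.

Definition upto (b : R) : set (measurableTypeR R) := `[0, b[%classic.

Lemma measurable_upto b : measurable (upto b).
Proof. exact: measurable_itv. Qed.

Lemma measurable_cell M j : measurable (cell M j).
Proof. exact: measurable_itv. Qed.

Lemma measurable_test (f : test_function R) :
  measurable_fun (`[0, +oo[%classic : set (measurableTypeR R)) f.
Proof.
apply: subspace_continuous_measurable_fun => //; exact: test_continuous.
Qed.

Lemma test_support (f : test_function R) :
  exists B : nat, forall x, B%:R <= x -> f x = 0.
Proof.
have [b fb] := test_compact_support f.
exists (Num.bound `|b|) => x bx; apply: fb.
by apply: lt_le_trans bx; exact: le_lt_trans (ler_norm _) (archi_boundP _).
Qed.

Lemma test_bounded (f : test_function R) : exists C, forall x, 0 <= x -> f x <= C.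
Proof.
have [B fB] := test_support f.
have [c _ fc] : exists2 c, c \in `[0, B%:R]%R & forall t, t \in `[0, B%:R]%R -> f t <= f c.
  apply: EVT_max => //.
  apply: continuous_subspaceW (@test_continuous _ f).
  by move=> x /=; rewrite !in_itv/= => /andP[->].
exists (Num.max (f c) 0) => x x0; rewrite le_max.
have [xB|xB] := leP x B%:R; first by rewrite fc// in_itv/= x0.
by rewrite (fB _ (ltW xB)) lexx orbT.
Qed.

(** Uniform continuity: Heine on [0, B + 1], while beyond [B] the function is
    zero. The extra unit and the bound [d <= 1] keep a pair of close points from
    straddling both regions. *)
Lemma test_uniform (f : test_function R) (e : R) : 0 < e ->
  exists2 d, 0 < d & forall x y, 0 <= x -> 0 <= y -> `|x - y| < d -> `|f x - f y| <= e.
Proof.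
move=> e0; have [B fB] := test_support f.
pose P (d x : R) := 0 <= x -> forall y, 0 <= y -> `|x - y| < d -> `|f x - f y| <= e.
have loc x : 0 <= x -> exists2 r, 0 < r &
    forall y, 0 <= y -> `|x - y| < r -> `|f x - f y| < e / 2.
  move=> x0; have := @test_continuous _ f.
  move/subspace_continuousP => /(_ x); rewrite /= in_itv/= x0 => /(_ isT).
  move/cvgrPdist_lt => /(_ (e / 2)); rewrite divr_gt0// => /(_ isT).
  rewrite /within/= => /nbhs_ballP[r r0 hr]; exists r => // y y0 xy.
  by apply: hr => //; rewrite /= in_itv/= y0.
have cpt : compact (`[0, B%:R + 1]%classic : set R) by exact: segment_compact.
have H : \forall d \near 0^'+, (`[0, B%:R + 1]%classic : set R) `<=` P d.
  move/compact_near_coveringP : cpt; apply => x /=; rewrite in_itv/= => /andP[x0 _].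
  have [r r0 hr] := loc x x0.
  near=> x' d => x'0 y y0 x'y.
  have xx' : `|x - x'| < r / 2.
    by near: x'; apply/nbhs_ballP; exists (r / 2) => //=; exact: divr_gt0.
  have dr : d < r / 2 by near: d; apply: nbhs_right_lt; exact: divr_gt0.
  have h1 : `|f x - f x'| < e / 2 by apply: hr => //; lra.
  have h2 : `|f x - f y| < e / 2.
    apply: hr => //; rewrite -(subrK x' x) -addrA.
    by rewrite (le_lt_trans (ler_normD _ _))// (splitr r) ltrD// (lt_trans x'y).
  rewrite -(subrK (f x) (f x')) -addrA (le_trans (ler_normD _ _))//.
  by rewrite (splitr e) lerD ?ltW// distrC.
have [d /= d0 hd] := H.
exists (Num.min (d / 2) 1).
  by rewrite lt_min ltr01 divr_gt0.
move=> x y x0 y0; rewrite lt_min => /andP[xyd xy1].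
have [xB|xB] := leP x (B%:R + 1).
  apply: (hd (d / 2)) => //=; rewrite ?sub0r ?normrN ?in_itv/= ?x0//.
  - rewrite gtr0_norm; lra.
  - lra.
rewrite !fB ?subrr ?normr0; [exact: ltW|move: xy1; rewrite ltr_norml; lra|lra].
Unshelve. all: by end_near. Qed.

Lemma cells_cover (M K : nat) : (0 < M)%N ->
  upto (K.+1%:R / M%:R) = upto (K%:R / M%:R) `|` cell M K.
Proof.
move=> M0; have h : (K%:R / M%:R : R) <= K.+1%:R / M%:R.
  by rewrite ler_pM2r ?invr_gt0 ?ltr0n// ler_nat.
apply/seteqP; split=> x /=; rewrite /upto /cell/= !in_itv/=.
  by move=> /andP[x0 xK]; have [h1|h1] := ltP x (K%:R / M%:R); [left; rewrite x0|right; rewrite xK].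
move=> [/andP[-> h1]|/andP[h1 ->]]; rewrite ?andbT/=; first exact: lt_le_trans h1 h.
by apply: le_trans h1; rewrite divr_ge0 ?ler0n.
Qed.

Lemma integrable_test (f : test_function R) (mu : counting_measure R) (b : R) :
  mu.-integrable (upto b) (EFin \o f).
Proof.
have [C fC] := test_bounded f.
apply: measurable_bounded_integrable => //.
- exact: measurable_upto.
- apply: le_lt_trans (cm_locally_finite mu b); apply: le_measure; rewrite ?inE//.
    exact: measurable_upto.
  by move=> x; rewrite /upto/= !in_itv/= => /andP[-> /ltW].
- apply: measurable_funS (measurable_test f) => //.
  by move=> x; rewrite /upto/= !in_itv/= => /andP[->].
exists C; split; first exact: num_real.
move=> y Cy x; rewrite /upto/= in_itv/= => /andP[x0 _].
by rewrite ger0_norm ?test_ge0// (le_trans (fC _ x0)) ?ltW.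
Qed.

(** Riemann sums at the left ends of the cells depend on [mu] only through its
    cell counts, so they carry agreement of counts over to integrals. *)
Lemma cell_approx (f : test_function R) (mu : counting_measure R) (M K : nat) (e : R) :
  (0 < M)%N ->
  (forall j x, cell M j x -> `|f x - f (j%:R / M%:R)| <= e) ->
  `|\int[mu]_(x in upto (K%:R / M%:R)) f x
     - \sum_(j < K) f (j%:R / M%:R) * fine (mu (cell M j))|
   <= e * fine (mu (upto (K%:R / M%:R))).
Proof.
move=> M0 fe; elim: K => [|K IH].
  rewrite mul0r (_ : upto 0 = set0) ?measure0 ?mulr0.
    by rewrite Rintegral_set0 big_ord0 subrr normr0.
  exact: set_itvco0.
have fincell b (A : set (measurableTypeR R)) : measurable A -> A `<=` upto b -> (mu A < +oo)%E.
  move=> mA Ab; apply: le_lt_trans (cm_locally_finite mu b); apply: le_measure; rewrite ?inE//.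
  by move=> x /Ab; rewrite /upto/= !in_itv/= => /andP[-> /ltW].
have disj : upto (K%:R / M%:R) `&` cell M K = set0.
  apply/seteqP; split=> x //=; rewrite /upto /cell/= !in_itv/= => -[/andP[_ h1] /andP[h2 _]].
  by move: (lt_le_trans h1 h2); rewrite ltxx.
have cK : cell M K `<=` upto (K.+1%:R / M%:R) by rewrite (cells_cover K M0); exact: subsetUr.
have cK0 : upto (K%:R / M%:R) `<=` upto (K.+1%:R / M%:R).
  by rewrite (cells_cover K M0); exact: subsetUl.
have int1 := integrable_test f mu (K.+1%:R / M%:R).
have intc : mu.-integrable (cell M K) (EFin \o f).
  exact: (integrableS (measurable_upto _) (measurable_cell _ _) cK int1).
have intcst (c : R) : mu.-integrable (cell M K) (EFin \o cst c).
  apply: measurable_bounded_integrable; [exact: measurable_cell|exact: (fincell _ _ (measurable_cell _ _) cK)|exact: measurable_cst|].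
  by exists `|c|; split; [exact: num_real|move=> y cy x _ /=; exact: ltW].
have mc := measurable_cell M K.
have key : `|\int[mu]_(x in cell M K) f x - f (K%:R / M%:R) * fine (mu (cell M K))|
    <= e * fine (mu (cell M K)).
  rewrite -!(Rintegral_cst mu mc) -(RintegralB mc intc (intcst _)).
  have intB := integrableB mc intc (intcst (f (K%:R / M%:R))).
  apply: le_trans (le_normr_Rintegral mc intB) _.
  apply: le_Rintegral => //; last exact: fe.
  - exact: integrable_norm intB.
  - exact: intcst.
have mu0 := measurable_upto (K%:R / M%:R).
rewrite (cells_cover K M0) Rintegral_setU//; last 2 first.
- by rewrite -(cells_cover K M0).
- exact/disj_set2P.
rewrite measureU// fineD ?ge0_fin_numE//; [|exact: (fincell _ _ mu0 cK0)|exact: (fincell _ _ mc cK)].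
rewrite mulrDr big_ord_recr/= opprD addrACA.
by apply: le_trans (ler_normD _ _) _; apply: lerD.
Qed.

End vague_convergence.

Section cells_determine.
Variable R : realType.
Implicit Types (mu : counting_measure R).

(** Both the mesh and the window depend on [m]: the grids become finer and
    eventually cover every compact set. *)
Definition same_grid (m : nat) (mu nu : counting_measure R) :=
  forall j, (j < m.+1 * m.+1)%N -> mu (@cell R m.+1 j) = nu (@cell R m.+1 j).

Lemma measure_cells mu (M K : nat) : (0 < M)%N ->
  mu (upto (K%:R / M%:R)) = (\sum_(j < K) mu (@cell R M j))%E.
Proof.
move=> M0; elim: K => [|K IH].
  by rewrite mul0r big_ord0 (_ : upto 0 = set0) ?measure0//; exact: set_itvco0.
rewrite big_ord_recr -IH (cells_cover R K M0) measureU//; [exact: measurable_upto|exact: measurable_cell|].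
apply/seteqP; split=> x //=; rewrite /upto /cell/= !in_itv/= => -[/andP[_ h1] /andP[h2 _]].
by move: (lt_le_trans h1 h2); rewrite ltxx.
Qed.

Lemma vague_integral_support (f : test_function R) mu (B : nat) :
  (forall x, B%:R <= x -> f x = 0) ->
  vague_integral mu f = \int[mu]_(x in upto B%:R) f x.
Proof.
move=> fB; rewrite /vague_integral /Rintegral; congr fine.
have -> : `[0, +oo[%classic = upto B%:R `|` `[B%:R, +oo[%classic :> set (measurableTypeR R).
  apply/seteqP; split=> x /=; rewrite /upto/= !in_itv/= ?andbT.
    by move=> x0; have [h|h] := ltP x B%:R; [left; rewrite x0|right].
  by move=> [/andP[]//|]; apply: le_trans.
rewrite ge0_integral_setU//=.
- rewrite [X in (_ + X)%E]integral0_eq ?adde0// => x /=.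
  by rewrite in_itv/= andbT => /fB ->.
- exact: measurable_upto.
- apply/measurable_EFinP; apply: measurable_funS (measurable_test f) => //.
  by move=> x; rewrite /upto/= !in_itv/= ?andbT => -[/andP[]//|]; apply: le_trans.
- move=> x; rewrite lee_fin => h; apply: test_ge0; move: h.
  by rewrite /upto/= !in_itv/= ?andbT => -[/andP[]//|]; apply: le_trans.
- by apply/disj_set2P/seteqP; split=> x //=; rewrite /upto/= !in_itv/= andbT => -[/andP[_ h1]] /(lt_le_trans h1); rewrite ltxx.
Qed.

(** The Riemann sums of [mu] and [nu m] coincide on the grid, and both integrals
    are close to them with the same error bound, namely the modulus of
    continuity times the mass that [mu] gives to the support. *)
Lemma same_grid_cvg (nu : nat -> counting_measure R) mu :
  (forall m, same_grid m mu (nu m)) -> nu @ \oo --> mu.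
Proof.
move=> H; apply: vague_cvg => f; apply/cvgrPdist_le => e e0.
have [B fB] := test_support f.
set S := fine (mu (upto B%:R)).
have S0 : 0 <= S by rewrite fine_ge0.
pose e' := e / (2 * (S + 1)).
have e'0 : 0 < e' by rewrite divr_gt0// mulr_gt0// ltr_wpDl.
have [d d0 fd] := test_uniform f e'0.
near=> m.
have Bm : (B <= m.+1)%N by rewrite leqW//; near: m; exact: nbhs_infty_ge.
have md : (m.+1%:R)^-1 < d by near: m; exact: near_infty_natSinv_lt (PosNum d0).
have gridB : (B%:R : R) = (B * m.+1)%N%:R / m.+1%:R by rewrite natrM mulfK.
have fc j x : @cell R m.+1 j x -> `|f x - f (j%:R / m.+1%:R)| <= e'.
  rewrite /cell/= in_itv/= => /andP[h1 h2].
  have j0 : 0 <= j%:R / m.+1%:R :> R by rewrite divr_ge0.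
  apply: fd => //; first exact: le_trans h1.
  rewrite ger0_norm ?subr_ge0//; apply: lt_trans md.
  by rewrite ltrBlDl; move: h2; rewrite -natr1 mulrDl mul1r.
have E (ka : counting_measure R) : same_grid m mu ka ->
   `|vague_integral ka f - \sum_(j < B * m.+1) f (j%:R / m.+1%:R) * fine (mu (cell m.+1 j))|
   <= e' * S.
  move=> Hka; rewrite (vague_integral_support _ fB) /S gridB.
  have -> : mu (upto ((B * m.+1)%:R / m.+1%:R)) = ka (upto ((B * m.+1)%:R / m.+1%:R)).
    rewrite !measure_cells//; apply: eq_bigr => j _; apply: Hka.
    by apply: leq_trans (ltn_ord j) _; rewrite leq_mul2r Bm orbT.
  rewrite (eq_bigr (fun j : 'I_(B * m.+1) => f (j%:R / m.+1%:R) * fine (ka (cell m.+1 j)))).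
    exact: (cell_approx ka (B * m.+1) (ltn0Sn m) fc).
  move=> j _; rewrite Hka//.
  by apply: leq_trans (ltn_ord j) _; rewrite leq_mul2r Bm orbT.
set s := \sum_(j < B * m.+1) _ in E.
have h1 := E mu (fun j _ => erefl); have h2 := E (nu m) (H m).
rewrite -(subrK s (vague_integral mu f)) -addrA (le_trans (ler_normD _ _))//.
have -> : e = e / 2 + e / 2 by rewrite -splitr.
have h3 : e' * S <= e / 2.
  rewrite /e' -mulrA ler_wpM2l ?(ltW e0)// invfM -mulrA ger_pMr ?invr_gt0//.
  by rewrite mulrC ler_pdivrMr ?ltr_wpDl// mul1r lerDl.
by apply: lerD; [exact: le_trans h3|rewrite distrC; exact: le_trans h3].
Unshelve. all: by end_near. Qed.

End cells_determine.

(** * Expectations of integer-valued variables *)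

Lemma measurable_fun_nat d (O : measurableType d) (f : O -> nat) :
  (forall k, measurable (f @^-1` [set k])) -> measurable_fun setT f.
Proof.
move=> mf _ B _; rewrite setTI.
have -> : f @^-1` B = \bigcup_(k in B) (f @^-1` [set k]).
  by apply/seteqP; split=> [w Bw|w [k Bk /= fk]]; [exists (f w)|rewrite /= fk].
by apply: bigcup_measurable => k _; exact: mf.
Qed.

Section discrete_expectation.
Context d (O : measurableType d) (R : realType) (P : probability O R).

Lemma bounded_integrable (f : O -> R) (C : R) (D : set O) : measurable D ->
  measurable_fun setT f -> (forall w, `|f w| <= C) ->
  P.-integrable D (EFin \o f).
Proof.
move=> mD mf fC; apply: measurable_bounded_integrable => //.
- by apply: le_lt_trans (probability_le1 _ mD) _; exact: ltry.
- exact: measurable_funS mf.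
- by exists C; split; [exact: num_real|move=> y Cy x _; exact: le_trans (fC x) (ltW Cy)].
Qed.

(** The terms that are kept are exact, so only the tail contributes an error. *)
Lemma discrete_expectation_approx (ka : O -> nat) (h : nat -> R) (C : R) J :
  measurable_fun setT ka -> (forall k, `|h k| <= C) ->
  `|\int[P]_w h (ka w) - \sum_(k < J) h k * fine (P (ka @^-1` [set (k : nat)]))|
  <= C * (1 - \sum_(k < J) fine (P (ka @^-1` [set (k : nat)]))).
Proof.
move=> mka hC.
have mk (B : set nat) : measurable (ka @^-1` B) by exact: preimageT_measurable.
have mh : measurable_fun setT (fun w => h (ka w)).
  exact: (@measurableT_comp _ _ _ _ _ _ h).
have int D : measurable D -> P.-integrable D (EFin \o (fun w => h (ka w))).
  by move=> mD; apply: (@bounded_integrable _ C).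
have fin (B : set nat) : P (ka @^-1` B) \is a fin_num by exact: fin_num_measure.
have E : \int[P]_(w in ka @^-1` `I_J) h (ka w)
    = \sum_(k < J) h k * fine (P (ka @^-1` [set (k : nat)])) /\
    fine (P (ka @^-1` `I_J)) = \sum_(k < J) fine (P (ka @^-1` [set (k : nat)])).
  elim: J => [|J [IH1 IH2]].
    rewrite (_ : ka @^-1` _ = set0) ?Rintegral_set0 ?measure0 ?big_ord0//.
    by apply/seteqP; split=> w.
  have -> : ka @^-1` `I_J.+1 = ka @^-1` `I_J `|` ka @^-1` [set J].
    apply/seteqP; split=> w /=.
      by rewrite ltnS leq_eqVlt => /orP[/eqP|]; [right|left].
    by case=> [|->]//; exact: ltnW.
  have disj : ka @^-1` `I_J `&` ka @^-1` [set J] = set0.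
    by apply/seteqP; split=> w //= [h1 h2]; rewrite h2 ltnn in h1.
  rewrite Rintegral_setU//; last 2 first.
  - by apply: int; exact: measurableU.
  - exact/disj_set2P.
  rewrite measureU// fineD; [|exact: fin|exact: fin].
  rewrite !big_ord_recr/= IH1 IH2; split=> //; congr (_ + _).
  rewrite -Rintegral_cst//; apply: eq_Rintegral => w.
  by rewrite inE/= => ->.
have [E1 E2] := E.
have UT : ka @^-1` `I_J `|` ka @^-1` (~` `I_J) = setT.
  by rewrite -preimage_setU setUv preimage_setT.
have disj : ka @^-1` `I_J `&` ka @^-1` (~` `I_J) = set0.
  by rewrite -preimage_setI setICr preimage_set0.
rewrite -E1 -E2 -UT Rintegral_setU//; last 2 first.
- by rewrite UT; exact: int.
- exact/disj_set2P.
rewrite addrAC subrr add0r.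
have -> : 1 - fine (P (ka @^-1` `I_J)) = fine (P (ka @^-1` (~` `I_J))).
  apply/eqP; rewrite subr_eq -fineD; [|exact: fin|exact: fin].
  rewrite addeC -measureU// UT.
  by apply/eqP; rewrite -[LHS]/(fine 1%E); congr fine; exact/esym/probability_setT.
have intm := int _ (mk (~` `I_J)).
apply: le_trans (le_normr_Rintegral _ intm) _ => //.
rewrite -Rintegral_cst//; apply: le_Rintegral => //.
- exact: integrable_norm intm.
- apply: (@bounded_integrable _ `|C|) => //.
Qed.

End discrete_expectation.

(** Convergence of the masses of an integer-valued variable to those of a
    probability implies tightness: the mass of the tail of [kan n] tends to that
    of [ka], hence is uniformly small. *)
Lemma cvg_discrete_expectation d (O : measurableType d) d' (O' : measurableType d')
   (R : realType) (P : probability O R) (P' : probability O' R)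
   (kan : nat -> O -> nat) (ka : O' -> nat) (h : nat -> R) (C : R) :
  (forall n, measurable_fun setT (kan n)) -> measurable_fun setT ka ->
  (forall k, `|h k| <= C) ->
  (forall k, P (kan n @^-1` [set k]) @[n --> \oo] --> P' (ka @^-1` [set k])) ->
  \int[P]_w h (kan n w) @[n --> \oo] --> \int[P']_w h (ka w).
Proof.
move=> mkan mka hC cv.
have C0 : 0 <= C by exact: le_trans (hC 0%N).
pose p k := fine (P' (ka @^-1` [set k])).
pose pn n k := fine (P (kan n @^-1` [set k])).
have cvp k : pn n k @[n --> \oo] --> p k.
  apply: fine_cvg; rewrite fineK; first exact: cv.
  by rewrite fin_num_measure//; exact: preimageT_measurable.
have cvs (a : nat -> R) J : \sum_(k < J) a k * pn n k @[n --> \oo] --> \sum_(k < J) a k * p k.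
  apply: cvg_big => [|k _]; first exact: (@add_continuous R).
  by apply: cvgM; [exact: cvg_cst|exact: cvp].
have sump : \sum_(k < J) p k @[J --> \oo] --> (1 : R).
  have : (\sum_(0 <= k < J) P' (ka @^-1` [set k]))%E @[J --> \oo] --> P' (\bigcup_k ka @^-1` [set k]).
    apply: measure_semi_sigma_additive.
    - by move=> k; exact: preimageT_measurable.
    - by move=> i j _ _ [w [/= <- <-]].
    - by apply: bigcup_measurable => k _; exact: preimageT_measurable.
  have -> : \bigcup_k ka @^-1` [set k] = setT.
    by apply/seteqP; split=> // w _; exists (ka w).
  rewrite probability_setT => /fine_cvg/=; apply: cvg_trans; apply: near_eq_cvg.
  near=> J => /=; rewrite big_mkord -sum_fine// => k _.
  by rewrite fin_num_measure//; exact: preimageT_measurable.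
apply/cvgrPdist_le => e e0.
have C1 : 0 < C + 1 by rewrite ltr_wpDl.
have e'0 : 0 < e / (4 * (C + 1)) by rewrite divr_gt0// mulr_gt0.
have e4 : 0 < e / 4 by rewrite divr_gt0.
have [J hJ] : exists J, 1 - \sum_(k < J) p k <= e / (4 * (C + 1)).
  move/cvgrPdist_le : sump => /(_ _ e'0)[J _ /(_ J (leqnn J))]/= h1.
  by exists J; exact: le_trans (ler_norm _) h1.
have cv1 : \sum_(k < J) pn n k @[n --> \oo] --> \sum_(k < J) p k.
  by apply: cvg_big => [|k _]; [exact: (@add_continuous R)|exact: cvp].
have cv2 := cvs h J.
near=> n.
have h1 : `|\sum_(k < J) p k - \sum_(k < J) pn n k| <= e / (4 * (C + 1)).
  by near: n; exact: ((cvgrPdist_le _ _).1 cv1 _ e'0).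
have h2 : `|\sum_(k < J) h k * p k - \sum_(k < J) h k * pn n k| <= e / 4.
  by near: n; exact: ((cvgrPdist_le _ _).1 cv2 _ e4).
have a1 := discrete_expectation_approx P' J mka hC.
have a2 := discrete_expectation_approx P J (mkan n) hC.
have b1 : C * (1 - \sum_(k < J) p k) <= e / 4.
  apply: le_trans (ler_wpM2l C0 hJ) _.
  have -> : e / 4 = (C + 1) * (e / (4 * (C + 1))).
    by field; rewrite gt_eqF.
  by rewrite ler_pM2r// lerDl.
have b2 : C * (1 - \sum_(k < J) pn n k) <= e / 2.
  have -> : 1 - \sum_(k < J) pn n k = (1 - \sum_(k < J) p k) + (\sum_(k < J) p k - \sum_(k < J) pn n k).
    by rewrite addrA subrK.
  apply: (@le_trans _ _ (C * (e / (4 * (C + 1)) + e / (4 * (C + 1))))).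
    by rewrite ler_wpM2l// lerD// (le_trans (ler_norm _)).
  have -> : e / 2 = (C + 1) * (e / (4 * (C + 1)) + e / (4 * (C + 1))) by field; rewrite gt_eqF.
  by rewrite ler_pM2r ?addr_gt0// lerDl.
move: a1 a2 h2 b1 b2; rewrite -/(pn n) /p.
move: (\int[P']_w _) (\int[P]_w _) => x y.
rewrite !ler_norml /pn; lra.
Unshelve. all: by end_near. Qed.

(** * Weak convergence from the laws of the cell counts *)

Section grid_code.
Variable R : realType.
Implicit Types (mu nu : counting_measure R).

Lemma cell_finite mu M j : (mu (cell M j) < +oo)%E.
Proof.
apply: le_lt_trans (cm_locally_finite mu (j.+1%:R / M%:R)).
apply: le_measure; rewrite ?inE//; first exact: measurable_cell.
move=> x; rewrite /cell/= !in_itv/= => /andP[h1 /ltW ->]; rewrite andbT.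
by apply: le_trans h1; rewrite divr_ge0.
Qed.

(** Cell counts are finite integers; [Num.truncn] reads them off. *)
Definition cell_count mu M j : nat := Num.truncn (fine (mu (@cell R M j))).

Lemma cell_countE mu M j : mu (cell M j) = (cell_count mu M j)%:R%:E.
Proof.
have [k E] := cm_integer (measurable_cell M j) (cell_finite mu M j).
by rewrite /cell_count E/= natrK.
Qed.

(** All counts on the [m]-th grid, packed into one integer, so that statements
    about finitely many counts become statements about one discrete variable. *)
Definition grid_code (m : nat) mu : nat :=
  pickle [seq cell_count mu m.+1 j | j <- iota 0 (m.+1 * m.+1)].

Lemma grid_code_inj m mu nu : grid_code m mu = grid_code m nu -> same_grid m mu nu.
Proof.
move=> /(pcan_inj pickleK) /eq_in_map H j jm.
by rewrite !cell_countE (H j)// mem_iota.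
Qed.

Lemma grid_codeP m mu (c : nat -> nat) :
  grid_code m mu = pickle [seq c j | j <- iota 0 (m.+1 * m.+1)] <->
  forall j, (j < m.+1 * m.+1)%N -> mu (@cell R m.+1 j) = (c j)%:R%:E.
Proof.
split=> [/(pcan_inj pickleK) /eq_in_map H j jm|H].
  by rewrite cell_countE H// mem_iota.
congr pickle; apply/eq_in_map => j; rewrite mem_iota add0n => /H.
by rewrite cell_countE => -[] /eqP; rewrite eqr_nat => /eqP.
Qed.

Lemma grid_code_fiber m k :
  (exists c : nat -> nat, forall mu, grid_code m mu = k <->
     forall j, (j < m.+1 * m.+1)%N -> mu (@cell R m.+1 j) = (c j)%:R%:E) \/
  (forall mu, grid_code m mu <> k).
Proof.
have [[mu <-]|no] := pselect (exists mu, grid_code m mu = k); last first.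
  by right=> mu E; apply: no; exists mu.
by left; exists (cell_count mu m.+1) => nu; exact: grid_codeP.
Qed.

End grid_code.

Section weak_convergence.
Context d (O : measurableType d) d' (O' : measurableType d') (R : realType).
Variables (P : probability O R) (P' : probability O' R).
Variables (Nn : nat -> O -> counting_measure R) (N : O' -> counting_measure R).
Hypothesis mNn : forall n, point_process (Nn n).
Hypothesis mN : point_process N.

Lemma measurable_grid_code e (U : measurableType e) (V : U -> counting_measure R) m :
  point_process V -> measurable_fun setT (fun w => grid_code m (V w)).
Proof.
move=> mV; apply: measurable_fun_nat => k.
have [[c Hc]|no] := grid_code_fiber R m k; last first.
  by rewrite (_ : _ @^-1` _ = set0)//; apply/seteqP; split=> w //= /no.
have -> : (fun w => grid_code m (V w)) @^-1` [set k] =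
   \bigcap_(j < (m.+1 * m.+1)%N) ((fun w => V w (cell m.+1 j)) @^-1` [set (c j)%:R%:E]).
  by apply/seteqP; split=> w; [move=> /Hc h j; exact: h|move=> h; apply/Hc].
apply: bigcap_measurable => [|j _]; first by exists 0%N.
by apply: preimageT_measurable; [exact: mV (measurable_cell _ _)|exact: emeasurable_set1].
Qed.

Hypothesis cells_cvg : forall m (c : nat -> nat),
  P [set w | forall j, (j < m.+1 * m.+1)%N -> Nn n w (@cell R m.+1 j) = (c j)%:R%:E]
    @[n --> \oo] -->
  P' [set w | forall j, (j < m.+1 * m.+1)%N -> N w (@cell R m.+1 j) = (c j)%:R%:E].

Lemma grid_code_cvg m k :
  P ((fun w => grid_code m (Nn n w)) @^-1` [set k]) @[n --> \oo] -->
  P' ((fun w => grid_code m (N w)) @^-1` [set k]).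
Proof.
have [[c Hc]|no] := grid_code_fiber R m k; last first.
  have E U (V : U -> counting_measure R) :
      (fun w => grid_code m (V w)) @^-1` [set k] = set0.
    by apply/seteqP; split=> w //= /no.
  by under eq_fun do rewrite E measure0; rewrite E measure0; exact: cvg_cst.
have E U (V : U -> counting_measure R) :
    (fun w => grid_code m (V w)) @^-1` [set k] =
    [set w | forall j, (j < m.+1 * m.+1)%N -> V w (@cell R m.+1 j) = (c j)%:R%:E].
  by apply/seteqP; split=> w /= /Hc.
by under eq_fun do rewrite E; rewrite E; exact: cells_cvg.
Qed.

(* For a bounded continuous [phi], [hi m k] is the supremum of [phi] over all
   measures with [m]-th code [k]. Measures that share the codes of [mu] converge
   to [mu], so [hi m (grid_code m mu)] tends to [phi mu] from above, pointwise.
   Each [hi m] depends only on a discrete variable, whose law converges. *)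
Section one_function.
Variables (phi : counting_measure R -> R) (C : R).
Hypothesis phi_cont : continuous phi.
Hypothesis C0 : 0 <= C.
Hypothesis phiC : forall mu, `|phi mu| <= C.

Let fiber m k := [set phi nu | nu in [set nu | grid_code m nu = k]].
Let hi m k : R := sup (fiber m k).

Let has_sup_fiber m (mu : counting_measure R) : has_sup (fiber m (grid_code m mu)).
Proof.
split; first by exists (phi mu), mu.
by exists C => _ [nu _ <-]; apply: le_trans (phiC nu); exact: ler_norm.
Qed.

Let le_hi m (mu : counting_measure R) : phi mu <= hi m (grid_code m mu).
Proof. by apply: sup_upper_bound; [exact: has_sup_fiber|exists mu]. Qed.

Let hiC m k : `|hi m k| <= C.
Proof.
have [[mu <-]|no] := pselect (exists mu : counting_measure R, grid_code m mu = k); last first.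
  rewrite /hi (_ : fiber m k = set0) ?sup0 ?normr0//.
  by apply/seteqP; split=> x //= [nu /= E _]; apply: no; exists nu.
rewrite ler_norml; apply/andP; split.
  apply: le_trans (le_hi m mu).
  by rewrite lerNl; apply: le_trans (phiC mu); rewrite -normrN ler_norm.
apply: ge_sup; first by exists (phi mu), mu.
by move=> _ [nu _ <-]; apply: le_trans (phiC nu); exact: ler_norm.
Qed.

Let hi_cvg (mu : counting_measure R) : hi m (grid_code m mu) @[m --> \oo] --> phi mu.
Proof.
(* Almost optimal measures share the codes of [mu], so they converge to it. *)
have near_sup m : exists nu : counting_measure R, grid_code m nu = grid_code m mu /\
    hi m (grid_code m mu) - m.+1%:R^-1 < phi nu.
  have := sup_adherent (_ : 0 < m.+1%:R^-1) (has_sup_fiber m mu).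
  by case=> [|_ [nu nuE <-] h]; [rewrite invr_gt0|exists nu].
have [nu nuP] := choice near_sup.
have cvnu : nu @ \oo --> mu.
  by apply: same_grid_cvg => m; apply: grid_code_inj; case: (nuP m).
have cvphi : phi (nu m) @[m --> \oo] --> phi mu.
  exact: (continuous_cvg _ (@phi_cont mu) cvnu).
apply: (@squeeze_cvgr _ _ _ _ (fun=> phi mu) (fun m => phi (nu m) + m.+1%:R^-1)).
- near=> m; rewrite le_hi/=; case: (nuP m) => _; rewrite ltrBlDr; exact: ltW.
- exact: cvg_cst.
- rewrite -[X in _ --> X]addr0; apply: cvgD => //; exact: cvg_harmonic.
Unshelve. all: by end_near. Qed.

(** A limit of functions of finitely many cell counts is measurable. This
    replaces the identification of the Borel sets of the vague topology. *)
Lemma measurable_comp_continuous e (U : measurableType e) (V : U -> counting_measure R) :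
  point_process V -> measurable_fun setT (phi \o V).
Proof.
move=> mV; apply: (@measurable_fun_cvg _ _ _ _ (fun m w => hi m (grid_code m (V w)))).
  move=> m; exact: (@measurableT_comp _ _ _ _ _ _ (hi m) _ _ _ (measurable_grid_code m mV)).
by move=> w _; exact: hi_cvg.
Qed.

(** One half of the convergence of expectations; applying it to [- phi] gives
    the other half. *)
Lemma expectation_upper (e : R) : 0 < e ->
  \forall n \near \oo, \int[P]_w phi (Nn n w) <= \int[P']_w phi (N w) + e.
Proof.
move=> e0.
have mh m e' (U : measurableType e') (V : U -> counting_measure R) : point_process V ->
    measurable_fun setT (fun w => hi m (grid_code m (V w))).
  by move=> mV; exact: (@measurableT_comp _ _ _ _ _ _ (hi m) _ _ _ (measurable_grid_code m mV)).
have dct : \int[P']_w hi m (grid_code m (N w)) @[m --> \oo] --> \int[P']_w phi (N w).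
  have intphi : P'.-integrable setT (EFin \o (phi \o N)).
    by apply: (@bounded_integrable _ _ _ _ _ C); [exact: measurableT|exact: measurable_comp_continuous|move=> w; exact: phiC].
  apply: fine_cvg; rewrite fineK; last exact: integrable_fin_num intphi.
  apply: (@dominated_cvg _ _ _ _ _ _ _ _ (cst C%:E)) => //.
  - by move=> m; apply/measurable_EFinP; exact: mh.
  - by move=> w _; apply: cvg_EFin; [exact: nearW|exact: hi_cvg].
  - by apply: (@bounded_integrable _ _ _ _ (cst C) `|C|).
  - by move=> m w _; rewrite /= lee_fin.
have [m hm] : exists m, \int[P']_w hi m (grid_code m (N w)) <= \int[P']_w phi (N w) + e / 2.
  have e2 : 0 < e / 2 by rewrite divr_gt0.
  move/cvgrPdist_le : dct => /(_ _ e2)[m _ /(_ m (leqnn m))]/= h1.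
  exists m; move: h1; rewrite ler_norml => /andP[h1 _]; lra.
have cv : \int[P]_w hi m (grid_code m (Nn n w)) @[n --> \oo] -->
    \int[P']_w hi m (grid_code m (N w)).
  apply: (cvg_discrete_expectation (h := hi m) (C := C)) => //.
  - by move=> n; exact: measurable_grid_code.
  - exact: measurable_grid_code.
  - exact: grid_code_cvg.
have e2 : 0 < e / 2 by rewrite divr_gt0.
move/cvgrPdist_le : cv => /(_ _ e2); apply: filterS => n.
rewrite ler_norml => /andP[h1 _].
have h2 : \int[P]_w phi (Nn n w) <= \int[P]_w hi m (grid_code m (Nn n w)).
  apply: le_Rintegral => //.
  - by apply: (@bounded_integrable _ _ _ _ _ C); [exact: measurableT|exact: measurable_comp_continuous|move=> w; exact: phiC].
  - by apply: (@bounded_integrable _ _ _ _ _ C); [exact: measurableT|exact: mh|move=> w; exact: hiC].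
lra.
Qed.

End one_function.

(** Convergence of the joint laws of the counts on the countably many grids is
    enough for weak convergence: continuity of [phi] is only used along sequences
    of measures that share exact counts with their limit, so points near the
    boundary of a cell cause no discontinuity. *)
Lemma cvg_in_distribution_cells : cvg_in_distribution P P' Nn N.
Proof.
split=> // phi cphi [C phiC].
have phiC' mu : `|phi mu| <= `|C| by exact: le_trans (phiC mu) (ler_norm _).
have mphi e (U : measurableType e) (V : U -> counting_measure R) :
    point_process V -> measurable_fun setT (phi \o V).
  by move=> mV; exact: (measurable_comp_continuous cphi phiC' mV).
have int e (U : measurableType e) (Q : probability U R) (V : U -> counting_measure R) :
    point_process V -> Q.-integrable setT (EFin \o (phi \o V)).
  by move=> mV; apply: (@bounded_integrable _ _ _ _ _ C); [exact: measurableT|exact: mphi|move=> w; exact: phiC].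
have EE e (U : measurableType e) (Q : probability U R) (V : U -> counting_measure R) :
    point_process V -> ('E_Q[phi \o V] = (\int[Q]_w phi (V w))%:E)%E.
  by move=> mV; rewrite unlock /Rintegral fineK//; exact: integrable_fin_num (int _ _ Q V mV).
rewrite EE//; under eq_fun do rewrite EE//.
apply: cvg_EFin; first exact: nearW.
apply/cvgrPdist_le => e e0.
have cNphi : continuous (fun mu => - phi mu) by move=> mu; exact: (cvgN (@cphi mu)).
have NphiC mu : `|- phi mu| <= `|C| by rewrite normrN.
have U1 := expectation_upper cphi (normr_ge0 C) phiC' e0.
have U2 := expectation_upper cNphi (normr_ge0 C) NphiC e0.
near=> n.
have h1 : \int[P]_w phi (Nn n w) <= \int[P']_w phi (N w) + e by near: n.
have h2 : \int[P]_w - phi (Nn n w) <= \int[P']_w - phi (N w) + e by near: n.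
have NR e' (U : measurableType e') (Q : probability U R) (V : U -> counting_measure R) :
    point_process V -> \int[Q]_w (- phi (V w)) = - \int[Q]_w phi (V w).
  move=> mV; under eq_Rintegral do rewrite -mulN1r.
  by rewrite RintegralZl ?mulN1r//; exact: int.
move: h1 h2; rewrite !NR// /= ler_norml => h1 h2; apply/andP; split; lra.
Unshelve. all: by end_near. Qed.

End weak_convergence.

(** * Exponential gaps *)

Section gaps.
Variable R : realType.
Let U : probability (measurableTypeR R) R := uniform_prob (@ltr01 R).

Lemma uniform01_oo (x : R) : 0 <= x -> x <= 1 -> U `]x, 1[%classic = (1 - x)%:E.
Proof.
move=> x0 x1; rewrite /U/= /uniform_prob.
rewrite (eq_integral (cst 1%E)); last first.
  move=> z; rewrite inE/= /uniform_pdf subr0 invr1 => /itvP zxy.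
  by have -> : 0 <= z <= 1 by rewrite zxy (le_trans x0)// zxy.
rewrite integral_cst//= mul1e lebesgue_measure_itv/= lte_fin.
by case: ltP => // yx; rewrite (le_anti (introT andP (conj x1 yx))) subrr.
Qed.

Lemma uniform01_core_oo (A : set (measurableTypeR R)) : measurable A ->
  U A = U (A `&` `]0, 1[%classic).
Proof.
move=> mA; rewrite -[in LHS](setIT A) -(setUv `]0, 1[%classic) setIUr measureU//.
- rewrite [X in (_ + X)%E](_ : _ = 0%E) ?adde0//.
  apply/eqP; rewrite -measure_le0.
  apply: (@le_trans _ _ (U (~` `]0, 1[%classic))).
    rewrite le_measure ?inE//; last exact: measurableC.
    by apply: measurableI => //; exact: measurableC.
  rewrite probability_setC// uniform01_oo// subr0 subee//.
- exact: measurableI.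
- by apply: measurableI => //; exact: measurableC.
- by rewrite setIACA setICr setI0.
Qed.

(** Inverse transform of a uniform variable into an exponential one; the value 1
    off ]0, 1[ only makes every gap positive. *)
Definition exponential_gap (u : measurableTypeR R) : measurableTypeR R :=
  if (0 < u < 1)%R then - ln u else 1.

Lemma exponential_gap_gt0 u : 0 < exponential_gap u.
Proof.
rewrite /exponential_gap; case: ifP => // /andP[u0 u1].
by rewrite oppr_gt0 ln_lt0// u0.
Qed.

Lemma measurable_exponential_gap : measurable_fun setT exponential_gap.
Proof.
apply: measurable_fun_ifT => //.
  by apply: measurable_and; apply: measurable_fun_ltr.
by apply: measurableT_comp => //; exact: measurable_ln.
Qed.

Lemma exponential_gap_cdf (x : R) : 0 <= x -> U (exponential_gap @^-1` `]-oo, x[%classic) = (1 - expR (- x))%:E.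
Proof.
move=> x0; rewrite uniform01_core_oo; last exact: preimageT_measurable measurable_exponential_gap _.
rewrite (_ : _ `&` _ = `]expR (- x), 1[%classic).
  by rewrite uniform01_oo ?expR_ge0// -expR0 ler_expR oppr_le0.
apply/seteqP; split=> u /=; rewrite !in_itv/= /exponential_gap.
  by move=> [+ /andP[u0 u1]]; rewrite u0 u1/= andbT ltrNl -ltr_expR lnK// posrE.
move=> /andP[h1 u1]; have u0 : 0 < u by exact: lt_trans (expR_gt0 _) h1.
by rewrite u0 u1/= ltrNl -ltr_expR lnK// posrE.
Qed.

Lemma exponential_gap_cdf_neg (x : R) : x <= 0 -> U (exponential_gap @^-1` `]-oo, x[%classic) = 0%E.
Proof.
move=> x0; rewrite (_ : _ @^-1` _ = set0) ?measure0//.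
apply/seteqP; split=> u //=; rewrite in_itv/= => h.
by have := lt_trans (exponential_gap_gt0 u) (lt_le_trans h x0); rewrite ltxx.
Qed.

(** Memorylessness, in the form: on the event that the gap exceeds [l], the
    excess has the exponential law, up to the factor [expR (- l)]. *)
Lemma exponential_gap_memoryless (l : R) (B : set (measurableTypeR R)) : 0 <= l -> measurable B ->
  U ((fun u => exponential_gap u - l) @^-1` B `&` exponential_gap @^-1` `[l, +oo[%classic) =
  ((expR (- l))%:E * U (exponential_gap @^-1` B))%E.
Proof.
move=> l0 mB.
have mg := measurable_exponential_gap.
apply: (@eq_law_ray _ _ _ _ R U U (fun u => exponential_gap u - l) exponential_gap) => //.
- by apply: measurable_funB.
- exact: preimageT_measurable.
move=> x; have [x0|x0] := leP x 0.
  rewrite exponential_gap_cdf_neg// mule0 (_ : _ `&` _ = set0) ?measure0//.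
  by apply/seteqP; split=> u //=; rewrite !in_itv/= andbT; lra.
have -> : (fun u => exponential_gap u - l) @^-1` `]-oo, x[%classic `&` exponential_gap @^-1` `[l, +oo[%classic =
   exponential_gap @^-1` `]-oo, l + x[%classic `\` exponential_gap @^-1` `]-oo, l[%classic.
  apply/seteqP; split=> u /=; rewrite !in_itv/= andbT.
    by move=> [h1 h2]; split; [lra|move=> h3; lra].
  by move=> [h1 /negP]; rewrite -leNgt => h2; split=> //; lra.
rewrite measureD//; last 3 first.
- exact: preimageT_measurable.
- exact: preimageT_measurable.
- by rewrite -ge0_fin_numE// fin_num_measure//; exact: preimageT_measurable.
rewrite setIidr; last by move=> u /=; rewrite !in_itv/=; lra.
have lx0 : 0 <= l + x by rewrite addr_ge0// ltW.
rewrite [X in (X - _)%E](exponential_gap_cdf lx0) [X in (_ - X)%E](exponential_gap_cdf l0) [X in (_ * X)%E](exponential_gap_cdf (ltW x0)).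
by rewrite -EFinM -EFinB opprD expRD; congr EFin; lra.
Qed.

(** Conditioning on the first gap: after it, the remaining time [s - gap] must
    contain [c] more points. In the variable [u], with gap [- ln u], the integrand
    is [expR (- s) * (s + ln u) ^+ c / c!] divided by [u], which has the explicit
    primitive [F]. *)
Lemma exponential_gap_renewal_integral (s : R) (c : nat) : 0 < s ->
  (\int[U]_u ((exponential_gap u < s)%R%:R * poisson_pmf (s - exponential_gap u) c)%:E = (poisson_pmf s c.+1)%:E)%E.
Proof.
move=> s0.
pose f (u : R) := expR (- s) * (s + ln u) ^+ c / c`!%:R / u.
pose F (u : R) := expR (- s) * (s + ln u) ^+ c.+1 / (c.+1)`!%:R.
set a := expR (- s).
have a0 : 0 < a by exact: expR_gt0.
have a1 : a < 1 by rewrite /a -expR0 ltr_expR oppr_lt0.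
have cf (u : R) : 0 < u -> {for u, continuous f}.
  move=> u0; apply: cvgM; last by apply: cvgV => //; rewrite gt_eqF.
  apply: cvgM; last exact: cvg_cst.
  apply: cvgM; first exact: cvg_cst.
  apply: (@continuous_cvg _ _ _ _ _ _ (fun x : R => x ^+ c)); first exact: exprn_continuous.
  by apply: cvgD; [exact: cvg_cst|exact: continuous_ln].
have dF (u : R) : 0 < u -> is_derive u 1 F (f u).
  move=> u0; have dln := is_derive1_ln u0.
  have h1 : is_derive u 1 (fun v : R => s + ln v) u^-1.
    by rewrite -[X in is_derive _ _ _ X]add0r; apply: is_deriveD.
  have h2 := @is_deriveX R R (fun v : R => s + ln v) c.+1 u 1 _ h1.
  have h3 := @is_deriveZ _ _ _ _ (expR (- s) / (c.+1)`!%:R) _ _ _ h2.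
  have -> : F = (expR (- s) / (c.+1)`!%:R) \*: (fun v : R => s + ln v) ^+ c.+1.
    by apply/funext => v; rewrite /F exprfctE /GRing.scale/= mulrAC.
  apply: is_derive_eq; rewrite /f /GRing.scale/= factS natrM.
  have c1 : 1 + c%:R != 0 :> R by rewrite nat1r pnatr_eq0.
  have c2 : c`!%:R != 0 :> R by rewrite pnatr_eq0 -lt0n fact_gt0.
  by field; rewrite (gt_eqF u0) c1 c2.
have cF (u : R) : 0 < u -> {for u, continuous F}.
  move=> u0; have h := dF u u0.
  by apply: differentiable_continuous; apply/derivable1_diffP; exact: ex_derive.
have mfoo : measurable_fun (`]a, 1[%classic : set (measurableTypeR R)) f.
  apply: subspace_continuous_measurable_fun => //.
  apply: continuous_in_subspaceT => u; rewrite inE/= in_itv/= => /andP[au _].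
  by apply: cf; exact: lt_trans au.
pose g (u : measurableTypeR R) : R := (exponential_gap u < s)%R%:R * poisson_pmf (s - exponential_gap u) c.
have mg : measurable_fun setT g.
  apply: measurable_funM.
    apply: measurableT_comp => //; apply: measurable_fun_ltr => //; exact: measurable_exponential_gap.
  apply: (@measurableT_comp _ _ _ _ _ _ (poisson_pmf ^~ c)); first exact: measurable_poisson_pmf.
  by apply: measurable_funB => //; exact: measurable_exponential_gap.
have g0 u : 0 <= g u by rewrite mulr_ge0// poisson_pmf_ge0.
rewrite -/g integral_uniform; last 2 first.
- exact/measurable_EFinP.
- by move=> u; rewrite lee_fin; exact: g0.
rewrite subr0 invr1 mul1e integral_itv_bndoo; last first.
  by apply/measurable_EFinP; exact: measurable_funS mg.
have -> : `]0%R, 1%R[%classic = `]0%R, a] `|` `]a, 1%R[ :> set (measurableTypeR R).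
  apply/seteqP; split=> u /=; rewrite !in_itv/=.
    by move=> /andP[-> ->]; case: (leP u a); [left|right].
  move=> [/andP[-> ua]|/andP[au ->]]; first exact: le_lt_trans a1.
  by rewrite (lt_trans a0).
rewrite ge0_integral_setU//=; last 3 first.
- by apply/measurable_EFinP; exact: measurable_funS mg.
- by move=> u _; rewrite lee_fin; exact: g0.
- apply/disj_set2P/seteqP; split=> u //=; rewrite !in_itv/= => -[/andP[_ h1] /andP[h2 _]].
  by move: (lt_le_trans h2 h1); rewrite ltxx.
(* For [u <= expR (- s)] the gap is at least [s] and the integrand is zero. *)
rewrite [X in (X + _)%E]integral0_eq ?add0e; last first.
  move=> u /=; rewrite in_itv/= => /andP[u0 ua].
  have u1 : u < 1 by exact: le_lt_trans a1.
  rewrite /g /exponential_gap u0 u1/= ltrNl -ltr_expR lnK ?posrE// -/a ltNge ua/=.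
  by rewrite mul0r.
rewrite (eq_integral (fun u : measurableTypeR R => (f u)%:E)); last first.
  move=> u; rewrite inE/= in_itv/= => /andP[au u1].
  have u0 : 0 < u by exact: lt_trans au.
  have h : - s < ln u by rewrite -ltr_expR lnK ?posrE.
  rewrite /g /exponential_gap u0 u1/= ltrNl h mul1r opprK /poisson_pmf ifT; last by lra.
  by rewrite /f opprD expRD expRN (expRN (ln u)) lnK ?posrE//; congr EFin; rewrite /=; ring.
rewrite -(integral_itv_bndoo true false); last exact/measurable_EFinP.
rewrite (@continuous_FTC2 _ f F)//; last 3 first.
- apply: continuous_in_subspaceT => u; rewrite inE/= in_itv/= => /andP[au _].
  by apply: cf; exact: lt_le_trans au.
- split.
  + move=> u; rewrite in_itv/= => /andP[au _].
    by have := dF u (lt_trans a0 au) => ?; exact: ex_derive.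
  + by apply: cvg_at_right_filter; exact: cF.
  + by apply: cvg_at_left_filter; exact: cF.
- move=> u; rewrite in_itv/= => /andP[au _].
  by have := dF u (lt_trans a0 au) => ?; rewrite derive1E derive_val.
rewrite -EFinB /F ln1 addr0 /a expRK subrr expr0n/= mulr0 mul0r subr0.
by rewrite /poisson_pmf s0; congr EFin; ring.
Qed.

End gaps.

(** * A Poisson process built from its gaps *)

Lemma law_exists d (O : measurableType d) d' (E : measurableType d') (R : realType)
    (P : probability O R) (f : O -> E) : measurable_fun setT f ->
  exists Q : probability E R, (forall B, measurable B -> Q B = P (f @^-1` B)) /\
    (forall g : E -> \bar R, measurable_fun setT g -> (forall x, 0 <= g x)%E ->
      (\int[Q]_x g x = \int[P]_w g (f w))%E).
Proof.
move=> mf; pose F : {mfun O >-> E} := HB.pack f (isMeasurableFun.Build _ _ _ _ f mf).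
exists (distribution P F); split=> // g mg g0.
exact: (@ge0_integral_distribution _ _ _ _ _ P F g mg g0).
Qed.

Section poisson_from_gaps.
Context d (O : measurableType d) (R : realType) (P : probability O R).
Variables (xi : O -> measurableTypeR R) (th : O -> O).
Hypothesis xi_iid : iid_shift P xi th.
Hypothesis xi_law : forall x, P [set w | xi w < x] = (clamp x)%:E.
Let U : probability (measurableTypeR R) R := uniform_prob (@ltr01 R).

Let mxi : measurable_fun setT xi. Proof. by case: xi_iid. Qed.
Let mth : measurable_fun setT th. Proof. by case: xi_iid. Qed.

Lemma uniform_law B : measurable B -> P (xi @^-1` B) = U B.
Proof.
move=> mB; have := @eq_law_ray _ _ _ _ R P U xi id setT 1 mxi _ measurableT ler01 _ B mB.
rewrite setIT mul1e preimage_id; apply => // x.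
rewrite setIT mul1e preimage_id [RHS]uniform01_ray -xi_law; congr (P _).
Qed.

Definition gap (w : O) : measurableTypeR R := exponential_gap (xi w).

Lemma measurable_gap : measurable_fun setT gap.
Proof. exact: measurableT_comp (@measurable_exponential_gap R) mxi. Qed.

Let G := projT1 (cid (law_exists U (@measurable_exponential_gap R))).

Let GE B : measurable B -> G B = P (gap @^-1` B).
Proof.
rewrite /G; case: cid => /= Q [QE _] mB; rewrite QE//.
rewrite -uniform_law//; exact: preimageT_measurable (@measurable_exponential_gap R) _.
Qed.

Let Gint (g : measurableTypeR R -> \bar R) : measurable_fun setT g ->
  (forall x, 0 <= g x)%E -> (\int[G]_x g x = \int[U]_u g (exponential_gap u))%E.
Proof. by rewrite /G; case: cid => /= Q [_ QE]; exact: QE. Qed.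

Let pr w : measurableTypeR R * O := (gap w, th w).

Let mpr : measurable_fun setT pr.
Proof. by apply: measurable_fun_pair => //; exact: measurable_gap. Qed.

Let indep A B : measurable A -> measurable B ->
  P (gap @^-1` A `&` th @^-1` B) = (P (gap @^-1` A) * P B)%E.
Proof.
move=> mA mB; case: xi_iid => _ _ h.
exact: (h (@exponential_gap R @^-1` A) B (preimageT_measurable (@measurable_exponential_gap R) mA) mB).
Qed.

Lemma joint_law (H : set (measurableTypeR R * O)) : measurable H -> P (pr @^-1` H) = (G \x P)%E H.
Proof.
move=> mH; have [Q [QE _]] := law_exists P mpr.
rewrite -QE//; apply/esym/product_measure_unique => // A B mA mB.
transitivity (P (pr @^-1` (A `*` B))); first by apply: QE; exact: measurableX.
by rewrite [X in (X * _)%E](GE mA) -indep.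
Qed.

(** The process restarts at every fixed time. On rectangles this is memorylessness
    of the gap together with its independence from the rest of the sequence, and
    rectangles determine a product measure. *)
Lemma memoryless_joint (l : R) (H : set (measurableTypeR R * O)) : 0 <= l -> measurable H ->
  P [set w | l <= gap w /\ H (gap w - l, th w)] = ((expR (- l))%:E * P (pr @^-1` H))%E.
Proof.
move=> l0 mH.
have mgl : measurable (gap @^-1` `[l, +oo[%classic).
  exact: preimageT_measurable measurable_gap _.
have mprl : measurable_fun setT (fun w => (gap w - l, th w) : measurableTypeR R * O).
  by apply: measurable_fun_pair => //; apply: measurable_funB => //; exact: measurable_gap.
pose q1 : {measure set (measurableTypeR R * O) -> \bar R} :=
  [the {measure set _ -> \bar R} of pushforward (mrestr P mgl)
    (fun w => (gap w - l, th w) : measurableTypeR R * O)].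
pose m1 : {measure set (measurableTypeR R * O) -> \bar R} :=
  [the {measure set _ -> \bar R} of mscale (NngNum (expR_ge0 l)) (q1 mprl)].
have E : (G \x P)%E H = m1 H.
  apply: product_measure_unique => // A B mA mB.
  rewrite /m1 /= /mscale /= /q1 /pushforward /mrestr /=.
  have -> : (fun w => (gap w - l, th w) : measurableTypeR R * O) @^-1` (A `*` B) `&` gap @^-1` `[l, +oo[%classic =
     xi @^-1` ((fun u => exponential_gap u - l) @^-1` A `&` exponential_gap (R:=R) @^-1` `[l, +oo[%classic) `&` th @^-1` B.
    by apply/seteqP; split=> w /= => [[[? ?] ?]|[[? ?] ?]].
  have mgA : measurable ((fun u : measurableTypeR R => exponential_gap u - l) @^-1` A
      `&` exponential_gap (R:=R) @^-1` `[l, +oo[%classic).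
    apply: measurableI; apply: preimageT_measurable => //; last exact: measurable_exponential_gap.
    by apply: measurable_funB => //; exact: measurable_exponential_gap.
  case: xi_iid => _ _ -> //.
  rewrite uniform_law// [X in (_ * (X * _))%E]exponential_gap_memoryless// !muleA -EFinM -expRD subrr expR0 mul1e.
  rewrite [X in _ = (X * _)%E](GE mA) -[X in (X * _)%E]uniform_law//; exact: preimageT_measurable (@measurable_exponential_gap R) _.
rewrite joint_law// E /m1 /= /mscale /= muleA -EFinM -expRD addNr expR0 mul1e.
rewrite /q1 /pushforward /mrestr /=; congr (P _); apply/seteqP; split=> w /=; rewrite in_itv/= andbT.
  by move=> [? ?].
by move=> [? ?].
Qed.

(** In a point [(s, (e, w))], [s] is the length of the current interval, [e] the
    distance from its left end to the next point, and [w] the source of the later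
    gaps. The interval contains exactly [c] points, and the configuration at its
    right end, given by the distance to the next point, is in [Next]. *)
Fixpoint step (Next : set (measurableTypeR R * O)) (c : nat) :
    set (measurableTypeR R * (measurableTypeR R * O)) :=
  if c is c'.+1 then
    [set x | x.2.1 < x.1 /\ step Next c' (x.1 - x.2.1, (gap x.2.2, th x.2.2))]
  else [set x | x.1 <= x.2.1 /\ Next (x.2.1 - x.1, x.2.2)].

Let mfst : measurable_fun setT (fun x : measurableTypeR R * (measurableTypeR R * O) => x.1).
Proof. exact: measurable_fst. Qed.
Let msndfst : measurable_fun setT (fun x : measurableTypeR R * (measurableTypeR R * O) => x.2.1).
Proof. by apply: measurableT_comp => //; exact: measurable_fst. Qed.
Let msndsnd : measurable_fun setT (fun x : measurableTypeR R * (measurableTypeR R * O) => x.2.2).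
Proof. by apply: measurableT_comp => //; exact: measurable_snd. Qed.

Lemma measurable_step Next c : measurable Next -> measurable (step Next c).
Proof.
move=> mN; elim: c => [|c IH].
  have -> : step Next 0 = [set x | x.1 <= x.2.1] `&`
     (fun x => (x.2.1 - x.1, x.2.2) : measurableTypeR R * O) @^-1` Next by [].
  apply: measurableI.
    rewrite -[X in measurable X]setTI.
    exact: (measurable_fun_ler mfst msndfst).
  apply: preimageT_measurable => //.
  by apply: measurable_fun_pair => //; apply: measurable_funB.
have -> : step Next c.+1 = [set x | x.2.1 < x.1] `&`
   (fun x => (x.1 - x.2.1, (gap x.2.2, th x.2.2)) : measurableTypeR R * (measurableTypeR R * O))
   @^-1` (step Next c) by [].
apply: measurableI.
  rewrite -[X in measurable X]setTI.
  exact: (measurable_fun_ltr msndfst mfst).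
apply: preimageT_measurable => //.
apply: measurable_fun_pair; first exact: measurable_funB.
by apply: measurable_fun_pair; apply: measurableT_comp => //; exact: measurable_gap.
Qed.

(** Induction on the number of points in the interval: no point is the memoryless
    property, one more point is [exponential_gap_renewal_integral]. The event [Next]
    factors out, which is the independence of increments. *)
Lemma step_law Next c s : measurable Next -> 0 < s ->
  P [set w | step Next c (s, pr w)] = ((poisson_pmf s c)%:E * P (pr @^-1` Next))%E.
Proof.
move=> mN; elim: c s => [|c IH] s s0.
  rewrite [LHS](@memoryless_joint s Next (ltW s0) mN).
  by rewrite /poisson_pmf s0 expr0 fact0 invr1 !mul1r.
pose H : set (measurableTypeR R * O) := [set x | x.1 < s /\ step Next c (s - x.1, pr x.2)].
have mH : measurable H.
  have -> : H = (fun x => (s, x) : measurableTypeR R * (measurableTypeR R * O)) @^-1` step Next c.+1.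
    by [].
  by apply: preimageT_measurable; [exact: measurable_fun_pair|exact: measurable_step].
rewrite [LHS](joint_law mH) /product_measure1.
set p := P (pr @^-1` Next).
have pfin : p = (fine p)%:E.
  by rewrite fineK// fin_num_measure//; exact: preimageT_measurable.
have p0 : 0 <= fine p by apply: fine_ge0; exact: measure_ge0.
have E e : P (xsection H e) = (fine p * ((e < s)%R%:R * poisson_pmf (s - e) c))%:E.
  rewrite (_ : xsection H e = [set w | e < s /\ step Next c (s - e, pr w)]); last first.
    by apply/seteqP; split=> w; rewrite /xsection/= inE.
  case: ltP => es; last first.
    by rewrite mul0r mulr0 (_ : [set _ | _] = set0) ?measure0//; apply/seteqP; split=> w // [].
  rewrite mul1r EFinM -pfin muleC -IH ?subr_gt0//.
  by congr (P _); apply/seteqP; split=> w // [].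
have mg : measurable_fun setT (fun e : measurableTypeR R => (e < s)%R%:R * poisson_pmf (s - e) c).
  apply: measurable_funM.
    by apply: measurableT_comp => //; apply: measurable_fun_ltr.
  apply: (@measurableT_comp _ _ _ _ _ _ (poisson_pmf ^~ c)); first exact: measurable_poisson_pmf.
  exact: measurable_funB.
rewrite (eq_integral (fun e : measurableTypeR R =>
  ((fine p)%:E * ((e < s)%R%:R * poisson_pmf (s - e) c)%:E)%E)); last first.
  by move=> e _; rewrite -EFinM; exact: E.
rewrite ge0_integralZl//; last 2 first.
- exact/measurable_EFinP.
- by move=> e _; rewrite lee_fin mulr_ge0// poisson_pmf_ge0.
rewrite Gint; last 2 first.
- exact/measurable_EFinP.
- by move=> e; rewrite lee_fin mulr_ge0// poisson_pmf_ge0.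
by rewrite exponential_gap_renewal_integral// -pfin muleC.
Qed.

Fixpoint chain (len : nat -> R) (c : nat -> nat) (m : nat) : set (measurableTypeR R * O) :=
  if m is m'.+1 then
    [set x | step (chain (len \o succn) (c \o succn) m') (c 0%N) (len 0%N, x)]
  else setT.

Lemma measurable_chain len c m : measurable (chain len c m).
Proof.
elim: m len c => //= m IH len c.
apply: (@preimageT_measurable _ _ _ _
  (fun x => (len 0%N, x) : measurableTypeR R * (measurableTypeR R * O))).
  exact: measurable_fun_pair.
by apply: measurable_step; exact: IH.
Qed.

Lemma chain_law (len : nat -> R) c m : (forall i, 0 < len i) ->
  P (pr @^-1` chain len c m) = (\prod_(i < m) poisson_pmf (len i) (c i))%:E.
Proof.
elim: m len c => [|m IH] len c len0.
  by rewrite big_ord0 preimage_setT probability_setT.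
rewrite big_ord_recl EFinM [LHS](@step_law _ (c 0%N) (len 0%N))//; last exact: measurable_chain.
congr (_ * _)%E; rewrite [LHS]IH; last by move=> i; exact: len0.
by congr EFin; apply: eq_bigr => i _.
Qed.

Definition pts (e : R) (w : O) (k : nat) : R := e + \sum_(j < k) gap (iter j th w).

Lemma gap_gt0 w : 0 < gap w. Proof. exact: exponential_gap_gt0. Qed.

Lemma ptsD e w c k : pts e w (c + k) = pts (pts e w c) (iter c th w) k.
Proof.
rewrite /pts big_split_ord/= addrA; congr (_ + _); apply: eq_bigr => j _.
by rewrite addnC iterD.
Qed.

Lemma ptsB e s w k : pts (e - s) w k = pts e w k - s.
Proof. by rewrite /pts addrAC. Qed.

Lemma ptsS e w k : pts e w k.+1 = pts (gap w) (th w) k + e.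
Proof.
rewrite /pts big_ord_recl/= addrC; congr (_ + _ + _).
by apply: eq_bigr => j _; rewrite /= -iterSr.
Qed.

Lemma pts_le e w k : e <= pts e w k.
Proof. by rewrite lerDl; apply: sumr_ge0 => j _; exact/ltW/gap_gt0. Qed.

(** The recursion of [step], solved in terms of the points: as they increase, a
    count is the threshold in the indices below which they lie in the interval,
    and no cardinal of a random set is needed. *)
Lemma stepP Next c s e w : step Next c (s, (e, w)) <->
  (forall k, (pts e w k < s) = (k < c)%N) /\ Next (pts e w c - s, iter c th w).
Proof.
elim: c s e w => [|c IH] s e w /=.
  have e0 : pts e w 0 = e by rewrite /pts big_ord0 addr0.
  rewrite e0; split=> [[se HN]|[h HN]]; split=> //.
    by move=> k; apply/negbTE; rewrite -leNgt; apply: le_trans se (pts_le _ _ _).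
  by rewrite leNgt -e0 h.
rewrite IH ptsS -iterSr; split.
  move=> [es [h HN]]; split; last first.
    by move: HN; rewrite opprB addrA.
  case=> [|k]; first by rewrite /pts big_ord0 addr0 es.
  by rewrite ptsS -ltrBrDr h.
move=> [h HN]; split; first by have := h 0%N; rewrite /pts big_ord0 addr0 => ->.
split; last by rewrite opprB addrA.
by move=> k; rewrite ltrBrDr -ptsS h.
Qed.

Lemma chainP (len : nat -> R) c m e w : (forall i, 0 < len i) ->
  chain len c m (e, w) <-> forall i, (i < m)%N -> forall k,
    (pts e w k < \sum_(j < i.+1) len j) = (k < \sum_(j < i.+1) c j)%N.
Proof.
elim: m len c e w => [|m IH] len c e w len0; first by split.
have -> : chain len c m.+1 (e, w) =
  step (chain (len \o succn) (c \o succn) m) (c 0%N) (len 0%N, (e, w)) by [].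
rewrite stepP (IH _ _ _ _ (fun i => len0 i.+1)); split.
  move=> [h0 h] [_|i im] k; first by rewrite !big_ord1.
  rewrite !(big_ord_recl i.+1)/=; have [kc|kc] := ltnP k (c 0%N).
    rewrite ltn_addr// ltr_wpDr//; first by apply: sumr_ge0 => j _; exact: ltW.
    by rewrite h0.
  rewrite -(subnKC kc) ltn_add2l -(h i)// ptsB ptsD.
  by rewrite ltrBlDl.
move=> h; split; first by move=> k; have := h 0%N isT k; rewrite !big_ord1.
move=> i im k; have := h i.+1 im (c 0%N + k)%N.
by rewrite !(big_ord_recl i.+1)/= ltn_add2l ptsD ptsB ltrBlDl.
Qed.

Definition arrival (k : nat) (w : O) : measurableTypeR R := pts (gap w) (th w) k.

Lemma measurable_arrival k : measurable_fun setT (arrival k).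
Proof.
apply: measurable_funD; first exact: measurable_gap.
apply: measurable_sum => j; apply: measurableT_comp; first exact: measurable_gap.
by apply: measurableT_comp => //; exact: measurable_iter.
Qed.

Lemma arrival_ge0 k w : 0 <= arrival k w.
Proof. by apply: le_trans (pts_le _ _ _); exact/ltW/gap_gt0. Qed.

Lemma arrival_increasing w : increasing_seq (fun k => arrival k w).
Proof.
apply: le_mono; apply: (@homo_ltn _ (arrival^~ w) (fun x y => x < y)); first exact: lt_trans.
by move=> k; rewrite /arrival /pts ltrD2l big_ord_recr/= ltrDl gap_gt0.
Qed.

Lemma arrival_law (t : nat -> R) (c : nat -> nat) m : t 0%N = 0 -> increasing_seq t ->
  P [set w | forall i, (i < m)%N -> forall k,
      (arrival k w < t i.+1) = (k < \sum_(j < i.+1) c j)%N] =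
  (\prod_(i < m) poisson_pmf (t i.+1 - t i) (c i))%:E.
Proof.
move=> t0 ti; have len0 i : 0 < t i.+1 - t i.
  by rewrite subr_gt0 (leW_mono ti) ltEnat/= ltnSn.
rewrite -(@chain_law (fun i => t i.+1 - t i))//; congr (P _).
have E i : \sum_(j < i.+1) (t j.+1 - t j) = t i.+1.
  by rewrite -(big_mkord xpredT (fun j => t j.+1 - t j)) telescope_sumr// t0 subr0.
apply/seteqP; split=> w /=.
  by move=> h; apply/chainP => // i im k; rewrite E; exact: h.
by move=> /chainP h i im k; rewrite -E; exact: h.
Qed.

End poisson_from_gaps.

(** * Counts in intervals and thresholds *)

Section counting_thresholds.
Variable R : realType.

Lemma counting_II n : counting `I_n = n%:R%:E :> \bar R.
Proof.
rewrite /counting asboolT; last exact: finite_II.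
congr (_%:R%:E); apply/card_eq_fsetP; rewrite fset_setK; last exact: finite_II.
exact: card_eqxx.
Qed.

Lemma counting_le (A B : set nat) : A `<=` B -> (counting A <= counting B :> \bar R)%E.
Proof.
move=> AB; have := @le_measure _ _ _ (@counting nat R) A B.
by apply; rewrite ?inE.
Qed.

Lemma counting_initial (S : set nat) n : (forall i j, (i <= j)%N -> S j -> S i) ->
  counting S = n%:R%:E :> \bar R -> S = `I_n.
Proof.
move=> dS cS.
have Sn k : S k -> (k < n)%N.
  move=> Sk; have : `I_k.+1 `<=` S by move=> i /= ik; apply: dS Sk.
  by move=> /counting_le; rewrite counting_II cS lee_fin ler_nat.
apply/seteqP; split=> k /= kn; first exact: Sn.
apply: contrapT => Sk.
have : S `<=` `I_k.
  move=> i Si /=; rewrite ltnNge; apply/negP => ki; apply: Sk; exact: dS ki Si.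
by move=> /counting_le; rewrite counting_II cS lee_fin ler_nat leqNgt kn.
Qed.

(** The points below an endpoint form an initial segment of the indices, so that
    counting them amounts to locating a threshold; counts of intervals are
    differences of thresholds. *)
Lemma counting_thresholds (T t : nat -> R) (c : nat -> nat) m :
  increasing_seq T -> (forall k, 0 <= T k) -> t 0%N = 0 -> increasing_seq t ->
  (forall i, (i < m)%N ->
     counting [set k | T k \in `[t i, t i.+1[] = (c i)%:R%:E :> \bar R) <->
  (forall i, (i < m)%N -> forall k, (T k < t i.+1) = (k < \sum_(j < i.+1) c j)%N).
Proof.
move=> Ti T0 t0 ti.
have tS i : t i <= t i.+1 by rewrite ti.
have split_count i C : (forall k, (T k < t i) = (k < C)%N) ->
    counting [set k | T k < t i.+1] =
    (C%:R%:E + counting [set k | T k \in `[t i, t i.+1[])%E :> \bar R.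
  move=> hC; rewrite -counting_II.
  have -> : [set k | T k < t i.+1] = `I_C `|` [set k | T k \in `[t i, t i.+1[].
    apply/seteqP; split=> k /=; rewrite in_itv/= -hC.
      by move=> ->; rewrite andbT; case: (ltP (T k) (t i)); [left|right].
    by move=> [h|/andP[]//]; apply: lt_le_trans h _.
  apply: (@measureU _ _ _ (@counting nat R)) => //.
  apply/seteqP; split=> k //=; rewrite in_itv/= -hC => -[h1 /andP[h2 _]].
  by move: (lt_le_trans h1 h2); rewrite ltxx.
have ini (x : R) : forall i j, (i <= j)%N -> [set k | T k < x] j -> [set k | T k < x] i.
  by move=> i j ij /=; apply: le_lt_trans; rewrite Ti.
have h0 k : (T k < t 0%N) = (k < \sum_(j < 0) c j)%N.
  by rewrite big_ord0 ltn0 t0 ltNge T0.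
split=> h.
  have H i : (i <= m)%N -> forall k, (T k < t i) = (k < \sum_(j < i) c j)%N.
    elim: i => [_|i IH im]; first exact: h0.
    have := split_count i _ (IH (ltnW im)); rewrite h// -EFinD -natrD.
    have -> : (\sum_(j < i) c j + c i = \sum_(j < i.+1) c j)%N by rewrite big_ord_recr.
    move=> /(counting_initial (ini _)) E k.
    have : [set k | T k < t i.+1] k <-> `I_(\sum_(j < i.+1) c j) k by rewrite E.
    by move=> /= E'; apply/idP/idP => /E'.
  by move=> i im; exact: H.
move=> i im; have hi k : (T k < t i) = (k < \sum_(j < i) c j)%N.
  by case: i im k => [_|i im] k; [exact: h0|apply: h; exact: ltnW].
have := split_count i _ hi.
have -> : [set k | T k < t i.+1] = `I_(\sum_(j < i.+1) c j).
  by apply/seteqP; split=> k /=; rewrite h.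
rewrite counting_II big_ord_recr/= natrD.
by move: (counting _) => [r| |]//; rewrite -!EFinD => -[] /addrI ->.
Qed.

End counting_thresholds.

Lemma poisson_points_thresholds d (O : measurableType d) (R : realType)
    (P : probability O R) (T : nat -> {RV P >-> R}) :
  (forall k w, 0 <= T k w) -> (forall w, increasing_seq (fun k => T k w)) ->
  (forall (t : nat -> R) (c : nat -> nat) m, t 0%N = 0 -> increasing_seq t ->
    P [set w | forall i, (i < m)%N -> forall k,
      (T k w < t i.+1) = (k < \sum_(j < i.+1) c j)%N] =
    (\prod_(i < m) poisson_pmf (t i.+1 - t i) (c i))%:E) ->
  poisson_points 1 T.
Proof.
move=> T0 Ti Tlaw; split.
- by apply: aeW => w.
- by apply: aeW => w; exact: Ti.
move=> t t0 ti m c; under eq_bigr do rewrite mul1r.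
rewrite -Tlaw//; congr (P _); apply/seteqP; split=> w.
  by move=> h; apply/(counting_thresholds _ _ (Ti w) (T0^~ w) t0 ti) => i im; exact: h.
by move=> /(counting_thresholds _ _ (Ti w) (T0^~ w) t0 ti) h i im; exact: h.
Qed.

Lemma poisson_pmf_sum (R : realType) (r : R) : 0 < r ->
  (\sum_(k <oo) (poisson_pmf r k)%:E = 1)%E.
Proof.
move=> r0; have h : poisson_prob r 0%N [set: nat] = 1%E by exact: probability_setT.
rewrite -h /poisson_prob r0 nneseries_esumT// => k.
by rewrite lee_fin poisson_pmf_ge0.
Qed.

(** Poisson masses sum to 1, so the number of points in a bounded window is
    almost surely finite; strictly increasing points alone could accumulate. *)
Lemma thresholds_finite d (O : measurableType d) (R : realType) (P : probability O R)
    (T : nat -> O -> R) :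
  (forall (t : nat -> R) (c : nat -> nat) m, t 0%N = 0 -> increasing_seq t ->
    P [set w | forall i, (i < m)%N -> forall k,
      (T k w < t i.+1) = (k < \sum_(j < i.+1) c j)%N] =
    (\prod_(i < m) poisson_pmf (t i.+1 - t i) (c i))%:E) ->
  (forall k, measurable_fun setT (T k)) ->
  {ae P, forall w, forall B : nat, exists n, forall k, (T k w < B.+1%:R) = (k < n)%N}.
Proof.
move=> Tlaw mT; apply: ae_foralln => B.
pose A n : set O := [set w | forall k, (T k w < B.+1%:R) = (k < n)%N].
have mA n : measurable (A n).
  have -> : A n = \bigcap_k (fun w => T k w < B.+1%:R) @^-1` [set (k < n)%N].
    by apply/seteqP; split=> w h; [move=> k _; exact: h|move=> k; exact: h].
  apply: bigcap_measurable => [|k _]; first by exists 0%N.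
  by apply: preimageT_measurable => //; exact: measurable_fun_ltr.
have PA n : P (A n) = (poisson_pmf B.+1%:R n)%:E.
  have := Tlaw (fun i => i%:R * B.+1%:R) (fun=> n) 1%N (mul0r _).
  rewrite big_ord1 mul1r mul0r subr0 => <-.
    congr (P _); apply/seteqP; split=> w /=.
      by move=> h [|//] _ k; rewrite mul1r big_ord1; exact: h.
    by move=> h k; have := h 0%N isT k; rewrite mul1r big_ord1.
  by move=> i j; rewrite /= ler_pM2r ?ltr0n// ler_nat.
have mUA : measurable (\bigcup_n A n) by exact: bigcup_measurable.
have PU : P (\bigcup_n A n) = 1%E.
  rewrite measure_semi_bigcup//.
    rewrite -(@poisson_pmf_sum R B.+1%:R)//; apply: eq_eseriesr => n _; exact: PA.
  move=> i j _ _ [w [Ai Aj]]; apply/eqP; rewrite eqn_leq.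
  apply/andP; split; rewrite leqNgt; apply/negP.
    by rewrite -(Ai j) (Aj j) ltnn.
  by rewrite -(Aj i) (Ai i) ltnn.
exists (~` \bigcup_n A n); split; first exact: measurableC.
  by rewrite [LHS](probability_setC P mUA) [X in (_ - X)%E]PU subee.
by move=> w /= h [n _ An]; apply: h; exists n.
Qed.

(** * Point measures with marks *)

Section point_measure.
Variable R : realType.
Implicit Types (T : nat -> R) (z : nat -> nat).

(** The partial sums are integers; if they stay bounded they are eventually
    constant. *)
Lemma natsum_integer (m : nat -> nat) :
  (\sum_(i <oo) (m i)%:R%:E < +oo :> \bar R)%E ->
  exists k : nat, (\sum_(i <oo) (m i)%:R%:E = k%:R%:E :> \bar R)%E.
Proof.
move=> fin; pose S n := (\sum_(i < n) m i)%N.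
have SE n : (\sum_(0 <= i < n) (m i)%:R%:E = (S n)%:R%:E :> \bar R)%E.
  by rewrite big_mkord sumEFin natr_sum.
have S_le n : ((S n)%:R%:E <= \sum_(i <oo) (m i)%:R%:E :> \bar R)%E.
  rewrite -SE; apply: nneseries_lim_ge => k _ _; by rewrite lee_fin.
have s0 : (0 <= \sum_(i <oo) (m i)%:R%:E :> \bar R)%E.
  by apply: nneseries_ge0 => k _ _; rewrite lee_fin.
move: fin S_le s0; set s := (\sum_(i <oo) _)%E => fin S_le s0.
have sfin : s = (fine s)%:E by rewrite fineK// ge0_fin_numE.
have bd n : (S n <= Num.bound (fine s))%N.
  have := S_le n; rewrite sfin lee_fin => h.
  by rewrite -(ler_nat R) (le_trans h)// ltW// archi_boundP// fine_ge0.
have [N Nmax] : exists N, forall n, (S n <= S N)%N.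
  apply: contrapT => /forallNP H.
  have {}H N : exists n, (S N < S n)%N.
    by have /existsNP[n /negP] := H N; rewrite -ltnNge; exists n.
  have [n] : exists n, (Num.bound (fine s) < S n)%N.
    elim: (Num.bound _).+1 => [|j [n jn]]; first by exists 0%N.
    by have [n' nn'] := H n; exists n'; exact: leq_ltn_trans nn'.
  by rewrite ltnNge bd.
exists (S N); apply/eqP; rewrite eq_le; apply/andP; split; last exact: S_le.
rewrite /s; apply: lime_le; first by apply: is_cvg_nneseries => k _ _; rewrite lee_fin.
by near=> n; rewrite SE lee_fin ler_nat.
Unshelve. all: by end_near. Qed.

Definition point_sum T z (A : set (measurableTypeR R)) : \bar R :=
  (\sum_(i <oo) (z i)%:R%:E * (\1_A (T i))%:E)%E.

Definition locally_finite_pts T :=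
  forall B : nat, exists n, forall k, (T k < B.+1%:R) = (k < n)%N.

Let pm T z : {measure set (measurableTypeR R) -> \bar R} :=
  mseries (fun i => mscale (z i)%:R%:nng (dirac (T i : measurableTypeR R))) 0.

Let pmE T z A : pm T z A = point_sum T z A.
Proof. by []. Qed.

Lemma point_sum_nat T z A : point_sum T z A =
  (\sum_(i <oo) (z i * (T i \in A))%N%:R%:E)%E.
Proof. by apply: eq_eseriesr => i _; rewrite -EFinM natrM indicE. Qed.

Lemma point_sum_finite T z (A : set (measurableTypeR R)) n : (forall k, (n <= k)%N -> ~ A (T k)) ->
  point_sum T z A = (\sum_(i < n | T i \in A) z i)%N%:R%:E.
Proof.
move=> H; rewrite point_sum_nat (nneseries_split_cond 0%N n)// add0n.
  rewrite [X in (_ + X)%E]eseries0 ?adde0; last first.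
    by move=> k nk _; rewrite memNset ?muln0//; exact: H.
  rewrite big_mkord sumEFin -natr_sum [in RHS]big_mkcond/=.
  by congr (_%:R%:E); apply: eq_bigr => i _; case: ifP; rewrite ?muln1 ?muln0.
Qed.

Let pm_support T z : (forall k, 0 <= T k) -> pm T z [set x : R | x < 0] = 0%E.
Proof.
move=> T0; rewrite pmE (@point_sum_finite T z _ 0%N) ?big_ord0//.
by move=> k _ /=; apply/negP; rewrite -leNgt.
Qed.

Let pm_locally_finite T z b : locally_finite_pts T -> (pm T z `[0%R, b]%classic < +oo)%E.
Proof.
move=> fT; have [n hn] := fT (Num.bound `|b|).
rewrite pmE (@point_sum_finite T z _ n) ?ltry// => k nk /=; rewrite in_itv/= => /andP[_ Tb].
suff : T k < (Num.bound `|b|).+1%:R by rewrite hn ltnNge nk.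
apply: le_lt_trans Tb _; apply: le_lt_trans (ler_norm _) _.
by apply: lt_trans (archi_boundP (normr_ge0 b)) _; rewrite ltr_nat.
Qed.

Let pm_integer T z A : measurable A -> (pm T z A < +oo)%E ->
  exists m : nat, pm T z A = m%:R%:E.
Proof. by move=> _; rewrite pmE point_sum_nat; exact: natsum_integer. Qed.

Definition point_measure T z (T0 : forall k, 0 <= T k) (fT : locally_finite_pts T) :
    counting_measure R :=
  @CountingMeasure R (pm T z) (pm_support z T0) (fun b => pm_locally_finite z b fT)
    (@pm_integer T z).

Lemma point_measureE T z (h1 : forall k, 0 <= T k) (h2 : locally_finite_pts T) A :
  point_measure z h1 h2 A = point_sum T z A.
Proof. by []. Qed.

Definition good_pts T : Prop := (forall k, 0 <= T k) /\ locally_finite_pts T.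

(** A [counting_measure] must be locally finite for every outcome, while the
    points are so only almost surely. On the exceptional outcomes the points are
    replaced by the integers, with zero marks. *)
Definition fixed_pts T : nat -> R := if `[< good_pts T >] then T else fun k => k%:R.
Definition fixed_marks T z : nat -> nat := if `[< good_pts T >] then z else fun=> 0%N.

Lemma fixed_pts_good T : good_pts (fixed_pts T).
Proof.
rewrite /fixed_pts; case: asboolP => // _; split=> [k|B]; first by [].
by exists B.+1 => k; rewrite ltr_nat.
Qed.

Definition marked_measure T z : counting_measure R :=
  point_measure (fixed_marks T z) (proj1 (fixed_pts_good T)) (proj2 (fixed_pts_good T)).

Lemma marked_measureE T z A : good_pts T -> marked_measure T z A = point_sum T z A.
Proof.
by move=> g; rewrite point_measureE /fixed_marks /fixed_pts; case: asboolP.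
Qed.

Lemma marked_measure_bad T z A : ~ good_pts T -> marked_measure T z A = 0%E.
Proof.
move=> g; rewrite point_measureE /fixed_marks /fixed_pts; case: asboolP => // _.
by apply: eseries0 => k _ _; rewrite mul0e.
Qed.

Lemma point_process_marked d (O : measurableType d) (T : nat -> O -> R) (z : nat -> O -> nat) :
  (forall k, measurable_fun setT (T k)) -> (forall k, measurable_fun setT (z k)) ->
  point_process (fun w => marked_measure (T^~ w) (z^~ w)).
Proof.
move=> mT mz A mA.
have mg : measurable [set w | good_pts (T^~ w)].
  have -> : [set w | good_pts (T^~ w)] = (\bigcap_k (fun w => 0 <= T k w) @^-1` [set true]) `&`
     \bigcap_B \bigcup_n \bigcap_k ((fun w => T k w < B.+1%:R) @^-1` [set (k < n)%N]).
    apply/seteqP; split=> w /=.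
      move=> [h1 h2]; split; first by move=> k _; exact: h1.
      by move=> B _; have [n hn] := h2 B; exists n => // k _; exact: hn.
    move=> [h1 h2]; split; first by move=> k; exact: h1.
    by move=> B; have [n _ hn] := h2 B I; exists n => k; exact: hn.
  apply: measurableI.
    apply: bigcap_measurable => [|k _]; first by exists 0%N.
    by apply: preimageT_measurable => //; exact: measurable_fun_ler.
  apply: bigcap_measurable => [|B _]; first by exists 0%N.
  apply: bigcup_measurable => n _.
  apply: bigcap_measurable => [|k _]; first by exists 0%N.
  by apply: preimageT_measurable => //; exact: measurable_fun_ltr.
have -> : (fun w => marked_measure (T^~ w) (z^~ w) A) =
  (fun w => if w \in [set w | good_pts (T^~ w)] then point_sum (T^~ w) (z^~ w) A else 0%E).
  apply/funext => w; case: ifPn; rewrite (inE, notin_setE) /= => h.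
    exact: marked_measureE.
  exact: marked_measure_bad.
apply: measurable_fun_ifT => //.
  apply: (measurable_fun_bool true); rewrite setTI.
  rewrite (_ : _ @^-1` _ = [set w | good_pts (T^~ w)])//.
  by apply/seteqP; split=> w; [move/set_mem|move/mem_set].
apply: ge0_emeasurable_sum => k *.
  by rewrite mule_ge0// lee_fin.
apply: emeasurable_funM.
  apply/measurable_EFinP.
  by apply: (@measurableT_comp _ _ _ _ _ _ (fun n : nat => n%:R : R)) => //; exact: mz.
apply/measurable_EFinP.
by apply: (@measurableT_comp _ _ _ _ _ _ (\1_A : measurableTypeR R -> R)) => //; exact: mT.
Qed.

End point_measure.

(** * An integer variable with a prescribed law *)

Section quantile.
Variables (R : realType) (g : nat -> R).
Hypothesis g_ge0 : forall k, (1 <= k)%N -> 0 <= g k.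
Hypothesis g_sum1 : (\sum_(1 <= k <oo) (g k)%:E)%E = 1%E.

(** The law as a mass function on all integers, with the value at 0 forced to be
    0, since nothing constrains [g 0]. *)
Definition sizes (k : nat) : R := if k is 0 then 0 else g k.

Lemma sizes_ge0 k : 0 <= sizes k.
Proof. by case: k => //= k; exact: g_ge0. Qed.

Definition cum n : R := \sum_(k < n.+1) sizes k.

Lemma cumS n : cum n.+1 = cum n + sizes n.+1.
Proof. by rewrite /cum big_ord_recr. Qed.

Lemma cum_nd : {homo cum : m n / (m <= n)%N >-> m <= n}.
Proof. by apply: homo_leq => //; [exact: le_trans|move=> n; rewrite cumS lerDl sizes_ge0]. Qed.

Lemma cum0 : cum 0 = 0. Proof. by rewrite /cum big_ord1. Qed.

Lemma sizes_sum : (\sum_(k <oo) (sizes k)%:E = 1)%E.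
Proof.
rewrite nneseries_recl//; last by move=> k _; rewrite lee_fin sizes_ge0.
rewrite add0e -g_sum1; apply: congr_lim; apply/funext => n.
by apply: eq_big_nat => -[].
Qed.

Lemma cum_le1 n : cum n <= 1.
Proof.
rewrite -lee_fin -sizes_sum /cum -sumEFin -(big_mkord xpredT (fun k => (sizes k)%:E)).
by apply: nneseries_lim_ge => k _ _; rewrite lee_fin sizes_ge0.
Qed.

Definition quantile (x : measurableTypeR R) : nat :=
  if pselect (exists n, x < cum n) is left e then ex_minn e else 0.

Lemma quantileP x k : (0 < k)%N -> quantile x = k <-> cum k.-1 <= x < cum k.
Proof.
case: k => // k _ /=; rewrite /quantile; case: pselect => [e|no]; last first.
  by split=> // /andP[_ h]; exfalso; apply: no; exists k.+1.
case: ex_minnP => n xn nmin; split.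
  move=> nk; rewrite -nk xn andbT leNgt; apply/negP => h.
  by have := nmin _ h; rewrite nk ltnn.
move=> /andP[h1 h2]; apply/eqP; rewrite eqn_leq nmin//= ltnNge; apply/negP => nk.
by have := lt_le_trans xn (le_trans (cum_nd nk) h1); rewrite ltxx.
Qed.

Context d (O : measurableType d) (P : probability O R).
Variables (xi : O -> measurableTypeR R).
Hypothesis mxi : measurable_fun setT xi.
Hypothesis xi_law : forall x, P [set w | xi w < x] = (clamp x)%:E.

Lemma quantile_fiber k : (0 < k)%N -> quantile @^-1` [set k] = `[cum k.-1, cum k[%classic.
Proof.
by move=> k0; apply/seteqP; split=> x /=; rewrite in_itv/= => /(quantileP x k0).
Qed.

Lemma measurable_quantile : measurable_fun setT quantile.
Proof.
apply: measurable_fun_nat => -[|k]; last by rewrite quantile_fiber.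
have -> : quantile @^-1` [set 0%N] = ~` \bigcup_k (quantile @^-1` [set k.+1]).
  apply/seteqP; split=> x /=; first by move=> h0 [k _ h1]; have := etrans (esym h0) h1.
  by move=> h; case E : (quantile x) => [//|k]; exfalso; apply: h; exists k.
by apply: measurableC; apply: bigcup_measurable => k _; rewrite quantile_fiber.
Qed.

Lemma quantile_law k : P ((fun w => quantile (xi w)) @^-1` [set k]) = (sizes k)%:E.
Proof.
have mq : measurable_fun setT (fun w => quantile (xi w)).
  exact: measurableT_comp measurable_quantile mxi.
have clampc n : clamp (cum n) = cum n.
  rewrite /clamp max_l ?min_l ?cum_le1//.
  by rewrite -cum0; exact: cum_nd.
have pos n : P ((fun w => quantile (xi w)) @^-1` [set n.+1]) = (sizes n.+1)%:E.
  have mx (x : R) : measurable [set w | xi w < x].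
    rewrite -[X in measurable X]setTI; exact: (measurable_fun_ltr mxi (measurable_cst x)).
  have -> : (fun w => quantile (xi w)) @^-1` [set n.+1] =
      [set w | xi w < cum n.+1] `\` [set w | xi w < cum n].
    apply/seteqP; split=> w /=.
      by move=> /(quantileP (xi w) (ltn0Sn n))/= /andP[h1 h2]; split=> //; apply/negP; rewrite -leNgt.
    by move=> [h1 /negP]; rewrite -leNgt => h2; apply/(quantileP (xi w) (ltn0Sn n))/andP.
  rewrite measureD//; last by rewrite -ge0_fin_numE// fin_num_measure.
  rewrite setIidr; last by move=> w /= h; apply: lt_le_trans h (cum_nd _).
  rewrite [X in (X - _)%E]xi_law [X in (_ - X)%E]xi_law !clampc.
  by rewrite -EFinB cumS addrAC subrr add0r.
case: k => [|k]; last exact: pos.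
(* The value 0 gets what the positive values leave, namely nothing. *)
have total : (\sum_(k <oo) P ((fun w => quantile (xi w)) @^-1` [set k]) = 1)%E.
  pose F k := (fun w => quantile (xi w)) @^-1` [set k].
  have UF : \bigcup_k F k = setT.
    by apply/seteqP; split=> // w _; exists (quantile (xi w)).
  have mF k : measurable (F k) by exact: preimageT_measurable.
  rewrite -(@measure_semi_bigcup _ _ _ P F)//.
  - by rewrite UF; exact: probability_setT.
  - by move=> i j _ _ [w [/= <- <-]].
  - by apply: bigcup_measurable.
move: total; rewrite nneseries_recl//.
have -> : (\sum_(1 <= k <oo) P ((fun w => quantile (xi w)) @^-1` [set k]) = 1)%E.
  rewrite -g_sum1; apply: congr_lim; apply/funext => n.
  by apply: eq_big_nat => -[//|k] _; rewrite pos.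
have fin : P ((fun w => quantile (xi w)) @^-1` [set 0%N]) \is a fin_num.
  by rewrite fin_num_measure//; exact: preimageT_measurable.
rewrite /= -(fineK fin) -EFinD => -[] h; congr EFin; lra.
Qed.

End quantile.

Lemma iid_shift_comp d (O : measurableType d) (R : realType) (P : probability O R)
    d' (E : measurableType d') d'' (E' : measurableType d'') (Y : O -> E) (th : O -> O)
    (f : E -> E') :
  measurable_fun setT f -> iid_shift P Y th -> iid_shift P (f \o Y) th.
Proof.
move=> mf [mY mth H]; split=> //; first exact: measurableT_comp.
move=> A B mA mB; exact: (H _ _ (preimageT_measurable mf mA) mB).
Qed.

Lemma iid_shift_indep d (O : measurableType d) (R : realType) (P : probability O R)
    d' (E : measurableType d') (Y : O -> E) (th : O -> O) (B : nat -> set E) m :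
  iid_shift P Y th -> (forall i, measurable (B i)) ->
  P (\bigcap_(i < m) (fun w => Y (iter i th w)) @^-1` (B i)) =
  (\prod_(i < m) P (Y @^-1` (B i)))%E.
Proof.
move=> [mY mth H]; elim: m B => [|m IH] B mB.
  by rewrite big_ord0 bigcap_mkord big_ord0 probability_setT.
have mI : measurable (\bigcap_(i < m) (fun w => Y (iter i th w)) @^-1` (B i.+1)).
  apply: bigcap_measurableType => i _; apply: preimageT_measurable => //.
  by apply: measurableT_comp => //; exact: measurable_iter.
rewrite big_ord_recl; have := IH (B \o succn) (fun i => mB i.+1).
rewrite (eq_bigr (fun i : 'I_m => P (Y @^-1` B (lift ord0 i))))//= => <-.
rewrite -H//.
congr (P _); apply/seteqP; split=> w /=.
  move=> h; split; first exact: (h 0%N).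
  by move=> i im /=; rewrite -iterSr; exact: (h i.+1).
by move=> [h0 h] [_|i im]; [exact: h0|rewrite /= -iterS iterSr; exact: (h i)].
Qed.

(** The sets of paths with a measurable preimage form a sigma-algebra that
    contains the cylinders. *)
Lemma measurable_path d (O : measurableType d) d' (E : measurableType d')
    (f : nat -> O -> E) (A : set (nat -> E)) :
  (forall k, measurable_fun setT (f k)) -> product_sigma_algebra A ->
  measurable [set w | A (fun k => f k w)].
Proof.
move=> mf; move: A; apply: smallest_sub.
  split=> /=.
  - exact: measurable0.
  - move=> A mA; rewrite (_ : [set w | _] = ~` [set w | A (fun k => f k w)]).
      exact: measurableC.
    by apply/seteqP; split=> w; [case|].
  - move=> F mF; rewrite (_ : [set w | _] = \bigcup_i [set w | F i (fun k => f k w)]).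
      exact: bigcup_measurable.
    by apply/seteqP; split.
move=> _ [i _ [B mB <-]] /=.
rewrite (_ : [set w | _] = f i @^-1` B); first exact: preimageT_measurable.
by apply/seteqP; split=> w //= [].
Qed.

(** * The compound Poisson process and its cell counts *)

Lemma point_sum_cell (R : realType) (T : nat -> R) (z : nat -> nat) (M j a b : nat) :
  (forall k, (T k < j%:R / M%:R) = (k < a)%N) ->
  (forall k, (T k < j.+1%:R / M%:R) = (k < b)%N) ->
  point_sum T z (cell M j) = (\sum_(a <= i < b) z i)%N%:R%:E.
Proof.
move=> ha hb.
have Tcell i : ((T i : measurableTypeR R) \in @cell R M j) = (a <= i < b)%N.
  by rewrite mem_setE /cell in_itv/= hb leNgt ha -leqNgt.
rewrite (@point_sum_finite R T z _ b); last first.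
  by move=> k bk Tk; have := Tcell k; rewrite mem_set// => /esym /andP[_]; rewrite ltnNge bk.
congr (_%:R%:E); rewrite (big_nat_widenl a 0%N)// big_mkord.
by apply: eq_bigl => i; rewrite Tcell ltn_ord andbT.
Qed.

Lemma measure_le_ae d (O : measurableType d) (R : realType)
    (mu : {measure set O -> \bar R}) (A B : set O) :
  measurable A -> measurable B -> {ae mu, forall w, A w -> B w} -> (mu A <= mu B)%E.
Proof.
move=> mA mB [C [mC C0 AB]].
apply: (@le_trans _ _ (mu (B `|` C))).
  apply: le_measure; rewrite ?inE//; first exact: measurableU.
  move=> w Aw; have [Cw|nCw] := pselect (C w); [by right|left].
  by apply: contrapT => nB; apply: nCw; apply: AB => /= /(_ Aw).
by apply: le_trans (measureU2 _ mB mC) _; rewrite [X in (_ + X)%E]C0 adde0.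
Qed.

Lemma measure_eq_ae d (O : measurableType d) (R : realType)
    (mu : {measure set O -> \bar R}) (A B : set O) :
  measurable A -> measurable B -> {ae mu, forall w, A w <-> B w} -> mu A = mu B.
Proof.
move=> mA mB AB; apply/eqP; rewrite eq_le; apply/andP; split; apply: measure_le_ae => //.
  by apply: filterS AB => w [].
by apply: filterS AB => w [].
Qed.

Lemma locally_finite_thresholds (R : realType) (T : nat -> R) (x : R) :
  locally_finite_pts T -> increasing_seq T ->
  exists n, forall k, (T k < x) = (k < n)%N.
Proof.
move=> fT Ti; have [n0 hn0] := fT (Num.bound `|x|).
have ex : exists n, x <= T n.
  exists n0; have := hn0 n0; rewrite ltnn => /negbT; rewrite -leNgt; apply: le_trans.
  apply: le_trans (ler_norm _) _; apply/ltW.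
  by apply: lt_trans (archi_boundP (normr_ge0 x)) _; rewrite ltr_nat.
exists (ex_minn ex) => k; case: ex_minnP => n xn nmin.
apply/idP/idP => h.
  rewrite ltnNge; apply/negP => nk; move: h; apply/negP; rewrite -leNgt.
  by apply: le_trans xn _; rewrite Ti.
by rewrite ltNge; apply/negP => /nmin; rewrite leqNgt h.
Qed.

Section compound.
Context d (O : measurableType d) (R : realType) (P : probability O R).
Variables (xi : O -> measurableTypeR R) (th : O -> O) (g : nat -> R).
Hypothesis xi_iid : iid_shift P xi th.
Hypothesis xi_law : forall x, P [set w | xi w < x] = (clamp x)%:E.
Hypothesis g_ge0 : forall k, (1 <= k)%N -> 0 <= g k.
Hypothesis g_sum1 : (\sum_(1 <= k <oo) (g k)%:E)%E = 1%E.

Let mxi : measurable_fun setT xi. Proof. by case: xi_iid. Qed.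
Let mth : measurable_fun setT th. Proof. by case: xi_iid. Qed.

Let Q : probability (O * O)%type R := [the probability _ _ of (P \x P)%E].

Lemma prod_law A B : measurable A -> measurable B ->
  Q [set w | A w.1 /\ B w.2] = (P A * P B)%E.
Proof. exact: product_measure1E. Qed.

Lemma fst_law A : measurable A -> Q [set w | A w.1] = P A.
Proof.
move=> mA; rewrite -[RHS]mule1 -(probability_setT P) -prod_law//.
by congr (Q _); apply/seteqP; split=> w //= [].
Qed.

Lemma snd_law A : measurable A -> Q [set w | A w.2] = P A.
Proof.
move=> mA; rewrite -[RHS]mul1e -(probability_setT P) -prod_law//.
by congr (Q _); apply/seteqP; split=> w //= [].
Qed.

Let Tf (k : nat) (w : O * O) : R := arrival xi th k w.1.
Let zf (k : nat) (w : O * O) : nat := quantile g (xi (iter k th w.2)).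

Let mT k : measurable_fun setT (Tf k).
Proof.
apply: (@measurableT_comp _ _ _ _ _ _ (arrival xi th k)); last exact: measurable_fst.
exact: (measurable_arrival xi_iid).
Qed.

Let mq : measurable_fun setT (quantile g).
Proof. exact: measurable_quantile. Qed.

Let mz2 k : measurable_fun setT (fun v : O => quantile g (xi (iter k th v))).
Proof.
apply: (measurableT_comp mq); apply: (measurableT_comp mxi); exact: measurable_iter.
Qed.

Let mqx : measurable_fun setT (quantile g \o xi).
Proof. exact: measurableT_comp mq mxi. Qed.

Let mz k : measurable_fun setT (zf k).
Proof. exact: (measurableT_comp (mz2 k) measurable_snd). Qed.

Let T (k : nat) : {RV Q >-> R} := HB.pack (Tf k) (isMeasurableFun.Build _ _ _ _ (Tf k) (mT k)).
Let zeta (k : nat) : {RV Q >-> nat} := HB.pack (zf k) (isMeasurableFun.Build _ _ _ _ (zf k) (mz k)).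

Let N w : counting_measure R := marked_measure (Tf^~ w) (zf^~ w).

Let Tlaw (t : nat -> R) (c : nat -> nat) m : t 0%N = 0 -> increasing_seq t ->
    P [set w | forall i, (i < m)%N -> forall k,
      (arrival xi th k w < t i.+1) = (k < \sum_(j < i.+1) c j)%N] =
    (\prod_(i < m) poisson_pmf (t i.+1 - t i) (c i))%:E.
Proof. exact: arrival_law. Qed.

Let mthr (t : nat -> R) (c : nat -> nat) m :
  measurable [set w | forall i, (i < m)%N -> forall k,
      (arrival xi th k w < t i.+1) = (k < \sum_(j < i.+1) c j)%N].
Proof.
rewrite (_ : [set w | _] = \bigcap_(i < m) \bigcap_k
  (fun w => arrival xi th k w < t i.+1) @^-1` [set (k < \sum_(j < i.+1) c j)%N]); last first.
  by apply/seteqP; split=> w h; [move=> i im k _; exact: h|move=> i im k; exact: h].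
apply: bigcap_measurableType => i _; apply: bigcap_measurableType => k _.
apply: preimageT_measurable => //; apply: measurable_fun_ltr => //.
exact: (measurable_arrival xi_iid).
Qed.

Let poissonT : poisson_points 1 T.
Proof.
apply: poisson_points_thresholds.
- by move=> k w; exact: arrival_ge0.
- by move=> w; exact: arrival_increasing.
- by move=> t c m t0 ti; rewrite -Tlaw// -fst_law.
Qed.

Let good_ae : {ae Q, forall w, good_pts (Tf^~ w)}.
Proof.
have : {ae Q, forall w, forall B : nat, exists n, forall k, (Tf k w < B.+1%:R) = (k < n)%N}.
  apply: thresholds_finite => // t c m t0 ti.
  by rewrite -Tlaw// -fst_law.
by apply: filterS => w h; split=> // k; exact: arrival_ge0.
Qed.

Lemma compound_poisson_marked : compound_poisson Q g N.
Proof.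
exists 1, T, zeta; split.
- by split.
- move=> m B mB.
  rewrite (_ : \bigcap_(i < m) _ = [set w : O * O | (\bigcap_(i < m) (fun v => quantile g (xi (iter i th v))) @^-1` B i) w.2]); last by [].
  rewrite snd_law; last first.
    by apply: bigcap_measurableType => i _; exact: preimageT_measurable.
  rewrite (iid_shift_indep m (iid_shift_comp mq xi_iid) mB).
  apply: eq_bigr => i _.
  have mBi : measurable ((quantile g \o xi) @^-1` B i) by exact: preimageT_measurable.
  rewrite -(iid_shift_measure i xi_iid mBi) -snd_law//.
  by apply: preimageT_measurable => //; exact: measurable_iter.
- move=> i k k1.
  rewrite (_ : zeta i @^-1` [set k] = [set w : O * O | (iter i th @^-1` ((fun v => quantile g (xi v)) @^-1` [set k])) w.2]); last by [].
  have mk : measurable ((quantile g \o xi) @^-1` [set k]) by exact: preimageT_measurable.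
  rewrite snd_law; last by apply: preimageT_measurable => //; exact: measurable_iter.
  rewrite (iid_shift_measure i xi_iid mk).
  by rewrite [LHS](quantile_law g_ge0 g_sum1 mxi xi_law) {mk}; case: k k1.
- move=> A B pA pB.
  have mA : measurable [set v | A (fun k => quantile g (xi (iter k th v)))].
    by apply: (measurable_path (f := fun k v => quantile g (xi (iter k th v)))).
  have mB : measurable [set v | B (fun k => arrival xi th k v)].
    by apply: measurable_path => // k; exact: (measurable_arrival xi_iid).
  have := prod_law mB mA; rewrite -fst_law// -snd_law// muleC => <-.
  by congr (Q _); apply/seteqP; split=> w /= [].
- apply: filterS good_ae => w gw A mA; exact: marked_measureE.
Qed.

Lemma point_process_compound : point_process N.
Proof. exact: point_process_marked. Qed.

Let zpos_ae : {ae P, forall v, forall i, (0 < quantile g (xi (iter i th v)))%N}.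
Proof.
apply: ae_foralln => i.
have m0 : measurable ((quantile g \o xi) @^-1` [set 0%N]) by exact: preimageT_measurable.
exists (iter i th @^-1` ((quantile g \o xi) @^-1` [set 0%N])); split.
- by apply: preimageT_measurable => //; exact: measurable_iter.
- exact: etrans (iid_shift_measure i xi_iid m0) (quantile_law g_ge0 g_sum1 mxi xi_law 0%N).
- by move=> v /= /negP; rewrite -eqn0Ngt => /eqP.
Qed.

Section cells.
Variables (M K : nat) (c : nat -> nat).
Hypothesis M0 : (0 < M)%N.

(* [r j] is the number of points in cell [j], and [a r j] the index of its first
   point. *)
Let D := (\max_(j < K) c j).+1.
Let rn (r : {ffun 'I_K -> 'I_D}) (i : nat) : nat := if insub i is Some j then r j else 0.
Let a (r : {ffun 'I_K -> 'I_D}) (i : nat) : nat := (\sum_(j < i) rn r j)%N.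
Let time (i : nat) : R := i%:R / M%:R.

Let S r : set O := [set v | forall i, (i < K)%N -> forall k,
      (arrival xi th k v < time i.+1) = (k < \sum_(j < i.+1) rn r j)%N].
Let B r : set O := [set v | forall j, (j < K)%N ->
   (\sum_(a r j <= i < a r j.+1) quantile g (xi (iter i th v)))%N = c j].
Let V r : set (O * O) := [set w | S r w.1 /\ B r w.2].
Let E : set (O * O) := [set w | forall j, (j < K)%N -> N w (@cell R M j) = (c j)%:R%:E].

Let rnE r (j : 'I_K) : rn r j = r j.
Proof. by rewrite /rn valK. Qed.

Let aS r i : a r i.+1 = (a r i + rn r i)%N.
Proof. by rewrite /a big_ord_recr. Qed.

Let time_inc : increasing_seq time.
Proof. by move=> i j; rewrite /time ler_pM2r ?invr_gt0 ?ltr0n// ler_nat. Qed.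

Let mB r : measurable (B r).
Proof.
rewrite (_ : B r = \bigcap_(j < K) (fun v => (\sum_(a r j <= i < a r j.+1) quantile g (xi (iter i th v)))%N) @^-1` [set c j]); last first.
  by apply/seteqP; split=> v h j; exact: h.
apply: bigcap_measurableType => j _; apply: preimageT_measurable => //.
elim: (index_iota _ _) => [|i s IH].
  by under eq_fun do rewrite big_nil; exact: measurable_cst.
under eq_fun do rewrite big_cons.
by apply: measurable_fun_addn => //; exact: mz2.
Qed.

Let V_law r : Q (V r) = (\prod_(j < K) (poisson_pmf (M%:R^-1) (r j) *
    conv_power (sizes g) (r j) (c j)))%:E.
Proof.
rewrite prod_law//; last exact: mthr.
have timeS i : time i.+1 - time i = M%:R^-1.
  by rewrite /time -natr1 mulrDl mul1r addrAC subrr add0r.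
rewrite [X in (X * _)%E](@Tlaw time (rn r) K)//; last by rewrite /time mul0r.
rewrite [X in (_ * X)%E](@block_sums_law _ _ _ P _ th (sizes g)
  (iid_shift_comp mq xi_iid) (quantile_law g_ge0 g_sum1 mxi xi_law) (a r) c K); last 2 first.
- by rewrite /a big_ord0.
- by move=> j; rewrite aS leq_addr.
rewrite -EFinM -big_split/=; congr EFin; apply: eq_bigr => j _.
by rewrite timeS aS addKn rnE.
Qed.

Let disjV : trivIset setT V.
Proof.
move=> r r' _ _ [w [[Sr _] [Sr' _]]]; apply/ffunP => j; apply: val_inj.
have ar i : (i <= K)%N -> a r i = a r' i.
  case: i => [_|i iK]; first by rewrite /a !big_ord0.
  have h k : (k < a r i.+1)%N = (k < a r' i.+1)%N by rewrite -(Sr i iK) (Sr' i iK).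
  apply/eqP; rewrite eqn_leq; apply/andP; split; rewrite leqNgt; apply/negP.
    by rewrite h ltnn.
  by rewrite -h ltnn.
have := ar j.+1 (ltn_ord j); rewrite !aS (ar j (ltnW (ltn_ord j))) !rnE.
by move/addnI.
Qed.

(* Almost surely the counts of the cells determine the numbers [r j] of points in
   them, up to a finite choice: as all marks are positive, [r j] is at most
   [c j]. This turns [E] into a finite disjoint union. *)
Let ET w : good_pts (Tf^~ w) -> (forall i, (0 < zf i w)%N) ->
  E w <-> (\bigcup_r V r) w.
Proof.
move=> gw z0; have [T0 fT] := gw.
have Ti : increasing_seq (Tf^~ w) by exact: arrival_increasing.
have nneg k : (Tf k w < 0) = false by apply/negbTE; rewrite -leNgt T0.
split; last first.
  move=> [r _ [Sr Br]] j jK; rewrite [LHS](marked_measureE (zf^~ w) _ gw).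
  rewrite (@point_sum_cell R (Tf^~ w) (zf^~ w) M j (a r j) (a r j.+1)).
  - by rewrite (Br j jK).
  - case: j jK => [_|j jK] k; last exact: (Sr j (ltnW jK)).
    by rewrite mul0r nneg /a big_ord0.
  - by move=> k; exact: (Sr j jK).
move=> Ew.
have /choice[nn hnn] i : exists n, forall k, (Tf k w < time i) = (k < n)%N.
  exact: (locally_finite_thresholds (T := Tf^~ w)).
have nn0 : nn 0%N = 0%N.
  have := hnn 0%N 0%N; rewrite /time mul0r nneg.
  by case: (nn 0%N).
have nnS i : (nn i <= nn i.+1)%N.
  rewrite leqNgt; apply/negP => h; have := hnn i (nn i.+1); rewrite h => h'.
  have : Tf (nn i.+1) w < time i.+1 by rewrite (lt_le_trans h')// time_inc.
  by rewrite hnn ltnn.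
have cE j : (j < K)%N -> (\sum_(nn j <= i < nn j.+1) zf i w)%N = c j.
  move=> jK; have := Ew j jK; rewrite [X in X = _ -> _](marked_measureE (zf^~ w) _ gw).
  rewrite (@point_sum_cell R (Tf^~ w) (zf^~ w) M j (nn j) (nn j.+1))//; try exact: hnn.
  by move=> [] /eqP; rewrite eqr_nat => /eqP.
have rlt (j : 'I_K) : (nn j.+1 - nn j < D)%N.
  rewrite ltnS; apply: (@leq_trans (c j)); last exact: (leq_bigmax j).
  rewrite -cE// -[X in (X <= _)%N]muln1 -sum_nat_const_nat.
  by apply: leq_sum => i _.
pose r : {ffun 'I_K -> 'I_D} := [ffun j => Ordinal (rlt j)].
have ra i : (i <= K)%N -> a r i = nn i.
  elim: i => [_|i IH iK]; first by rewrite /a big_ord0 nn0.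
  rewrite aS IH ?(ltnW iK)//.
  have -> : rn r i = (nn i.+1 - nn i)%N by rewrite (rnE r (Ordinal iK)) ffunE.
  by rewrite subnKC.
exists r => //; split.
  move=> i iK k.
  by rewrite [LHS](hnn i.+1 k) -(ra i.+1 iK).
move=> j jK; rewrite (ra j (ltnW jK)) (ra j.+1 jK); exact: cE.
Qed.

Let mV r : measurable (V r).
Proof.
rewrite (_ : V r = S r `*` B r)//; apply: measurableX; last exact: mB.
exact: mthr.
Qed.

Let mE : measurable E.
Proof.
rewrite (_ : E = \bigcap_(j < K) (fun w => N w (@cell R M j)) @^-1` [set (c j)%:R%:E]); last first.
  by apply/seteqP; split=> w h j; exact: h.
apply: bigcap_measurableType => j _; apply: preimageT_measurable => //.
by apply: point_process_compound; exact: measurable_cell.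
Qed.

(** The union over the numbers of points of the events [V r], whose probabilities
    are products of Poisson masses and convolution powers; exchanging the sum
    over [r] with the product over the cells gives one compound mass per cell. *)
Lemma cells_law : Q E = (\prod_(j < K) compound_pmf (M%:R^-1) (sizes g) (c j))%:E.
Proof.
have mU : measurable (\bigcup_(r in setT) V r).
  by apply: fin_bigcup_measurable => // r _; exact: mV.
have -> : Q E = Q (\bigcup_(r in setT) V r).
  apply: measure_eq_ae => //.
  have zae : {ae Q, forall w, forall i, (0 < zf i w)%N}.
    have [C [mC C0 hC]] := zpos_ae; exists [set w | C w.2]; split.
    - rewrite (_ : [set w | _] = snd @^-1` C)//.
      by apply: preimageT_measurable => //; exact: measurable_snd.
    - by rewrite snd_law.
    - by move=> w h; exact: (hC w.2).
  by apply: filterS2 good_ae zae => w gw zw; exact: ET.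
rewrite measure_fin_bigcup//.
rewrite (@fsbigE _ _ _ _ _ (enum {: {ffun 'I_K -> 'I_D}}))//=; last 2 first.
- exact: enum_uniq.
- by move=> r _; rewrite mem_enum.
rewrite big_enum_cond/=.
transitivity (\sum_(r : {ffun 'I_K -> 'I_D}) (\prod_(j < K) (poisson_pmf (M%:R^-1) (r j) *
    conv_power (sizes g) (r j) (c j)))%:E)%E.
  by apply: eq_big => [r|r _]; [rewrite in_setT|exact: V_law].
rewrite sumEFin -(bigA_distr_bigA (fun (j : 'I_K) (x : 'I_D) =>
  poisson_pmf (M%:R^-1) x * conv_power (sizes g) x (c j))).
congr EFin; apply: eq_bigr => j _; rewrite /compound_pmf.
have cD : ((c j).+1 <= D)%N by rewrite ltnS; exact: (leq_bigmax j).
rewrite (big_ord_widen D (fun x => poisson_pmf (M%:R^-1) x * conv_power (sizes g) x (c j)) cD).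
rewrite [RHS]big_mkcond/=; apply: eq_bigr => x _; case: ltnP => // cx.
by rewrite conv_power_eq0 ?mulr0.
exact: finite_finset.
Qed.

End cells.

End compound.

Lemma compound_poisson_exists (R : realType) (g : nat -> R) :
  (forall k, (1 <= k)%N -> 0 <= g k) -> (\sum_(1 <= k <oo) (g k)%:E)%E = 1%E ->
  exists (d : measure_display) (O : measurableType d) (P : probability O R)
    (N : O -> counting_measure R),
    [/\ compound_poisson P g N, point_process N &
      forall (M K : nat) (c : nat -> nat), (0 < M)%N ->
        P [set w | forall j, (j < K)%N -> N w (@cell R M j) = (c j)%:R%:E] =
        (\prod_(j < K) compound_pmf (M%:R^-1) (sizes g) (c j))%:E].
Proof.
move=> g_ge0 g_sum1; have [d [S [P [xi [th [iid law]]]]]] := exists_uniform_sequence R.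
exists (d, d).-prod%mdisp, (S * S)%type, [the probability _ _ of (P \x P)%E].
exists (fun w => marked_measure (fun k => arrival xi th k w.1)
   (fun k => quantile g (xi (iter k th w.2)))); split.
- exact: compound_poisson_marked iid law g_ge0 g_sum1.
- exact: (point_process_compound iid g_ge0).
- by move=> M K c M0; exact: cells_law.
Qed.

(** * Exceedances as point sums, and counting clumps *)

Section exceedance_points.
Variable R : realType.

Lemma exceedances_point_sum n (x : nat -> R) (v : R) A :
  exceedances n x v A = point_sum (fun k => k%:R / n%:R) (fun k => (v < x k)%R : nat) A.
Proof.
rewrite /exceedances counting_dirac; apply: eq_eseriesr => k _.
rewrite diracE -EFinM indicE -natrM; congr (_%:R%:E).
have [vx|vx] := boolP (v < x k); last first.
  by rewrite mul0n memNset// => -[_]; apply/negP.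
rewrite mul1n; congr nat_of_bool; apply/idP/idP => /set_mem.
  by move=> [h _]; exact/mem_set.
by move=> h; apply/mem_set.
Qed.

(** The least [k] with [k / (n + 1)] at or beyond the left end [j / M] of the
    cell, that is, a quotient rounded up. *)
Definition cell_start (n M j : nat) : nat := ((j * n.+1 + M.-1) %/ M)%N.

Lemma cell_startP n M j k : (0 < M)%N ->
  ((k%:R / n.+1%:R : R) < j%:R / M%:R) = (k < cell_start n M j)%N.
Proof.
move=> M0; rewrite ltr_pdivrMr ?ltr0n// mulrAC ltr_pdivlMr ?ltr0n// -!natrM ltr_nat.
rewrite /cell_start leq_divRL//; apply/idP/idP; nia.
Qed.

Lemma cell_start0 n M : (0 < M)%N -> cell_start n M 0 = 0%N.
Proof. by case: M => // M _; rewrite /cell_start mul0n add0n divn_small. Qed.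

Lemma cell_start_le n M j : (cell_start n M j <= cell_start n M j.+1)%N.
Proof. by apply: leq_div2r; rewrite leq_add2r leq_mul2r leqnSn orbT. Qed.

Lemma exceedances_cell n (x : nat -> R) (v : R) M j : (0 < M)%N ->
  exceedances n.+1 x v (cell M j) =
  (\sum_(cell_start n M j <= k < cell_start n M j.+1) (v < x k)%R)%N%:R%:E.
Proof.
move=> M0; rewrite exceedances_point_sum; apply: point_sum_cell => k; exact: cell_startP.
Qed.

Lemma cvg_cell_length M j : (0 < M)%N ->
  (fun n => (cell_start n M j.+1 - cell_start n M j)%N%:R / n.+2%:R : R) @ \oo --> (M%:R^-1 : R).
Proof.
move=> M0.
have bound n : `|(cell_start n M j.+1 - cell_start n M j)%N%:R / n.+2%:R - M%:R^-1 : R| <= 2 / n.+2%:R.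
  have Mp : 0 < M%:R :> R by rewrite ltr0n.
  have np : 0 < n.+2%:R :> R by rewrite ltr0n.
  set L := (_ - _)%N.
  have h1 : (L * M <= n.+1 + M)%N.
    rewrite /L mulnBl.
    have := leq_trunc_div (j.+1 * n.+1 + M.-1) M.
    have := ltn_ceil (j * n.+1 + M.-1) M0; rewrite -/(cell_start n M j) -/(cell_start n M j.+1).
    by rewrite mulSn; lia.
  have h2 : (n.+1 <= L * M + M)%N.
    rewrite /L mulnBl.
    have := leq_trunc_div (j * n.+1 + M.-1) M.
    have := ltn_ceil (j.+1 * n.+1 + M.-1) M0; rewrite -/(cell_start n M j) -/(cell_start n M j.+1).
    by rewrite mulSn; lia.
  have -> : L%:R / n.+2%:R - M%:R^-1 = (L%:R * M%:R - n.+2%:R) / (M%:R * n.+2%:R) :> R.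
    by field; rewrite !gt_eqF.
  rewrite normrM normfV (gtr0_norm (mulr_gt0 Mp np)) ler_pdivrMr ?mulr_gt0//.
  have -> : 2 / n.+2%:R * (M%:R * n.+2%:R) = 2 * M%:R :> R by field; rewrite gt_eqF.
  rewrite ler_norml; apply/andP; split.
    by rewrite lerNl opprB lerBlDr -!natrM -natrD ler_nat; lia.
  by rewrite lerBlDr -!natrM -natrD ler_nat; lia.
have c0 : (fun n => 2 / n.+2%:R : R) @ \oo --> (0 : R).
  rewrite -(mulr0 2); apply: cvgM; first exact: cvg_cst.
  have := @cvg_harmonic R; by rewrite -cvg_shiftS.
apply/cvgrPdistC_le => e e0; near=> n; apply: le_trans (bound n) _.
by near: n; exact: cvgr_le c0 _ e0.
Unshelve. all: by end_near. Qed.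

End exceedance_points.

Section clumps.

Lemma sum_interval_indicator (A i B Z : nat) : (A + Z <= i)%N -> (i < B)%N ->
  (\sum_(A <= k < B) ((k <= i) && (i < k + Z)))%N = Z.
Proof.
move=> h1 h2; have hA : (A <= i.+1 - Z)%N by lia.
have hZ : (i.+1 - Z <= i.+1)%N by exact: leq_subr.
rewrite (big_cat_nat hA)/=; last by lia.
rewrite (big_cat_nat hZ)//=.
have const b m n : (forall k, (m <= k < n)%N -> (k <= i < k + Z)%N = b) ->
    (\sum_(m <= k < n) (k <= i < k + Z) = (n - m) * b)%N.
  by move=> h; rewrite -sum_nat_const_nat; apply: eq_big_nat => k /h ->.
rewrite (const false A (i.+1 - Z)%N); last by lia.
rewrite (const true (i.+1 - Z)%N i.+1); last by lia.
rewrite (const false i.+1 B); last by lia.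
by rewrite !muln0 muln1 add0n addn0; lia.
Qed.

(** A seed [i] (with [I i]) of size [Z i] occupies the [Z i] indices that end at
    [i]. In a block where sizes are at most [K], seeds are at distance more than
    [K], and no seed is within [K] of the left end, the occupied sets are disjoint
    and contained in the block, so the occupied indices are counted by the sum of
    the sizes. *)
Lemma clump_count (I : nat -> bool) (Z : nat -> nat) (e : nat -> bool) (A B K : nat) :
  (A <= B)%N ->
  (forall i, (i < B)%N -> I i -> (Z i <= K)%N) ->
  (forall i h, (i + h.+1 < B)%N -> (h < K)%N -> I i -> ~~ I (i + h.+1)%N) ->
  (forall h, (h < K)%N -> ~~ I (A + h)%N) ->
  (forall k, (A <= k < B)%N -> e k <-> exists i, [/\ (A <= i < B)%N, I i & (k <= i < k + Z i)%N]) ->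
  (\sum_(A <= k < B) e k = \sum_(A <= i < B) (I i * Z i))%N.
Proof.
move=> AB ZK sep gap eP.
transitivity (\sum_(A <= k < B) \sum_(A <= i < B) I i * ((k <= i) && (i < k + Z i)))%N.
  apply: eq_big_nat => k kAB.
  have [ek|nek] := boolP (e k); last first.
    rewrite big_nat_cond big1// => i /andP[iAB _]; apply/eqP; rewrite muln_eq0.
    case Ii : (I i) => //=; rewrite eqb0; apply/negP => ki.
    by move: nek; apply/negP; rewrite negbK; apply/(eP _ kAB); exists i.
  have [i [iAB Ii ki]] := (eP _ kAB).1 ek.
  rewrite (bigD1_seq i) ?iota_uniq ?mem_index_iota//= Ii ki big_nat_cond big1// => i'.
  move=> /andP[iAB' ii']; case Ii' : (I i') => //=.
  rewrite mul1n; apply/eqP; rewrite eqb0; apply/negP => ki'.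
  have Zi := ZK i (proj2 (andP iAB)) Ii; have Zi' := ZK i' (proj2 (andP iAB')) Ii'.
  have [ltii|ltii|eqii] := ltngtP i i'; last by rewrite eqii eqxx in ii'.
    have := sep i (i' - i).-1; rewrite (_ : i + _.+1 = i')%N; last by lia.
    by rewrite Ii' => /(_ _ _ Ii)/=; lia.
  have := sep i' (i - i').-1; rewrite (_ : i' + _.+1 = i)%N; last by lia.
  by rewrite Ii => /(_ _ _ Ii')/=; lia.
rewrite exchange_big_nat/=; apply: eq_big_nat => i iAB; rewrite -big_distrr/=.
case Ii : (I i) => //; rewrite !mul1n sum_interval_indicator//; last by case/andP: iAB.
have Zi := ZK i (proj2 (andP iAB)) Ii.
rewrite leqNgt; apply/negP => h.
have /(_ _) := gap (i - A)%N; rewrite subnKC; last by case/andP: iAB.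
by rewrite Ii => /(_ _)/=; lia.
Qed.

End clumps.

(** * Seeds, marks and the rare bad configurations *)

Lemma union_bound d (O : measurableType d) (R : realType) (P : probability O R)
    (F : nat -> set O) (n : nat) (b : R) :
  (forall i, measurable (F i)) -> (forall i, (i < n)%N -> (P (F i) <= b%:E)%E) ->
  (P (\bigcup_(i in `I_n) F i) <= (n%:R * b)%:E)%E.
Proof.
move=> mF Fb; rewrite bigcup_mkord.
apply: le_trans (Boole_inequality P (fun i _ => mF i)) _.
apply: (@le_trans _ _ (\sum_(i < n) b%:E)%E).
  by apply: lee_sum => i _; exact: Fb.
by rewrite sumEFin lee_fin sumr_const card_ord mulr_natl.
Qed.

(** Two consecutive uniform variables serve one index: the first is the seed
    variable and the second one produces the size. *)
Definition seed_shift (O : Type) (th : O -> O) (w : O) : O := th (th w).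

Definition seed_size (R : realType) (O : Type) (xi : O -> measurableTypeR R) (th : O -> O)
    (g : nat -> R) (w : O) : nat := quantile g (xi (th w)).

(** The size of the clump at a seed of level [p], and 0 at other indices. *)
Definition mark (R : realType) (O : Type) (xi : O -> measurableTypeR R) (th : O -> O)
    (g : nat -> R) (p : R) (w : O) : nat := ((xi w < p)%R * seed_size xi th g w)%N.

Section seeds.
Context d (O : measurableType d) (R : realType) (P : probability O R).
Variables (xi : O -> measurableTypeR R) (th : O -> O) (g : nat -> R).
Hypothesis xi_iid : iid_shift P xi th.
Hypothesis xi_law : forall x, P [set w | xi w < x] = (clamp x)%:E.
Hypothesis g_ge0 : forall k, (1 <= k)%N -> 0 <= g k.
Hypothesis g_sum1 : (\sum_(1 <= k <oo) (g k)%:E)%E = 1%E.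

Local Notation s := (seed_shift th).
Local Notation size := (seed_size xi th g).
Local Notation low q := [set w | (xi w < q)%R].

Let mxi : measurable_fun setT xi. Proof. by case: xi_iid. Qed.
Let mth : measurable_fun setT th. Proof. by case: xi_iid. Qed.

Lemma measurable_seed_shift : measurable_fun setT s.
Proof. exact: measurableT_comp mth mth. Qed.

Let mqx : measurable_fun setT (quantile g \o xi).
Proof. exact: measurableT_comp (measurable_quantile g_ge0) mxi. Qed.

Lemma measurable_seed_size : measurable_fun setT size.
Proof. exact: measurableT_comp mqx mth. Qed.

Let ray p : measurable (low p).
Proof.
rewrite -[X in measurable X]setTI; exact: (measurable_fun_ltr mxi (measurable_cst p)).
Qed.

Lemma seed_law C A B : measurable C -> measurable A -> measurable B ->
  P (xi @^-1` C `&` (size @^-1` A `&` s @^-1` B)) =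
  (P (xi @^-1` C) * (P (size @^-1` A) * P B))%E.
Proof.
move=> mC mA mB; case: (xi_iid) => _ _ H; case: (iid_shift_comp (measurable_quantile g_ge0) xi_iid) => _ _ H'.
have mB' : measurable (th @^-1` B) by exact: preimageT_measurable.
have mA' : measurable ((quantile g \o xi) @^-1` A) by exact: preimageT_measurable.
have -> : size @^-1` A `&` s @^-1` B =
  th @^-1` ((quantile g \o xi) @^-1` A `&` th @^-1` B) by [].
rewrite H//; last exact: measurableI.
congr (_ * _)%E; rewrite H'//; congr (_ * _)%E.
by rewrite [RHS](iid_shift_measure 1 xi_iid mA').
Qed.

Lemma seed_iid : iid_shift P xi s.
Proof.
split=> //; first exact: measurable_seed_shift.
move=> A B mA mB; have := seed_law mA measurableT mB.
by rewrite preimage_setT setTI [P setT]probability_setT mul1e.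
Qed.

Lemma measurable_mark p : measurable_fun setT (mark xi th g p).
Proof.
apply: measurable_fun_nat => k.
rewrite (_ : _ @^-1` _ = (low p `&` size @^-1` [set k]) `|`
   (~` (low p) `&` (if k is 0 then setT else set0))); last first.
  apply/seteqP; split=> w; rewrite /mark /=.
    by case: (xi w < p) => /=; rewrite (mul1n, mul0n) => h; [left|right; split=> //; rewrite -h].
  by case: (xi w < p) => /= -[[]|[]]//; case: k => // n; rewrite ?mul1n.
apply: measurableU; apply: measurableI => //.
- by apply: preimageT_measurable => //; exact: measurable_seed_size.
- exact: measurableC.
- by case: k.
Qed.

(* Without a seed the mark is 0, hence the indicator in the second term. *)
Let mark_rect p A B : measurable A -> measurable B ->
  P (mark xi th g p @^-1` A `&` s @^-1` B) =
  ((P (low p) * P (size @^-1` A) +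
    P (~` (low p)) * (\1_A 0%N)%:E) * P B)%E.
Proof.
move=> mA mB.
pose A0 : set nat := if 0%N \in A then setT else set0.
have -> : mark xi th g p @^-1` A `&` s @^-1` B =
    (xi @^-1` [set x | x < p] `&` (size @^-1` A `&` s @^-1` B)) `|`
    (xi @^-1` (~` [set x | x < p]) `&` (size @^-1` A0 `&` s @^-1` B)).
  apply/seteqP; split=> w; rewrite /mark /A0 /=.
    case: (xi w < p) => /=; rewrite (mul1n, mul0n) => -[h1 h2]; [left|right]; split=> //.
    by rewrite mem_set.
  case: (xi w < p) => /= -[[h1 [h2 h3]]|[h1 [h2 h3]]] //; rewrite ?mul1n ?mul0n; split=> //.
  by move: h2; case: ifP => // /set_mem.
have mray : measurable ([set x | x < p] : set (measurableTypeR R)).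
  by rewrite -[X in measurable X]set_itvE.
rewrite measureU; last 3 first.
- apply: measurableI; first exact: preimageT_measurable.
  apply: measurableI; first by apply: preimageT_measurable => //; exact: measurable_seed_size.
  by apply: preimageT_measurable => //; exact: measurable_seed_shift.
- apply: measurableI; first by apply: preimageT_measurable => //; exact: measurableC.
  apply: measurableI; first by apply: preimageT_measurable => //; exact: measurable_seed_size.
  by apply: preimageT_measurable => //; exact: measurable_seed_shift.
- by apply/seteqP; split=> w //= [[h _] [h' _]].
rewrite [X in X + _](seed_law mray mA mB).
rewrite [X in _ + X](seed_law (measurableC mray) (I : measurable A0) mB).
rewrite ge0_muleDl ?mule_ge0// ?lee_fin//; congr (_ + _)%E; rewrite muleA//.
congr (_ * _ * _)%E; rewrite /A0 indicE; case: ifP => _ /=.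
  by rewrite preimage_setT [LHS]probability_setT.
by rewrite preimage_set0 measure0.
Qed.

Lemma mark_iid p : iid_shift P (mark xi th g p) s.
Proof.
split; [exact: measurable_mark|exact: measurable_seed_shift|].
move=> A B mA mB; have := mark_rect p mA measurableT.
by rewrite preimage_setT setIT [P setT]probability_setT mule1 => ->; exact: mark_rect.
Qed.

Lemma size_law k : P (size @^-1` [set k]) = (sizes g k)%:E.
Proof.
have mk : measurable ((quantile g \o xi) @^-1` [set k]) by exact: preimageT_measurable.
rewrite -(quantile_law g_ge0 g_sum1 mxi xi_law k).
exact: (iid_shift_measure 1 xi_iid mk).
Qed.

Lemma seed_prob (p : R) : 0 <= p <= 1 -> P (low p) = p%:E.
Proof. by move=> /andP[p0 p1]; rewrite xi_law /clamp max_l ?min_l. Qed.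

Lemma mark_law (p : R) : 0 <= p <= 1 ->
  forall k, P (mark xi th g p @^-1` [set k]) = (thinned p (sizes g) k)%:E.
Proof.
move=> p01 k; have := mark_rect p (I : measurable ([set k] : set nat)) measurableT.
rewrite preimage_setT setIT [P setT]probability_setT mule1 => ->.
rewrite [P (~` _)]probability_setC//.
rewrite [X in (X * _ + _)%E](seed_prob p01) [X in (_ + (_ - X) * _)%E](seed_prob p01).
rewrite [X in (_ * X + _)%E]size_law -EFinB -!EFinM -EFinD /thinned.
congr (_ + _ * _)%:E; rewrite indicE; congr (nat_of_bool _)%:R.
by apply/idP/eqP => [/set_mem//|->]; exact/mem_set.
Qed.

Let shifted i B : measurable B -> P (iter i s @^-1` B) = P B.
Proof. exact: (iid_shift_measure i seed_iid). Qed.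

Let mshift i B : measurable B -> measurable (iter i s @^-1` B).
Proof.
by move=> mB; apply: preimageT_measurable => //; apply: measurable_iter; exact: measurable_seed_shift.
Qed.

Let mgt K : measurable [set w | (K < size w)%N].
Proof.
rewrite (_ : [set w | _] = size @^-1` [set k | (K < k)%N])//.
by apply: preimageT_measurable => //; exact: measurable_seed_size.
Qed.

Definition size_tail (K : nat) : R := fine (P [set w | (K < size w)%N]).

Lemma size_tail_ge0 K : 0 <= size_tail K.
Proof. exact: fine_ge0. Qed.

Lemma cvg_size_tail : size_tail @ \oo --> (0 : R).
Proof.
have := @nonincreasing_cvg_mu _ _ _ P (fun K => [set w | (K < size w)%N]).
rewrite (_ : \bigcap_n _ = set0) ?measure0; last first.
  by apply/seteqP; split=> w // /(_ (size w) I) /=; rewrite ltnn.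
move=> h; apply: fine_cvg; apply: h => //.
- by rewrite -ge0_fin_numE// fin_num_measure.
- move=> m n mn; apply/subsetPset => w /=; exact: leq_ltn_trans.
Qed.

Section bad.
Variables (p : R) (K W J : nat) (a : nat -> nat).
Hypothesis p01 : 0 <= p <= 1.

(** The configurations in the window [0, W[ for which clumps are not separated:
    a seed with a large clump, two seeds within distance [K], a seed within [K] of
    the left end of a block, and a seed beyond the window that reaches into it.
    A seed at distance [h + 1] from the window only reaches it if its variable
    is below [2 ^- (h + 1)], by the definition of the process; for [h < K] only
    the bound [p] is used. *)
Definition oversized := \bigcup_(i in `I_W)
  (iter i s @^-1` [set w | xi w < p /\ (K < size w)%N]).

Definition crowded := \bigcup_(i in `I_W) (iter i s @^-1`
  \bigcup_(h in `I_K) [set w | xi w < p /\ xi (iter h.+1 s w) < p]).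

Definition crossing := \bigcup_(j in `I_J) (iter (a j) s @^-1`
  \bigcup_(h in `I_K) (iter h s @^-1` low p)).

Definition incoming := iter W s @^-1`
  (\bigcup_(h in `I_K) (iter h s @^-1` low p) `|`
   \bigcup_h (iter (K + h) s @^-1` low (2^-1 ^+ (K + h).+1)%R)).

Definition bad := oversized `|` crowded `|` crossing `|` incoming.

Let m2 h : measurable [set w | xi w < p /\ xi (iter h.+1 s w) < p].
Proof.
rewrite (_ : [set w | _] = low p `&` iter h.+1 s @^-1` low p)//.
by apply: measurableI => //; exact: mshift.
Qed.

Let mo : measurable [set w | xi w < p /\ (K < size w)%N].
Proof. exact: (measurableI _ _ (ray p) (mgt K)). Qed.

Lemma measurable_bad : measurable bad.
Proof.
rewrite /bad; apply: measurableU; first (apply: measurableU; first apply: measurableU).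
- by apply: bigcup_measurable => i _; exact: mshift.
- by apply: bigcup_measurable => i _; apply: mshift; exact: bigcup_measurable.
- apply: bigcup_measurable => i _; apply: mshift; apply: bigcup_measurable => h _; exact: mshift.
- apply: mshift; apply: measurableU; apply: bigcup_measurable => h _; exact: mshift.
Qed.

Let crossing1 : (P (\bigcup_(h in `I_K) (iter h s @^-1` low p)) <= (K%:R * p)%:E)%E.
Proof.
apply: union_bound => [h|h _]; first exact: mshift.
by rewrite shifted// seed_prob.
Qed.

(** A union bound for each of the four kinds. With [p] of order 1/W and [K] fixed,
    only the terms in [size_tail K] and [2 ^- K] survive; they vanish as [K] grows,
    whatever the mean of the sizes. *)
Lemma bad_bound : (P bad <= (W%:R * p * size_tail K + W%:R * p * (K%:R * p)
   + J%:R * (K%:R * p) + (K%:R * p + 2^-1 ^+ K))%:E)%E.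
Proof.
have halfp n : 0 <= (2^-1 : R) ^+ n <= 1.
  by rewrite exprn_ge0//= exprn_ile1// invf_le1// ler1n.
have mover : measurable oversized.
  by apply: bigcup_measurable => i _; exact: mshift.
have mcrow : measurable crowded.
  by apply: bigcup_measurable => i _; apply: mshift; exact: bigcup_measurable.
have mcros : measurable crossing.
  apply: bigcup_measurable => i _; apply: mshift; apply: bigcup_measurable => h _; exact: mshift.
have m4 : measurable (\bigcup_(h in `I_K) (iter h s @^-1` low p)).
  by apply: bigcup_measurable => h _; exact: mshift.
have m5 : measurable (\bigcup_h (iter (K + h) s @^-1` low (2^-1 ^+ (K + h).+1)%R)).
  by apply: bigcup_measurable => h _; exact: mshift.
have minc : measurable incoming by apply: mshift; exact: measurableU.
rewrite !EFinD.
apply: le_trans (measureU2 _ (measurableU _ _ (measurableU _ _ mover mcrow) mcros) minc) _.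
apply: leeD.
  apply: le_trans (measureU2 _ (measurableU _ _ mover mcrow) mcros) _; apply: leeD.
    apply: le_trans (measureU2 _ mover mcrow) _; apply: leeD.
      rewrite -mulrA; apply: union_bound => [i|i _]; first exact: mshift.
      rewrite shifted// EFinM /size_tail fineK ?fin_num_measure//.
      rewrite -(seed_prob p01).
      have mray : measurable ([set x | x < p] : set (measurableTypeR R)).
        by rewrite -[X in measurable X]set_itvE.
      have := @seed_law [set x | x < p] [set k | (K < k)%N] setT mray _ measurableT.
      by rewrite preimage_setT setIT [P setT]probability_setT mule1 => <-.
    rewrite -mulrA; apply: union_bound => [i|i _]; first by apply: mshift; exact: bigcup_measurable.
    rewrite shifted; last exact: bigcup_measurable.
    rewrite mulrCA; apply: union_bound => // h _.
    have mh : measurable (iter h s @^-1` low p) by exact: mshift.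
    have mray : measurable ([set x | x < p] : set (measurableTypeR R)).
      by rewrite -[X in measurable X]set_itvE.
    case: seed_iid => _ _ /(_ _ _ mray mh).
    rewrite [P (iter h s @^-1` _)]shifted// [X in (_ * X)%E]seed_prob// [X in (X * _)%E]seed_prob//.
    rewrite -EFinM => <-; rewrite le_eqVlt; apply/orP; left; apply/eqP; congr (P _).
    by apply/seteqP; split=> w /=; rewrite -iterSr.
  apply: union_bound => [j|j _]; first exact: mshift.
  by rewrite shifted.
rewrite [X in (X <= _)%E]shifted; last exact: measurableU.
apply: le_trans (measureU2 _ m4 m5) _; apply: leeD => //.
pose F h := iter (K + h) s @^-1` low (2^-1 ^+ (K + h).+1)%R.
have mF h : measurable (F h) by exact: mshift.
have /le_trans := @measure_sigma_subadditive _ _ _ P (\bigcup_h F h) F mF m5 (@subset_refl _ _).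
apply.
apply: le_trans (epsilon_trick0 xpredT (proj1 (andP (halfp K)))).
apply: lee_nneseries => [h _|h _]; first by [].
rewrite [X in (X <= _)%E]shifted// [X in (X <= _)%E]seed_prob// lee_fin.
by rewrite -addnS exprD natrX -exprVn.
Qed.

End bad.

End seeds.

(** * The stationary clump process *)

(** The contribution to index [k] of the seed variable at [k + h]: it counts if
    the clump is long enough to reach back by [h], and if the variable is below
    [2 ^- h]. Without the second condition, sizes of infinite mean would let
    infinitely many seeds reach [k] and the supremum would be almost surely 0. *)
Definition clump_term (R : realType) (O : Type) (xi : O -> measurableTypeR R) (th : O -> O)
    (g : nat -> R) (h : nat) (w : O) : R :=
  if (h < seed_size xi th g w)%N && (xi w < 2^-1 ^+ h) then - Num.max 0 (xi w) else - 1.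

Definition clump_process (R : realType) (O : Type) (xi : O -> measurableTypeR R) (th : O -> O)
    (g : nat -> R) (k : nat) (w : O) : R :=
  sup (range (fun h => clump_term xi th g h (iter (k + h) (seed_shift th) w))).

Section process.
Context d (O : measurableType d) (R : realType) (P : probability O R).
Variables (xi : O -> measurableTypeR R) (th : O -> O) (g : nat -> R).
Hypothesis xi_iid : iid_shift P xi th.
Hypothesis xi_law : forall x, P [set w | xi w < x] = (clamp x)%:E.
Hypothesis g_ge0 : forall k, (1 <= k)%N -> 0 <= g k.
Hypothesis g_sum1 : (\sum_(1 <= k <oo) (g k)%:E)%E = 1%E.

Local Notation s := (seed_shift th).
Local Notation size := (seed_size xi th g).
Local Notation X := (clump_process xi th g).

Let mxi : measurable_fun setT xi. Proof. by case: xi_iid. Qed.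

Lemma clump_term_le0 h w : clump_term xi th g h w <= 0.
Proof.
by rewrite /clump_term; case: ifP => _; rewrite oppr_le0// le_max lexx.
Qed.

Lemma clump_has_ubound k w :
  has_ubound (range (fun h => clump_term xi th g h (iter (k + h) s w))).
Proof. by exists 0 => _ [h _ <-]; exact: clump_term_le0. Qed.

Lemma clump_process_gt p k w : 0 < p < 1 ->
  (- p < X k w) <-> exists h, [/\ (h < size (iter (k + h) s w))%N,
    xi (iter (k + h) s w) < 2^-1 ^+ h & xi (iter (k + h) s w) < p].
Proof.
move=> /andP[p0 p1]; split.
  move=> /sup_gt[]; first by exists (clump_term xi th g 0 (iter (k + 0) s w)), 0%N.
  move=> _ [h _ <-]; rewrite /clump_term; case: ifP => [/andP[h1 h2]|_]; last first.
    by rewrite ltrN2 => /(lt_trans p1); rewrite ltxx.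
  by rewrite ltrN2 gt_max => /andP[_ h3]; exists h.
move=> [h [h1 h2 h3]].
apply: (@lt_le_trans _ _ (clump_term xi th g h (iter (k + h) s w))).
  by rewrite /clump_term h1 h2/= ltrN2 gt_max p0.
by apply: ub_le_sup; [exact: clump_has_ubound|exists h].
Qed.

Lemma clump_process_shift l k w : X (l + k)%N w = X k (iter l s w).
Proof.
rewrite /clump_process; congr sup; congr (_ @` _); apply/funext => h.
by rewrite -iterD -addnA addnC.
Qed.

Lemma measurable_clump_process k : measurable_fun setT (X k).
Proof.
have mterm h : measurable_fun setT (clump_term xi th g h).
  apply: measurable_fun_ifT => //.
    apply: measurable_and.
      apply: (measurable_fun_bool true); rewrite setTI.
      rewrite (_ : _ @^-1` _ = size @^-1` [set i | (h < i)%N])//.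
      by apply: preimageT_measurable => //; exact: (measurable_seed_size xi_iid).
    exact: measurable_fun_ltr.
  by apply: measurableT_comp => //; exact: measurable_maxr.
rewrite (_ : X k = fun w => sups (fun h => clump_term xi th g h (iter (k + h) s w)) 0%N).
  apply: measurable_fun_sups => [w _|h]; first exact: clump_has_ubound.
  apply: (measurableT_comp (mterm h)); apply: measurable_iter.
  exact: (measurable_seed_shift xi_iid).
apply/funext => w; rewrite /sups /sdrop /clump_process; congr sup.
by apply/seteqP; split=> _ [h _ <-]; exists h.
Qed.

(** The process is a function of the shifted sequence, and the shift preserves
    the probability. *)
Lemma clump_process_stationary l (A : set (nat -> R)) : product_sigma_algebra A ->
  P [set w | A (fun k => X (l + k)%N w)] = P [set w | A (fun k => X k w)].
Proof.
move=> mA; have mX : measurable [set w | A (fun k => X k w)].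
  by apply: measurable_path => //; exact: measurable_clump_process.
rewrite -(iid_shift_measure l (seed_iid xi_iid g_ge0) mX); congr (P _).
apply/seteqP; split=> w /=; congr A; apply/funext => k; rewrite clump_process_shift//.
Qed.

(** Exceedances of [- p] are the indices occupied by seeds of level [p]. Off the
    bad event, seeds outside a block do not reach into it: those in the following
    block lie further from the left end of that block than their size, and those
    beyond the window do not reach back. As [p <= 2 ^- K], the condition on the
    seed variable holds automatically within distance [K], so all clumps are
    complete. *)
Lemma exceedances_off_bad p K J (a : nat -> nat) w : 0 < p < 1 -> p <= 2^-1 ^+ K ->
  (forall j, (a j <= a j.+1)%N) -> ~ bad xi th g p K (a J) J a w ->
  forall j, (j < J)%N ->
  (\sum_(a j <= k < a j.+1) (- p < X k w)%R)%N =
  (\sum_(a j <= i < a j.+1) mark xi th g p (iter i s w))%N.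
Proof.
move=> p01 pK a_nd nbad j jJ.
have a_mono m n : (m <= n)%N -> (a m <= a n)%N.
  by move=> mn; apply: (homo_leq leqnn leq_trans a_nd).
have aW : (a j.+1 <= a J)%N by exact: a_mono.
have halfle m n : (m <= n)%N -> (2^-1 : R) ^+ n <= 2^-1 ^+ m.
  by move=> mn; apply: ler_wiXn2l => //; rewrite ?invr_ge0// invf_le1// ler1n.
have ZK i : (i < a J)%N -> xi (iter i s w) < p -> (size (iter i s w) <= K)%N.
  move=> iW Ii; rewrite leqNgt; apply/negP => Zi; apply: nbad.
  by left; left; left; exists i.
have gap j' h : (j' < J)%N -> (h < K)%N -> ~~ (xi (iter (a j' + h) s w) < p).
  move=> jJ' hK; apply/negP => Ii; apply: nbad; left; right.
  by exists j' => //; exists h => //=; rewrite -iterD addnC.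
apply: (@clump_count (fun i => xi (iter i s w) < p) (fun i => size (iter i s w)) _ _ _ K) => //.
- by move=> i iB; apply: ZK; exact: leq_trans iB aW.
- move=> i h ihB hK Ii; apply/negP => Ii'; apply: nbad; left; left; right.
  exists i => /=; first by apply: leq_trans aW; apply: leq_trans ihB; rewrite ltnS leq_addr.
  by exists h => //; split=> //; rewrite -iterS -iterD addnC.
- by move=> h hK; exact: gap.
move=> k /andP[Ak kB]; rewrite clump_process_gt//; split; last first.
  move=> [i [/andP[Ai iB] Ii /andP[ki iZ]]]; exists (i - k)%N; rewrite subnKC//; split=> //.
    by rewrite ltn_subLR.
  have ZiK := ZK i (leq_trans iB aW) Ii.
  apply: lt_le_trans Ii _; apply: le_trans pK _; apply: halfle.
  by rewrite leq_subLR ltnW// (leq_trans iZ)// leq_add2l.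
move=> [h [hZ Uh Up]]; exists (k + h)%N; rewrite Up leq_addr ltn_add2l hZ; split=> //.
rewrite (leq_trans Ak (leq_addr _ _))/= ltnNge; apply/negP => Bkh.
have [khW|Wkh] := ltnP (k + h)%N (a J).
  have hK : (h < K)%N by apply: leq_trans hZ _; exact: ZK.
  have jJ' : (j.+1 < J)%N.
    by rewrite ltnNge; apply/negP => /a_mono Ja; move: (leq_trans khW Ja); rewrite ltnNge Bkh.
  have hK' : (k + h - a j.+1 < K)%N by rewrite ltn_subLR// -addSn leq_add// ltnW.
  have /negP := gap j.+1 (k + h - a j.+1)%N jJ' hK'.
  by rewrite subnKC.
apply: nbad; right; pose e := (k + h - a J)%N.
have khE : (k + h = e + a J)%N by rewrite /e subnK.
rewrite khE iterD in Up Uh; rewrite /incoming /=.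
have [eK|Ke] := ltnP e K; first by left; exists e.
right; exists (e - K)%N => //=; rewrite subnKC//.
by apply: lt_le_trans Uh _; apply: halfle; rewrite /e; lia.
Qed.

End process.

(** * Convergence of the exceedance counts *)

Lemma cvg_compound_level (R : realType) (L : nat -> nat) (t : R) (g : nat -> R) c :
  0 < t -> g 0%N = 0 -> (fun n => (L n)%:R / n.+2%:R) @ \oo --> t ->
  (fun n => conv_power (thinned (level R n.+1) g) (L n) c) @ \oo --> compound_pmf t g c.
Proof.
move=> t0 g0 cL; pose L' n := L n.-1.
have cL' : (fun n => (L' n)%:R / n.+1%:R) @ \oo --> t.
  by rewrite -cvg_shiftS.
have lv01 n : 0 <= level R n < 1 by rewrite (ltW (level_gt0 _ n)) level_lt1.
have := @cvg_compound R (@level R) L' t g c t0 g0 lv01 (@cvg_level R) (cvg_mul_level cL') (cvg_exp_level cL').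
by rewrite -cvg_shiftS.
Qed.

(** The order of the limits matters: [K] is chosen first, through [A], and [n] is
    then taken large depending on [K]. *)
Lemma cvg_approx (R : realType) (f h : nat -> R) (A B : nat -> R) (p : nat -> R) (l : R) :
  (forall K, \forall n \near \oo, `|f n - h n| <= A K + B K * p n) ->
  A @ \oo --> (0 : R) -> p @ \oo --> (0 : R) -> h @ \oo --> l -> f @ \oo --> l.
Proof.
move=> fh cA cp ch; apply/cvgrPdist_le => e e0.
have e3 : 0 < e / 3 by rewrite divr_gt0.
have [K AK] : exists K, A K <= e / 3.
  by have [K _ /(_ K (leqnn K)) h'] := cvgr_le _ cA _ e3; exists K.
have cBp : (fun n => B K * p n) @ \oo --> (0 : R).
  by rewrite -(mulr0 (B K)); apply: cvgM => //; exact: cvg_cst.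
near=> n.
have h1 : `|f n - h n| <= A K + B K * p n by near: n; exact: fh.
have h2 : B K * p n <= e / 3 by near: n; exact: cvgr_le cBp _ e3.
have h3 : `|l - h n| <= e / 3 by near: n; move: (e / 3) e3; exact/cvgrPdist_le.
have := ler_distD (h n) l (f n); rewrite (distrC (h n) (f n)).
move: h1 h2 h3 AK; set x := `|f n - h n|; set y := `|l - h n|; lra.
Unshelve. all: by end_near. Qed.

Lemma fine_measure_dist d (O : measurableType d) (R : realType) (P : probability O R)
    (A B N : set O) (b : R) : measurable A -> measurable B -> measurable N ->
  (forall w, ~ N w -> A w <-> B w) -> (P N <= b%:E)%E ->
  `|fine (P A) - fine (P B)| <= b.
Proof.
move=> mA mB mN AB PN.
have half (C D : set O) : measurable C -> measurable D -> (forall w, ~ N w -> C w -> D w) ->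
    fine (P C) <= fine (P D) + b.
  move=> mC mD CD.
  have : (P C <= P D + b%:E)%E.
    apply: le_trans (leeD (lexx _) PN); apply: le_trans (measureU2 _ mD mN).
    apply: le_measure; rewrite ?inE//; first exact: measurableU.
    by move=> w Cw; have [Nw|nN] := pselect (N w); [right|left; exact: CD].
  have fC : P C \is a fin_num by exact: fin_num_measure.
  have fD : P D \is a fin_num by exact: fin_num_measure.
  by rewrite -(fineK fC) -(fineK fD) -EFinD lee_fin.
rewrite ler_distl; apply/andP; split.
  by rewrite lerBlDr; apply: half => // w nw /AB; apply.
by apply: half => // w nw /AB; apply.
Qed.

Section convergence.
Context d (O : measurableType d) (R : realType) (P : probability O R).
Variables (xi : O -> measurableTypeR R) (th : O -> O) (g : nat -> R).
Hypothesis xi_iid : iid_shift P xi th.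
Hypothesis xi_law : forall x, P [set w | xi w < x] = (clamp x)%:E.
Hypothesis g_ge0 : forall k, (1 <= k)%N -> 0 <= g k.
Hypothesis g_sum1 : (\sum_(1 <= k <oo) (g k)%:E)%E = 1%E.

Local Notation s := (seed_shift th).
Local Notation X := (clump_process xi th g).
Local Notation lv := (level R).

Lemma point_process_exceedances n (v : R) :
  point_process (fun w => exceedance_process (ltn0Sn n) (fun k => X k w) v).
Proof.
move=> A mA; rewrite (_ : (fun w => _) = (fun w =>
   point_sum (fun k => k%:R / n.+1%:R) (fun k => (v < X k w)%R : nat) A)); last first.
  by apply/funext => w; exact: (exceedances_point_sum n.+1 (fun k => X k w) v A).
apply: ge0_emeasurable_sum => k *; first by rewrite mule_ge0// lee_fin.
apply: emeasurable_funM; last exact: measurable_cst.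
apply/measurable_EFinP.
apply: (@measurableT_comp _ _ _ _ _ _ (fun b : bool => (b : nat)%:R : R)) => //.
by apply: measurable_fun_ltr => //; exact: (measurable_clump_process xi_iid g_ge0 k).
Qed.

Variables (M J : nat) (c : nat -> nat).
Hypothesis M0 : (0 < M)%N.

Let a n := cell_start n M.

Let exceed n : set O := [set w | forall j, (j < J)%N ->
  (\sum_(a n j <= k < a n j.+1) (- lv n.+1 < X k w)%R)%N = c j].

Let marks n : set O := [set w | forall j, (j < J)%N ->
  (\sum_(a n j <= i < a n j.+1) mark xi th g (lv n.+1) (iter i s w))%N = c j].

Let lv01 n : 0 <= lv n <= 1.
Proof. by rewrite (ltW (level_gt0 _ n)) (ltW (level_lt1 _ n)). Qed.

Let cvg_marks : (fun n => fine (P (marks n))) @ \oo -->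
  \prod_(j < J) compound_pmf (M%:R^-1) (sizes g) (c j).
Proof.
rewrite (_ : (fun n => _) = (fun n => \prod_(j < J)
   conv_power (thinned (lv n.+1) (sizes g)) (a n j.+1 - a n j) (c j))).
  apply: cvg_big => [|j _]; first exact: (@mul_continuous R).
  apply: cvg_compound_level => //; first by rewrite invr_gt0 ltr0n.
  exact: cvg_cell_length.
apply/funext => n.
rewrite [P _](@block_sums_law _ _ _ P _ s (thinned (lv n.+1) (sizes g))
  (mark_iid xi_iid g_ge0 (lv n.+1)) (mark_law xi_iid xi_law g_ge0 g_sum1 (lv01 n.+1)) (a n) c J)//.
- exact: cell_start0.
- by move=> j; exact: cell_start_le.
Qed.

Let measurable_blocks (f : nat -> O -> nat) n : (forall k, measurable_fun setT (f k)) ->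
  measurable [set w | forall j, (j < J)%N ->
    (\sum_(a n j <= k < a n j.+1) f k w)%N = c j].
Proof.
move=> mf.
rewrite (_ : [set w | _] = \bigcap_(j < J)
   (fun w => (\sum_(a n j <= k < a n j.+1) f k w)%N) @^-1` [set c j]); last first.
  by apply/seteqP; split=> v h j; exact: h.
apply: bigcap_measurableType => j _; apply: preimageT_measurable => //.
elim: (index_iota _ _) => [|i t IH].
  by under eq_fun do rewrite big_nil; exact: measurable_cst.
by under eq_fun do rewrite big_cons; exact: measurable_fun_addn.
Qed.

(* The expected number of seeds in the window stays bounded. *)
Let window n : (a n J)%:R * lv n.+1 <= J.+1%:R.
Proof.
have h : (a n J <= J.+1 * n.+2)%N.
  apply: (@leq_trans (((J * n.+1).+1 * M) %/ M)%N); last by rewrite mulnK//; nia.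
  by apply: leq_div2r; nia.
apply: (@le_trans _ _ ((J.+1 * n.+2)%N%:R * n.+2%:R^-1)); last first.
  by rewrite natrM mulfK.
by apply: ler_pM => //; [exact: ltW (level_gt0 _ _)|rewrite ler_nat|exact: level_le].
Qed.

(** Off the bad event the counts of exceedances in the cells are sums of i.i.d.
    marks over blocks, whose law converges to the compound Poisson law. *)
Lemma cvg_exceedance_cells :
  P [set w | forall j, (j < J)%N ->
    exceedance_process (ltn0Sn n) (fun k => X k w) (- lv n.+1) (@cell R M j) = (c j)%:R%:E]
  @[n --> \oo] --> (\prod_(j < J) compound_pmf (M%:R^-1) (sizes g) (c j))%:E.
Proof.
have mexceed n : measurable (exceed n).
  apply: measurable_blocks => k; apply: (@measurableT_comp _ _ _ _ _ _ nat_of_bool) => //.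
  by apply: measurable_fun_ltr => //; exact: (measurable_clump_process xi_iid g_ge0 k).
have mmarks n : measurable (marks n).
  apply: measurable_blocks => k; apply: measurableT_comp.
    exact: (measurable_mark xi_iid).
  by apply: measurable_iter; exact: (measurable_seed_shift xi_iid).
rewrite (_ : (fun n => _) = (fun n => P (exceed n))); last first.
  apply/funext => n; congr (P _); apply/seteqP; split=> w /= h j jJ.
    have := h j jJ; rewrite [X in X = _ -> _](exceedances_cell n _ _ j M0) => -[] /eqP.
    by rewrite eqr_nat => /eqP.
  by rewrite [LHS](exceedances_cell n _ _ j M0) h.
apply: cvg_EFin; first by apply: nearW => n; exact: fin_num_measure.
pose tail K : R := J.+1%:R * size_tail P xi th g K + 2^-1 ^+ K.
pose coef K : R := J.+1%:R * K%:R + J%:R * K%:R + K%:R.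
apply: (@cvg_approx R _ (fun n => fine (P (marks n))) tail coef (fun n => lv n.+1)).
- move=> K; near=> n.
  have pK : lv n.+1 <= 2^-1 ^+ K.
    near: n; apply: (cvgr_le (0 : R)); last by rewrite exprn_gt0.
    by have := @cvg_level R; rewrite -cvg_shiftS.
  apply: (@fine_measure_dist _ _ _ P _ _ (bad xi th g (lv n.+1) K (a n J) J (a n))) => //.
  + exact: (measurable_bad xi_iid).
  + move=> w nbad; have E := exceedances_off_bad (a := a n) _ pK (fun j => cell_start_le n M j) nbad.
    by split=> h j jJ; [rewrite -E|rewrite E]; rewrite ?h// level_gt0 level_lt1.
  + apply: le_trans (bad_bound xi_iid xi_law g_ge0 K (a n J) J (a n) (lv01 n.+1)) _.
    rewrite lee_fin /tail /coef.
    have h0 := @window n; have h1 := size_tail_ge0 P xi th g K.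
    have h2 := ler_wpM2r h1 h0.
    have h3 : 0 <= K%:R * lv n.+1 by rewrite mulr_ge0// (ltW (level_gt0 _ _)).
    have h4 := ler_wpM2r h3 h0.
    move: h2 h4; set x := _ * size_tail _ _ _ _ _; set y := _ * (K%:R * _) => h2 h4.
    lra.
- rewrite /tail -[X in _ --> X]addr0 -[X in _ --> X + _](mulr0 J.+1%:R); apply: cvgD.
    by apply: cvgM; [exact: cvg_cst|exact: (cvg_size_tail xi_iid)].
  by apply: cvg_expr; rewrite gtr0_norm ?invr_gt0// invf_lt1// ltr1n.
- by have := @cvg_level R; rewrite -cvg_shiftS.
- exact: cvg_marks.
Unshelve. all: by end_near. Qed.

End convergence.

(** * Existence of the stationary process *)

Theorem theorem1 (R : realType) (g : nat -> R)
    (g_ge0 : forall k, (1 <= k)%N -> 0 <= g k)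
    (g_sum1 : (\sum_(1 <= k <oo) (g k)%:E)%E = 1%E) :
  exists (d : measure_display) (Omega : measurableType d)
    (P : probability Omega R) (X : nat -> {RV P >-> R}) (u : nat -> R),
    [/\ stationary X,
        increasing_seq u &
        exists (d' : measure_display) (Omega' : measurableType d')
          (P' : probability Omega' R) (N : Omega' -> counting_measure R),
          compound_poisson P' g N /\
          cvg_in_distribution P P'
            (fun n w => exceedance_process (ltn0Sn n)
                          (fun k => X k w) (u n.+1))
            N].
Proof.
have [d [S [P [xi [th [xi_iid xi_law]]]]]] := exists_uniform_sequence R.
have mX k : measurable_fun setT (clump_process xi th g k).
  exact: (measurable_clump_process xi_iid g_ge0).
pose X (k : nat) : {RV P >-> R} := HB.pack (clump_process xi th g k)
  (isMeasurableFun.Build _ _ _ _ (clump_process xi th g k) (mX k)).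
exists d, S, P, X, (fun n => - level R n).
split.
- by move=> l _ A mA; exact: (clump_process_stationary xi_iid g_ge0).
- exact: level_mono.
have [d' [S' [P' [N [cpN ppN lawN]]]]] := compound_poisson_exists g_ge0 g_sum1.
exists d', S', P', N; split=> //.
apply: cvg_in_distribution_cells => //.
  by move=> n; exact: (point_process_exceedances xi_iid g_ge0).
move=> m c; rewrite lawN//.
exact: (cvg_exceedance_cells xi_iid xi_law g_ge0 g_sum1).
Qed.
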